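(* Let $\Bbbk$ be a field and $\mathcal C$ a $\Bbbk$-linear monoidal category. For a choice $\mathtt W$ of a very cyclic generator $\mathtt W(\mathbf M)$ for each very cyclic $\mathcal C$-module category $\mathbf M$, the pseudofunctor $$\mathbb{N}_{\mathtt W}:\mathcal C\text{-Tamb}_c\to\mathrm{Bimod}(\mathcal C\text{-Tamb}(\mathcal C,\mathcal C)),\qquad \mathbf M\mapsto[\mathtt W(\mathbf M),\mathtt W(\mathbf M)],\quad (\mathtt\Psi:\mathbf M\nrightarrow\mathbf N)\mapsto\mathtt\Psi[\mathtt W(\mathbf N),\mathtt W(\mathbf M)],$$ is a biequivalence.
   Context: All categories, functors, etc. are $\Bbbk$-linear; $FG$ abbreviates $F\otimes G$ in $\mathcal C$. Module categories. A $\mathcal C$-module category is a category $\mathbf M$ with a strong monoidal functor $\mathcal C\to\mathrm{End}(\mathbf M)$, $F\mapsto\mathbf MF$, with coherence isomorphisms $\mathbf m_{G,F}:\mathbf MG\,\mathbf MF\Rightarrow\mathbf M(GF)$ and $\mathbf m_{\mathbb 1}:\mathrm{Id}_{\mathbf M}\Rightarrow\mathbf M\mathbb 1$. $\mathcal C$ is a module category over itself by left tensoring. Tambara modules. A profunctor $\mathbf M\nrightarrow\mathbf N$ is a functor $\mathbf N^{\mathrm{op}}\otimes_\Bbbk\mathbf M\to\mathbf{Vec}_\Bbbk$; composition is $(\mathtt\Psi\diamond\mathtt\Phi)(C,A)=\int^B\mathtt\Psi(C,B)\otimes_\Bbbk\mathtt\Phi(B,A)$. A Tambara module $\mathtt\Phi:\mathbf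 M\nrightarrow\mathbf N$ is a profunctor with linear maps $\mathsf t_{H;Y,X}:\mathtt\Phi(Y,X)\to\mathtt\Phi(\mathbf NH\,Y,\mathbf MH\,X)$, natural in $Y,X$, extranatural in $H\in\mathcal C$, such that $\mathtt\Phi((\mathbf n_{G,F})_Y,\mathrm{id})\circ\mathsf t_{GF;Y,X}=\mathtt\Phi(\mathrm{id},(\mathbf m_{G,F})_X)\circ\mathsf t_{G;\mathbf NFY,\mathbf MFX}\circ\mathsf t_{F;Y,X}$ and $\mathtt\Phi((\mathbf n_{\mathbb 1})_Y,(\mathbf m_{\mathbb 1})_X^{-1})\circ\mathsf t_{\mathbb 1;Y,X}=\mathrm{id}$. Tambara morphisms are profunctor morphisms commuting with the maps $\mathsf t$. Composites carry the Tambara structure induced by $\mathsf t^{\mathtt\Psi}\otimes\mathsf t^{\mathtt\Phi}$. This gives the bicategory $\mathcal C\text{-Tamb}$ of $\mathcal C$-module categories, Tambara modules, Tambara morphisms; the identity on $\mathbf M$ is the Hom-profunctor with structure $f\mapsto\mathbf MH(f)$. In particular $\mathcal C\text{-Tamb}(\mathcal C,\mathcal C)$ is a monoidal category under $\diamond$ with unit $\mathcal C(-,-)$; it has reflexive coequalizers preserved by $\diamond$ in each variable. Very cyclic. $\mathbf M$ is very cyclic if there is $X\in\mathbf M$ (a very cyclic generator) such that every object of $\mathbf M$ is isomorphic to $\mathbf MF\,X$ for some $F\in\mathcal C$. $\mathcal C\text{-Tamb}_c$ is the full sub-bicategory of $\mathcal C\text{-Tamb}$ on the very cyclic module categories. The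 pseudofunctor. For $\mathtt\Psi:\mathbf M\nrightarrow\mathbf N$, $X\in\mathbf M$, $Y\in\mathbf N$, $\mathtt\Psi[Y,X]:\mathcal C\nrightarrow\mathcal C$ is the profunctor $(F,G)\mapsto\mathtt\Psi(\mathbf NFY,\mathbf MGX)$ with Tambara structure $\mathtt\Psi(\mathbf n_{H,F}^{-1},\mathbf m_{H,G})\circ\mathsf t_{H;\mathbf NFY,\mathbf MGX}$. For $\mathbf M=\mathbf N$ and $\mathtt\Psi$ the identity, write $[Y,X]$. $[X,X]$ is a monoid in $\mathcal C\text{-Tamb}(\mathcal C,\mathcal C)$ with unit $\mathcal C(F,G)\ni f\mapsto(\mathbf Mf)_X$ and multiplication $b\otimes c\mapsto c\circ b$. $\mathtt\Psi[Y,X]$ is a $[Y,Y]$-$[X,X]$-bimodule with actions $f\otimes v\mapsto\mathtt\Psi(f,\mathrm{id})(v)$ and $v\otimes g\mapsto\mathtt\Psi(\mathrm{id},g)(v)$. $\mathrm{Bimod}(\mathcal A)$ is the bicategory of monoids, bimodules and bimodule morphisms in $\mathcal A$ with composition the relative tensor product; a 1-morphism $A\to B$ is a $B$-$A$-bimodule. On 2-morphisms $\mathbb N_{\mathtt W}$ sends a Tambara morphism $\mathtt t$ to $(\mathtt t_{\mathbf NFY,\mathbf MGX})_{F,G}$, with $X=\mathtt W(\mathbf M)$, $Y=\mathtt W(\mathbf N)$; its coherence isomorphisms $\mathtt\Sigma[Z,Y]\otimes_{[Y,Y]}\mathtt\Psi[Y,X]\to(\mathtt\Sigma\diamond\mathtt\Psi)[Z,X]$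 are induced by the canonical maps $\mathtt\Sigma(\mathbf NFZ,\mathbf MHY)\otimes\mathtt\Psi(\mathbf MHY,\mathbf KGX)\to\int^{U\in\mathbf M}\mathtt\Sigma(\mathbf NFZ,U)\otimes\mathtt\Psi(U,\mathbf KGX)$, and it is strictly unital. *)

(* Defs.v *)
From HB Require Import structures.
From mathcomp Require Import all_boot ssralg.
From mathcomp Require Import boolp.

Set Implicit Arguments.
Unset Strict Implicit.
Unset Printing Implicit Defensive.

Import GRing.Theory.
Local Open Scope ring_scope.

Section LinearMaps.
Context (k : fieldType).

Lemma linD (U V : lmodType k) (f : U -> V) :
  linear f -> forall u v, f (u + v) = f u + f v.
Proof. by move=> fl u v; have := fl 1 u v; rewrite !scale1r. Qed.

Lemma lin0 (U V : lmodType k) (f : U -> V) : linear f -> f 0 = 0.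
Proof. by move=> fl; have /eqP := linD fl 0 0; rewrite addr0 -subr_eq subrr => /eqP. Qed.

Lemma linZ (U V : lmodType k) (f : U -> V) :
  linear f -> forall a u, f (a *: u) = a *: f u.
Proof. by move=> fl a u; have := fl a u 0; rewrite !addr0 (lin0 fl) addr0. Qed.

Lemma lin_comp (U V W : lmodType k) (g : V -> W) (f : U -> V) :
  linear g -> linear f -> linear (g \o f).
Proof. by move=> gl fl a u v /=; rewrite fl gl. Qed.

End LinearMaps.

(* The vector space [uvs R] represents a "multi-linear" functor
   V |-> {f : T -> V | R V f}: formal linear combinations of elements of T,
   two of them being identified when every f satisfying R sends them to the
   same vector. When R is given by linear equations, the tautological map
   [ugen] satisfies R and is universal among the maps that do, see [uvsP] and
   [uvs_ext]. All tensor products, coends and cokernels below are of this form. *)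
Section UniversalSpace.
Context (k : fieldType) (T : Type) (R : forall V : lmodType k, (T -> V) -> Prop).
Implicit Types s t : seq (k * T).

Definition lcomb (V : lmodType k) (f : T -> V) s : V :=
  \sum_(x <- s) x.1 *: f x.2.

Definition ueq s t : Prop :=
  forall (V : lmodType k) (f : T -> V), R f -> lcomb f s = lcomb f t.

Definition uvs : Type := {P : seq (k * T) -> Prop | exists s, P = ueq s}.

Definition upi s : uvs := exist _ (ueq s) (ex_intro _ s erefl).
Definition urepr (x : uvs) : seq (k * T) := projT1 (cid (projT2 x)).

Lemma upiP s t : ueq s t -> upi s = upi t.
Proof.
move=> st; apply: eq_exist; apply: funext => r; apply: propext.
by split=> h V f Rf; rewrite -h // st.
Qed.

Lemma ureprK x : upi (urepr x) = x.
Proof.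
case: x => P p; rewrite /urepr /=; case: cid => s /= Ps.
by apply: eq_exist; rewrite Ps.
Qed.

Lemma upi_eq s t : upi s = upi t -> ueq s t.
Proof. by case=> e; rewrite e => V f Rf. Qed.

Lemma ureprP s : ueq (urepr (upi s)) s.
Proof. by apply: upi_eq; rewrite ureprK. Qed.

Lemma lcomb_cat (V : lmodType k) (f : T -> V) s t :
  lcomb f (s ++ t) = lcomb f s + lcomb f t.
Proof. exact: big_cat. Qed.

Lemma lcomb_scale (V : lmodType k) (f : T -> V) a s :
  lcomb f [seq (a * x.1, x.2) | x <- s] = a *: lcomb f s.
Proof.
by rewrite /lcomb big_map scaler_sumr; apply: eq_bigr => x _; rewrite scalerA.
Qed.

Definition uadd x y := upi (urepr x ++ urepr y).
Definition uscale a x := upi [seq (a * z.1, z.2) | z <- urepr x].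
Definition uzero := upi [::].
Definition uopp x := uscale (-1) x.

Lemma uaddE s t : uadd (upi s) (upi t) = upi (s ++ t).
Proof. by apply: upiP => V f Rf; rewrite !lcomb_cat !(ureprP _ Rf). Qed.

Lemma uscaleE a s : uscale a (upi s) = upi [seq (a * z.1, z.2) | z <- s].
Proof. by apply: upiP => V f Rf; rewrite !lcomb_scale !(ureprP _ Rf). Qed.

Lemma uaddA : associative uadd.
Proof.
move=> x y z; rewrite -(ureprK x) -(ureprK y) -(ureprK z) !uaddE.
by rewrite catA.
Qed.

Lemma uaddC : commutative uadd.
Proof.
move=> x y; apply: upiP => V f Rf.
by rewrite !lcomb_cat addrC.
Qed.

Lemma uadd0 : left_id uzero uadd.
Proof. by move=> x; rewrite -{2}(ureprK x) -(ureprK x) uaddE ureprK. Qed.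

Lemma uaddN : left_inverse uzero uopp uadd.
Proof.
move=> x; rewrite -(ureprK x) /uopp uscaleE uaddE; apply: upiP => V f Rf.
by rewrite lcomb_cat lcomb_scale scaleN1r addNr /lcomb big_nil.
Qed.

HB.instance Definition _ := gen_eqMixin uvs.
HB.instance Definition _ := gen_choiceMixin uvs.
HB.instance Definition _ := GRing.isZmodule.Build uvs uaddA uaddC uadd0 uaddN.

Lemma uscaleA a b x : uscale a (uscale b x) = uscale (a * b) x.
Proof.
rewrite -(ureprK x) !uscaleE; apply: upiP => V f Rf.
by rewrite !lcomb_scale scalerA.
Qed.

Lemma uscale1 : left_id 1 uscale.
Proof.
move=> x; rewrite -(ureprK x) !uscaleE; apply: upiP => V f Rf.
by rewrite !lcomb_scale scale1r.
Qed.

Lemma uscaleDr : right_distributive uscale +%R.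
Proof.
move=> a x y; rewrite -(ureprK x) -(ureprK y) /GRing.add /= !(uscaleE, uaddE).
by apply: upiP => V f Rf; rewrite !(lcomb_scale, lcomb_cat) scalerDr.
Qed.

Lemma uscaleDl x : {morph uscale^~ x : a b / a + b >-> a + b}.
Proof.
move=> a b; rewrite -(ureprK x) /GRing.add /= !(uscaleE, uaddE).
by apply: upiP => V f Rf; rewrite !(lcomb_scale, lcomb_cat) scalerDl.
Qed.

HB.instance Definition _ :=
  GRing.Zmodule_isLmodule.Build k uvs uscaleA uscale1 uscaleDr uscaleDl.

Definition ugen (t : T) : uvs := upi [:: (1, t)].

Definition ulift (V : lmodType k) (f : T -> V) (x : uvs) : V := lcomb f (urepr x).

Lemma uliftE (V : lmodType k) (f : T -> V) s : R f -> ulift f (upi s) = lcomb f s.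
Proof. by move=> Rf; rewrite /ulift (ureprP _ Rf). Qed.

Lemma uvsP (V : lmodType k) (f : T -> V) :
  R f -> linear (ulift f) /\ forall t : T, ulift f (ugen t) = f t.
Proof.
move=> Rf; split=> [a x y|t]; last first.
  by rewrite /ugen uliftE // /lcomb big_seq1 scale1r.
rewrite -(ureprK x) -(ureprK y).
rewrite [a *: _]uscaleE [_ + upi (urepr y)]uaddE !uliftE //.
by rewrite lcomb_cat lcomb_scale.
Qed.

Lemma upi_sum s : upi s = \sum_(x <- s) x.1 *: ugen x.2.
Proof.
elim: s => [|[a t] s IH]; first by rewrite big_nil.
rewrite big_cons -IH /= [_ *: _]uscaleE [_ + _]uaddE /=.
by rewrite mulr1.
Qed.

Lemma uvs_ext (V : lmodType k) (f g : uvs -> V) :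
  linear f -> linear g -> (forall t : T, f (ugen t) = g (ugen t)) -> f =1 g.
Proof.
move=> fl gl fg x; rewrite -(ureprK x) upi_sum.
elim: (urepr x) => [|y s IH]; first by rewrite big_nil !lin0.
by rewrite big_cons fl gl fg IH.
Qed.

(* To be used to check that ugen satisfies R. *)
Lemma upi_lin a s t : a *: upi s + upi t = upi ([seq (a * z.1, z.2) | z <- s] ++ t).
Proof. by rewrite [_ *: _]uscaleE [_ + _]uaddE. Qed.

Lemma lcomb1 (V : lmodType k) (f : T -> V) (t : T) : lcomb f [:: (1, t)] = f t.
Proof. by rewrite /lcomb big_seq1 scale1r. Qed.

End UniversalSpace.

Reserved Notation "g ∘ f" (at level 40, left associativity).

Section Categories.
Context (k : fieldType).

Record lincat := LinCat {
  lob :> Type;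
  hom : lob -> lob -> lmodType k;
  idm : forall x, hom x x;
  cmp : forall x y z, hom y z -> hom x y -> hom x z;
  cmp_linl : forall x y z (f : hom x y), linear (fun g : hom y z => cmp g f);
  cmp_linr : forall x y z (g : hom y z), linear (fun f : hom x y => cmp g f);
  cmpA : forall x y z t (h : hom z t) (g : hom y z) (f : hom x y),
    cmp h (cmp g f) = cmp (cmp h g) f;
  cmp1m : forall x y (f : hom x y), cmp (idm y) f = f;
  cmpm1 : forall x y (f : hom x y), cmp f (idm x) = f }.

End Categories.

Arguments hom {k l} _ _ : rename.
Arguments idm {k l} x : rename.
Arguments cmp {k l x y z} _ _ : rename.
Notation "g ∘ f" := (cmp g f) : ring_scope.

Section Functors.
Context (k : fieldType).

Record linfunctor (M N : lincat k) := LinFunctor {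
  fob :> M -> N;
  fmap : forall X Y, hom X Y -> hom (fob X) (fob Y);
  fmap_lin : forall X Y, linear (@fmap X Y);
  fmap1 : forall X, fmap (idm X) = idm (fob X);
  fmapM : forall X Y Z (g : hom Y Z) (f : hom X Y),
    fmap (g ∘ f) = fmap g ∘ fmap f }.

Definition is_iso (M : lincat k) (X Y : M) (f : hom X Y) : Prop :=
  exists g : hom Y X, g ∘ f = idm X /\ f ∘ g = idm Y.

Definition isomorphic (M : lincat k) (X Y : M) : Prop :=
  exists f : hom X Y, is_iso f.

Record moncat := MonCat {
  moncat_cat :> lincat k;
  ten : moncat_cat -> moncat_cat -> moncat_cat;
  tenm : forall F F' G G',
    hom F F' -> hom G G' -> hom (ten F G) (ten F' G');
  tenm_linl : forall F F' G G' (g : hom G G'),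
    linear (fun f : hom F F' => tenm f g);
  tenm_linr : forall F F' G G' (f : hom F F'),
    linear (fun g : hom G G' => tenm f g);
  tenm1 : forall F G, tenm (idm F) (idm G) = idm (ten F G);
  tenmM : forall F F' F'' G G' G''
      (f' : hom F' F'') (f : hom F F') (g' : hom G' G'') (g : hom G G'),
    tenm (f' ∘ f) (g' ∘ g) = tenm f' g' ∘ tenm f g;
  tunit : moncat_cat;
  asso : forall F G H, hom (ten (ten F G) H) (ten F (ten G H));
  asso_inv : forall F G H, hom (ten F (ten G H)) (ten (ten F G) H);
  assoK : forall F G H, asso_inv F G H ∘ asso F G H = idm _;
  assoVK : forall F G H, asso F G H ∘ asso_inv F G H = idm _;
  asso_nat : forall F F' G G' H H' (f : hom F F') (g : hom G G') (h : hom H H'),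
    asso F' G' H' ∘ tenm (tenm f g) h = tenm f (tenm g h) ∘ asso F G H;
  luni : forall F, hom (ten tunit F) F;
  luni_inv : forall F, hom F (ten tunit F);
  luniK : forall F, luni_inv F ∘ luni F = idm _;
  luniVK : forall F, luni F ∘ luni_inv F = idm _;
  luni_nat : forall F F' (f : hom F F'),
    luni F' ∘ tenm (idm tunit) f = f ∘ luni F;
  runi : forall F, hom (ten F tunit) F;
  runi_inv : forall F, hom F (ten F tunit);
  runiK : forall F, runi_inv F ∘ runi F = idm _;
  runiVK : forall F, runi F ∘ runi_inv F = idm _;
  runi_nat : forall F F' (f : hom F F'),
    runi F' ∘ tenm f (idm tunit) = f ∘ runi F;
  pentagon : forall F G H K,
    tenm (idm F) (asso G H K) ∘ asso F (ten G H) K ∘ tenm (asso F G H) (idm K)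
    = asso F G (ten H K) ∘ asso (ten F G) H K;
  triangle : forall F G,
    tenm (idm F) (luni G) ∘ asso F tunit G = tenm (runi F) (idm G) }.

End Functors.

Arguments fmap {k M N} _ {X Y} _.
Arguments tunit {k} _.
Arguments ten {k _} _ _.

Section LinearityRules.
Context (k : fieldType).

Lemma cmpPl (M : lincat k) (x y z : M) a (g g' : hom y z) (f : hom x y) :
  (a *: g + g') ∘ f = a *: (g ∘ f) + g' ∘ f.
Proof. exact: cmp_linl. Qed.

Lemma cmpPr (M : lincat k) (x y z : M) a (g : hom y z) (f f' : hom x y) :
  g ∘ (a *: f + f') = a *: (g ∘ f) + g ∘ f'.
Proof. exact: cmp_linr. Qed.

Lemma tenmPl (C : moncat k) (F F' G G' : C) a (f f' : hom F F') (g : hom G G') :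
  tenm (a *: f + f') g = a *: tenm f g + tenm f' g.
Proof. exact: (tenm_linl g a f f'). Qed.

Lemma tenmPr (C : moncat k) (F F' G G' : C) a (f : hom F F') (g g' : hom G G') :
  tenm f (a *: g + g') = a *: tenm f g + tenm f g'.
Proof. exact: (tenm_linr f a g g'). Qed.

Lemma cmp_mono (M : lincat k) (x y z : M) (e : hom y z) (e' : hom z y)
  (f g : hom x y) : e' ∘ e = idm y -> e ∘ f = e ∘ g -> f = g.
Proof. by move=> ee fg; rewrite -[f]cmp1m -[g]cmp1m -ee -!cmpA fg. Qed.

Lemma cmp_epi (M : lincat k) (x y z : M) (e : hom x y) (e' : hom y x)
  (f g : hom y z) : e ∘ e' = idm y -> f ∘ e = g ∘ e -> f = g.
Proof. by move=> ee fg; rewrite -[f]cmpm1 -[g]cmpm1 -ee !cmpA fg. Qed.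

(* Kelly's consequence of the pentagon and triangle axioms. *)
Lemma luni_ten (C : moncat k) (F G : C) :
  luni (ten F G) ∘ asso (tunit C) F G = tenm (luni F) (idm G).
Proof.
have faith (X Y : C) (f g : hom X Y) :
    tenm (idm (tunit C)) f = tenm (idm (tunit C)) g -> f = g.
  move=> fg; apply: (cmp_epi (luniVK X)).
  by rewrite -!luni_nat fg.
apply: faith; rewrite -(cmp1m (idm (tunit C))) tenmM.
have e1 : tenm (asso (tunit C) (tunit C) F) (idm G)
          ∘ tenm (asso_inv (tunit C) (tunit C) F) (idm G) = idm _.
  by rewrite -tenmM assoVK cmp1m tenm1.
have e2 := assoVK (tunit C) (ten (tunit C) F) G.
apply: (cmp_epi e2); apply: (cmp_epi e1).
rewrite -!cmpA (cmpA (tenm _ (asso _ _ _))) pentagon cmpA triangle.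
rewrite -(tenm1 F G) -asso_nat -triangle.
rewrite -[in LHS](cmp1m (idm G)) tenmM !cmpA asso_nat.
by rewrite cmp1m.
Qed.

End LinearityRules.

Section Modules.
Context (k : fieldType) (C : moncat k).

(* A module category: a strong monoidal functor from C to the endofunctors of
   [mcat], with [mact F] for the image of F, [mactm f X] for the component at X
   of the image of f, and [mmul], [mone] for the coherence isomorphisms. *)
Record modcat := ModCat {
  mcat :> lincat k;
  mact : C -> linfunctor mcat mcat;
  mactm : forall F G (f : hom F G) X, hom (mact F X) (mact G X);
  mactm_nat : forall F G (f : hom F G) X Y (x : hom X Y),
    fmap (mact G) x ∘ mactm f X = mactm f Y ∘ fmap (mact F) x;
  mactm_lin : forall F G X, linear (fun f : hom F G => mactm f X);
  mactm1 : forall F X, mactm (idm F) X = idm (mact F X);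
  mactmM : forall F G H (g : hom G H) (f : hom F G) X,
    mactm (g ∘ f) X = mactm g X ∘ mactm f X;
  mmul : forall G F X, hom (mact G (mact F X)) (mact (ten G F) X);
  mmul_inv : forall G F X, hom (mact (ten G F) X) (mact G (mact F X));
  mmulK : forall G F X, mmul_inv G F X ∘ mmul G F X = idm _;
  mmulVK : forall G F X, mmul G F X ∘ mmul_inv G F X = idm _;
  mmul_natX : forall G F X Y (x : hom X Y),
    fmap (mact (ten G F)) x ∘ mmul G F X
    = mmul G F Y ∘ fmap (mact G) (fmap (mact F) x);
  mmul_nat : forall G G' F F' (g : hom G G') (f : hom F F') X,
    mactm (tenm g f) X ∘ mmul G F X
    = mmul G' F' X ∘ (mactm g (mact F' X) ∘ fmap (mact G) (mactm f X));
  mone : forall X, hom X (mact (tunit C) X);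
  mone_inv : forall X, hom (mact (tunit C) X) X;
  moneK : forall X, mone_inv X ∘ mone X = idm _;
  moneVK : forall X, mone X ∘ mone_inv X = idm _;
  mone_nat : forall X Y (x : hom X Y),
    fmap (mact (tunit C)) x ∘ mone X = mone Y ∘ x;
  mmulA : forall H G F X,
    mactm (asso H G F) X ∘ (mmul (ten H G) F X ∘ mmul H G (mact F X))
    = mmul H (ten G F) X ∘ fmap (mact H) (mmul G F X);
  mmul1l : forall F X,
    mactm (luni F) X ∘ (mmul (tunit C) F X ∘ mone (mact F X)) = idm _;
  mmul1r : forall F X,
    mactm (runi F) X ∘ (mmul F (tunit C) X ∘ fmap (mact F) (mone X)) = idm _ }.

Lemma mactmP (M : modcat) (F G : C) (X : M) a (f g : hom F G) :
  mactm (a *: f + g) X = a *: mactm f X + mactm g X.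
Proof. exact: (@mactm_lin M F G X a f g). Qed.

Definition very_cyclic_generator (M : modcat) (X : M) : Prop :=
  forall Y : M, exists F : C, isomorphic Y (mact M F X).

Definition very_cyclic (M : modcat) : Prop := exists X : M, very_cyclic_generator X.

Section Regular.

Lemma reg_lin (F X Y : C) : linear (fun x : hom X Y => tenm (idm F) x).
Proof. by move=> a u v; rewrite tenmPr. Qed.

Lemma reg_cmp (F X Y Z : C) (g : hom Y Z) (f : hom X Y) :
  tenm (idm F) (g ∘ f) = tenm (idm F) g ∘ tenm (idm F) f.
Proof. by rewrite -tenmM cmp1m. Qed.

Definition reg_act (F : C) : linfunctor C C :=
  LinFunctor (@reg_lin F) (fun X => tenm1 F X) (@reg_cmp F).

Lemma asso_inv_nat (F F' G G' H H' : C)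
    (f : hom F F') (g : hom G G') (h : hom H H') :
  tenm (tenm f g) h ∘ asso_inv F G H = asso_inv F' G' H' ∘ tenm f (tenm g h).
Proof.
apply: (cmp_mono (assoK F' G' H')).
by rewrite !cmpA asso_nat assoVK cmp1m -cmpA assoVK cmpm1.
Qed.

Lemma reg_nat (F G : C) (f : hom F G) (X Y : C) (x : hom X Y) :
  tenm (idm G) x ∘ tenm f (idm X) = tenm f (idm Y) ∘ tenm (idm F) x.
Proof. by rewrite -!tenmM !cmp1m !cmpm1. Qed.

Lemma reg_mactmM (F G H : C) (g : hom G H) (f : hom F G) (X : C) :
  tenm (g ∘ f) (idm X) = tenm g (idm X) ∘ tenm f (idm X).
Proof. by rewrite -tenmM cmp1m. Qed.

Lemma reg_mul_natX (G F X Y : C) (x : hom X Y) :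
  tenm (idm (ten G F)) x ∘ asso_inv G F X
  = asso_inv G F Y ∘ tenm (idm G) (tenm (idm F) x).
Proof. by rewrite -tenm1 asso_inv_nat. Qed.

Lemma reg_mul_nat (G G' F F' : C) (g : hom G G') (f : hom F F') (X : C) :
  tenm (tenm g f) (idm X) ∘ asso_inv G F X
  = asso_inv G' F' X
    ∘ (tenm g (idm (ten F' X)) ∘ tenm (idm G) (tenm f (idm X))).
Proof. by rewrite asso_inv_nat -tenmM cmpm1 cmp1m. Qed.

Lemma reg_one_nat (X Y : C) (x : hom X Y) :
  tenm (idm (tunit C)) x ∘ luni_inv X = luni_inv Y ∘ x.
Proof.
apply: (cmp_mono (luniK Y)).
by rewrite !cmpA luni_nat luniVK cmp1m -cmpA luniVK cmpm1.
Qed.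

Lemma reg_mulA (H G F X : C) :
  tenm (asso H G F) (idm X) ∘ (asso_inv (ten H G) F X ∘ asso_inv H G (ten F X))
  = asso_inv H (ten G F) X ∘ tenm (idm H) (asso_inv G F X).
Proof.
apply: (cmp_mono (assoK _ _ _)); rewrite !cmpA assoVK cmp1m.
have e : tenm (idm H) (asso_inv G F X) ∘ tenm (idm H) (asso G F X) = idm _.
  by rewrite -tenmM assoK cmpm1 tenm1.
apply: (cmp_mono (e' := tenm (idm H) (asso_inv G F X)) e).
rewrite !cmpA pentagon -(cmpA (asso _ _ _)) assoVK cmpm1 assoVK.
by rewrite -tenmM assoVK cmpm1 tenm1.
Qed.

Lemma reg_mul1l (F X : C) :
  tenm (luni F) (idm X) ∘ (asso_inv (tunit C) F X ∘ luni_inv (ten F X)) = idm _.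
Proof.
by rewrite -luni_ten cmpA -(cmpA (luni _)) assoVK cmpm1 luniVK.
Qed.

Lemma reg_mul1r (F X : C) :
  tenm (runi F) (idm X) ∘ (asso_inv F (tunit C) X ∘ tenm (idm F) (luni_inv X))
  = idm _.
Proof.
rewrite -triangle cmpA -(cmpA (tenm _ _)) assoVK cmpm1.
by rewrite -tenmM luniVK cmpm1 tenm1.
Qed.

Definition regular : modcat := @ModCat C reg_act
  (fun F G f X => tenm f (idm X)) reg_nat
  (fun F G X => tenm_linl (idm X)) (fun F X => tenm1 F X) reg_mactmM
  (fun G F X => asso_inv G F X) (fun G F X => asso G F X)
  (fun G F X => assoVK G F X) (fun G F X => assoK G F X)
  reg_mul_natX reg_mul_nat
  (fun X => luni_inv X) (fun X => luni X)
  (fun X => luniVK X) (fun X => luniK X) reg_one_nat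
  reg_mulA reg_mul1l reg_mul1r.

End Regular.

End Modules.

Arguments mact {k C} _ _.
Arguments mactm {k C} _ {F G} _ _.
Arguments mmul {k C} _ _ _ _.
Arguments mmul_inv {k C} _ _ _ _.
Arguments mone {k C} _ _.
Arguments mone_inv {k C} _ _.

Section Profunctors.
Context (k : fieldType).

(* A profunctor from M to N, i.e. a functor N^op (x) M -> Vec: the first argument
   of [pob] is the contravariant one. *)
Record prof (M N : lincat k) := Prof {
  pob :> N -> M -> lmodType k;
  pmap : forall Y Y' X X', hom Y' Y -> hom X X' -> pob Y X -> pob Y' X';
  pmap_lin : forall Y Y' X X' (f : hom Y' Y) (g : hom X X'), linear (pmap f g);
  pmap_linl : forall Y Y' X X' (g : hom X X') (v : pob Y X),
    linear (fun f : hom Y' Y => pmap f g v);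
  pmap_linr : forall Y Y' X X' (f : hom Y' Y) (v : pob Y X),
    linear (fun g : hom X X' => pmap f g v);
  pmap1 : forall Y X (v : pob Y X), pmap (idm Y) (idm X) v = v;
  pmapM : forall Y Y' Y'' X X' X'' (f : hom Y' Y) (f' : hom Y'' Y')
      (g : hom X X') (g' : hom X' X'') (v : pob Y X),
    pmap (f ∘ f') (g' ∘ g) v = pmap f' g' (pmap f g v) }.

Lemma pmapPv (M N : lincat k) (P : prof M N) (Y Y' : N) (X X' : M)
    (f : hom Y' Y) (g : hom X X') a (u v : P Y X) :
  pmap f g (a *: u + v) = a *: pmap f g u + pmap f g v.
Proof. exact: (pmap_lin f g a u v). Qed.

Lemma pmapPl (M N : lincat k) (P : prof M N) (Y Y' : N) (X X' : M) a
    (f f' : hom Y' Y) (g : hom X X') (v : P Y X) :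
  pmap (a *: f + f') g v = a *: pmap f g v + pmap f' g v.
Proof. exact: (pmap_linl g v a f f'). Qed.

Lemma pmapPr (M N : lincat k) (P : prof M N) (Y Y' : N) (X X' : M) a
    (f : hom Y' Y) (g g' : hom X X') (v : P Y X) :
  pmap f (a *: g + g') v = a *: pmap f g v + pmap f g' v.
Proof. exact: (pmap_linr f v a g g'). Qed.

(* pmap f g is the composite of the two one-sided actions, in any order. *)
Lemma pmap_lr (M N : lincat k) (P : prof M N) (Y Y' : N) (X X' : M)
    (f : hom Y' Y) (g : hom X X') (v : P Y X) :
  pmap f g v = pmap f (idm X') (pmap (idm Y) g v).
Proof. by rewrite -pmapM !cmp1m. Qed.

Lemma pmap_rl (M N : lincat k) (P : prof M N) (Y Y' : N) (X X' : M)
    (f : hom Y' Y) (g : hom X X') (v : P Y X) :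
  pmap f g v = pmap (idm Y') g (pmap f (idm X) v).
Proof. by rewrite -pmapM !cmpm1. Qed.

Definition homprof_map (M : lincat k) (Y Y' X X' : M) (f : hom Y' Y)
  (g : hom X X') (v : hom Y X) : hom Y' X' := g ∘ v ∘ f.

Section HomProf.
Context (M : lincat k).

Lemma homprof_lin (Y Y' X X' : M) (f : hom Y' Y) (g : hom X X') :
  linear (homprof_map f g).
Proof. by move=> a u v; rewrite /homprof_map cmpPr cmpPl. Qed.

Lemma homprof_linl (Y Y' X X' : M) (g : hom X X') (v : hom Y X) :
  linear (fun f : hom Y' Y => homprof_map f g v).
Proof. by move=> a f f'; rewrite /homprof_map cmpPr. Qed.

Lemma homprof_linr (Y Y' X X' : M) (f : hom Y' Y) (v : hom Y X) :
  linear (fun g : hom X X' => homprof_map f g v).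
Proof. by move=> a g g'; rewrite /homprof_map !cmpPl. Qed.

Lemma homprof1 (Y X : M) (v : hom Y X) : homprof_map (idm Y) (idm X) v = v.
Proof. by rewrite /homprof_map cmp1m cmpm1. Qed.

Lemma homprofM (Y Y' Y'' X X' X'' : M) (f : hom Y' Y) (f' : hom Y'' Y')
    (g : hom X X') (g' : hom X' X'') (v : hom Y X) :
  homprof_map (f ∘ f') (g' ∘ g) v = homprof_map f' g' (homprof_map f g v).
Proof. by rewrite /homprof_map !cmpA. Qed.

Definition homprof : prof M M :=
  Prof homprof_lin homprof_linl homprof_linr homprof1 homprofM.

End HomProf.

Section Coend.
Context (M N K : lincat k) (Psi : prof N K) (Phi : prof M N).

Definition balanced (Z : K) (X : M) (V : lmodType k)
    (f : {Y : N & (Psi Z Y * Phi Y X)%type} -> V) : Prop :=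
  [/\ forall Y (q : Phi Y X), linear (fun p : Psi Z Y => f (existT _ Y (p, q))),
      forall Y (p : Psi Z Y), linear (fun q : Phi Y X => f (existT _ Y (p, q)))
    & forall Y Y' (h : hom Y Y') (p : Psi Z Y) (q : Phi Y' X),
        f (existT _ Y' (pmap (idm Z) h p, q))
        = f (existT _ Y (p, pmap h (idm X) q))].

(* The coend of Psi(Z, Y) (x) Phi(Y, X) over Y in N. Its elements are spanned by
   the classes [cgen p q] of pure tensors. *)
Definition coend (Z : K) (X : M) : lmodType k := uvs (@balanced Z X).

Context (Z : K) (X : M).

Definition cgen (Y : N) (p : Psi Z Y) (q : Phi Y X) : coend Z X :=
  ugen (@balanced Z X) (existT _ Y (p, q)).

Lemma cgenPl (Y : N) a (p p' : Psi Z Y) (q : Phi Y X) :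
  cgen (a *: p + p') q = a *: cgen p q + cgen p' q.
Proof.
rewrite /cgen /ugen upi_lin; apply: upiP => V f Rf.
rewrite lcomb_cat lcomb_scale !lcomb1; case: Rf => Rf _ _; exact: Rf.
Qed.

Lemma cgenPr (Y : N) a (p : Psi Z Y) (q q' : Phi Y X) :
  cgen p (a *: q + q') = a *: cgen p q + cgen p q'.
Proof.
rewrite /cgen /ugen upi_lin; apply: upiP => V f Rf.
rewrite lcomb_cat lcomb_scale !lcomb1; case: Rf => _ Rf _; exact: Rf.
Qed.

Lemma cgen_bal (Y Y' : N) (h : hom Y Y') (p : Psi Z Y) (q : Phi Y' X) :
  cgen (pmap (idm Z) h p) q = cgen p (pmap h (idm X) q).
Proof.
apply: upiP => V f Rf.
rewrite !lcomb1; case: Rf => _ _ Rf; exact: Rf.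
Qed.

Section Lift.
Context (V : lmodType k) (g : forall Y, Psi Z Y -> Phi Y X -> V).

Definition cbal : Prop :=
  [/\ forall Y (q : Phi Y X), linear (fun p : Psi Z Y => g p q),
      forall Y (p : Psi Z Y), linear (g p)
    & forall Y Y' (h : hom Y Y') (p : Psi Z Y) (q : Phi Y' X),
        g (pmap (idm Z) h p) q = g p (pmap h (idm X) q)].

Definition clift (x : coend Z X) : V :=
  ulift (fun t => g (projT2 t).1 (projT2 t).2) x.

Lemma clift_lin : cbal -> linear clift.
Proof. by move=> gb; have [] := uvsP (R := @balanced Z X) (f := fun t => g (projT2 t).1 (projT2 t).2) gb. Qed.

Lemma clift_gen : cbal -> forall Y (p : Psi Z Y) (q : Phi Y X), clift (cgen p q) = g p q.
Proof.
move=> gb Y p q.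
by have [_ e] := uvsP (R := @balanced Z X) (f := fun t => g (projT2 t).1 (projT2 t).2) gb; apply: e.
Qed.

End Lift.

Lemma coend_ext (V : lmodType k) (f g : coend Z X -> V) :
  linear f -> linear g ->
  (forall Y (p : Psi Z Y) (q : Phi Y X), f (cgen p q) = g (cgen p q)) -> f =1 g.
Proof. by move=> fl gl fg; apply: uvs_ext => // -[Y [p q]]; apply: fg. Qed.

End Coend.

Section Compose.
Context (M N K : lincat k) (Psi : prof N K) (Phi : prof M N).

Definition comp_map (Z Z' : K) (X X' : M) (f : hom Z' Z) (g : hom X X') :
  coend Psi Phi Z X -> coend Psi Phi Z' X' :=
  clift (fun Y (p : Psi Z Y) (q : Phi Y X) =>
           cgen (pmap f (idm Y) p) (pmap (idm Y) g q)).

Lemma comp_map_bal (Z Z' : K) (X X' : M) (f : hom Z' Z) (g : hom X X') :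
  cbal (fun Y (p : Psi Z Y) (q : Phi Y X) =>
           cgen (pmap f (idm Y) p) (pmap (idm Y) g q)).
Proof.
split=> [Y q a u v|Y p a u v|Y Y' h p q].
- by rewrite pmapPv cgenPl.
- by rewrite pmapPv cgenPr.
- by rewrite -pmap_lr pmap_rl cgen_bal -pmap_lr -pmap_rl.
Qed.

Lemma comp_map_gen (Z Z' : K) (X X' : M) (f : hom Z' Z) (g : hom X X') Y
    (p : Psi Z Y) (q : Phi Y X) :
  comp_map f g (cgen p q) = cgen (pmap f (idm Y) p) (pmap (idm Y) g q).
Proof. exact: (clift_gen (comp_map_bal f g)). Qed.

Lemma comp_map_lin (Z Z' : K) (X X' : M) (f : hom Z' Z) (g : hom X X') :
  linear (comp_map f g).
Proof. exact: (clift_lin (comp_map_bal f g)). Qed.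

Lemma comp_mapPv (Z Z' : K) (X X' : M) (f : hom Z' Z) (g : hom X X') a u v :
  comp_map f g (a *: u + v) = a *: comp_map f g u + comp_map f g v.
Proof. exact: comp_map_lin. Qed.

Lemma comp_map_linl (Z Z' : K) (X X' : M) (g : hom X X') v :
  linear (fun f : hom Z' Z => comp_map f g v).
Proof.
move=> a f f'; move: v; apply: coend_ext => [b u v|b u v|Y p q].
- by rewrite !comp_mapPv.
- rewrite !comp_mapPv !scalerDr !scalerA (mulrC a) -!addrA; congr (_ + _).
  by rewrite !addrA; congr (_ + _); rewrite addrC.
- by rewrite !comp_map_gen pmapPl cgenPl.
Qed.

Lemma comp_map_linr (Z Z' : K) (X X' : M) (f : hom Z' Z) v :
  linear (fun g : hom X X' => comp_map f g v).
Proof.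
move=> a g g'; move: v; apply: coend_ext => [b u v|b u v|Y p q].
- by rewrite !comp_mapPv.
- rewrite !comp_mapPv !scalerDr !scalerA (mulrC a) -!addrA; congr (_ + _).
  by rewrite !addrA; congr (_ + _); rewrite addrC.
- by rewrite !comp_map_gen pmapPr cgenPr.
Qed.

Lemma comp_map1 (Z : K) (X : M) v : comp_map (idm Z) (idm X) v = v.
Proof.
move: v; apply: coend_ext => [b u v|//|Y p q]; first by rewrite comp_mapPv.
by rewrite comp_map_gen !pmap1.
Qed.

Lemma comp_mapM (Z Z' Z'' : K) (X X' X'' : M) (f : hom Z' Z) (f' : hom Z'' Z')
      (g : hom X X') (g' : hom X' X'') v :
    comp_map (f ∘ f') (g' ∘ g) v = comp_map f' g' (comp_map f g v).
Proof.
move: v; apply: coend_ext => [b u v|b u v|Y p q].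
- by rewrite comp_mapPv.
- by rewrite !comp_mapPv.
- by rewrite !comp_map_gen -!pmapM !cmp1m.
Qed.

Definition comp_prof : prof M K :=
  Prof comp_map_lin comp_map_linl comp_map_linr comp_map1 comp_mapM.

End Compose.

End Profunctors.

Arguments cgen {k M N K Psi Phi Z X Y} _ _.

Section Bicategories.
Context (k : fieldType).

(* k-linear bicategories (vector spaces of 2-cells, bilinear compositions), presented by hom-categories ([cell2], [id2], [vcomp])
   and composition functors ([comp1], [hcomp]); both compositions are written
   right to left. *)
Record bicat := Bicat {
  bob :> Type;
  cell1 : bob -> bob -> Type;
  cell2 : forall a b, cell1 a b -> cell1 a b -> lmodType k;
  id1 : forall a, cell1 a a;
  comp1 : forall a b c, cell1 b c -> cell1 a b -> cell1 a c;
  id2 : forall a b (f : cell1 a b), cell2 f f;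
  vcomp : forall a b (f g h : cell1 a b), cell2 g h -> cell2 f g -> cell2 f h;
  hcomp : forall a b c (g g' : cell1 b c) (f f' : cell1 a b),
    cell2 g g' -> cell2 f f' -> cell2 (comp1 g f) (comp1 g' f');
  assoc : forall a b c d (h : cell1 c d) (g : cell1 b c) (f : cell1 a b),
    cell2 (comp1 (comp1 h g) f) (comp1 h (comp1 g f));
  assoc_inv : forall a b c d (h : cell1 c d) (g : cell1 b c) (f : cell1 a b),
    cell2 (comp1 h (comp1 g f)) (comp1 (comp1 h g) f);
  lunit : forall a b (f : cell1 a b), cell2 (comp1 (id1 b) f) f;
  lunit_inv : forall a b (f : cell1 a b), cell2 f (comp1 (id1 b) f);
  runit : forall a b (f : cell1 a b), cell2 (comp1 f (id1 a)) f;
  runit_inv : forall a b (f : cell1 a b), cell2 f (comp1 f (id1 a));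
  vcomp_linl : forall a b (f g h : cell1 a b) (s : cell2 f g),
    linear (fun t : cell2 g h => vcomp t s);
  vcomp_linr : forall a b (f g h : cell1 a b) (t : cell2 g h),
    linear (fun s : cell2 f g => vcomp t s);
  hcomp_linl : forall a b c (g g' : cell1 b c) (f f' : cell1 a b) (s : cell2 f f'),
    linear (fun t : cell2 g g' => hcomp t s);
  hcomp_linr : forall a b c (g g' : cell1 b c) (f f' : cell1 a b) (t : cell2 g g'),
    linear (fun s : cell2 f f' => hcomp t s);
  vcomp1l : forall a b (f g : cell1 a b) (s : cell2 f g), vcomp (id2 g) s = s;
  vcomp1r : forall a b (f g : cell1 a b) (s : cell2 f g), vcomp s (id2 f) = s;
  vcompA : forall a b (f g h i : cell1 a b)
      (u : cell2 h i) (t : cell2 g h) (s : cell2 f g),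
    vcomp u (vcomp t s) = vcomp (vcomp u t) s;
  hcomp1 : forall a b c (g : cell1 b c) (f : cell1 a b),
    hcomp (id2 g) (id2 f) = id2 (comp1 g f);
  hcompM : forall a b c (g g' g'' : cell1 b c) (f f' f'' : cell1 a b)
      (t' : cell2 g' g'') (t : cell2 g g') (s' : cell2 f' f'') (s : cell2 f f'),
    hcomp (vcomp t' t) (vcomp s' s) = vcomp (hcomp t' s') (hcomp t s);
  assocK : forall a b c d (h : cell1 c d) (g : cell1 b c) (f : cell1 a b),
    vcomp (assoc_inv h g f) (assoc h g f) = id2 _;
  assocVK : forall a b c d (h : cell1 c d) (g : cell1 b c) (f : cell1 a b),
    vcomp (assoc h g f) (assoc_inv h g f) = id2 _;
  lunitK : forall a b (f : cell1 a b), vcomp (lunit_inv f) (lunit f) = id2 _;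
  lunitVK : forall a b (f : cell1 a b), vcomp (lunit f) (lunit_inv f) = id2 _;
  runitK : forall a b (f : cell1 a b), vcomp (runit_inv f) (runit f) = id2 _;
  runitVK : forall a b (f : cell1 a b), vcomp (runit f) (runit_inv f) = id2 _;
  assoc_nat : forall a b c d (h h' : cell1 c d) (g g' : cell1 b c) (f f' : cell1 a b)
      (u : cell2 h h') (t : cell2 g g') (s : cell2 f f'),
    vcomp (assoc h' g' f') (hcomp (hcomp u t) s)
    = vcomp (hcomp u (hcomp t s)) (assoc h g f);
  lunit_nat : forall a b (f f' : cell1 a b) (s : cell2 f f'),
    vcomp (lunit f') (hcomp (id2 _) s) = vcomp s (lunit f);
  runit_nat : forall a b (f f' : cell1 a b) (s : cell2 f f'),
    vcomp (runit f') (hcomp s (id2 _)) = vcomp s (runit f);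
  bipentagon : forall a b c d e (i : cell1 d e) (h : cell1 c d)
      (g : cell1 b c) (f : cell1 a b),
    vcomp (hcomp (id2 i) (assoc h g f))
      (vcomp (assoc i (comp1 h g) f) (hcomp (assoc i h g) (id2 f)))
    = vcomp (assoc i h (comp1 g f)) (assoc (comp1 i h) g f);
  bitriangle : forall a b c (g : cell1 b c) (f : cell1 a b),
    vcomp (hcomp (id2 g) (lunit f)) (assoc g (id1 b) f) = hcomp (runit g) (id2 f) }.

(* The full sub-bicategory on the 0-cells satisfying P. *)
Definition full_sub (B : bicat) (P : B -> Prop) : bicat :=
  @Bicat {a : B | P a}
    (fun a b => cell1 (sval a) (sval b)) (fun a b f g => cell2 f g)
    (fun a => id1 (sval a)) (fun a b c g f => comp1 g f)
    (fun a b f => id2 f) (fun a b f g h t s => vcomp t s)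
    (fun a b c g g' f f' t s => hcomp t s)
    (fun a b c d h g f => assoc h g f) (fun a b c d h g f => assoc_inv h g f)
    (fun a b f => lunit f) (fun a b f => lunit_inv f)
    (fun a b f => runit f) (fun a b f => runit_inv f)
    (fun a b f g h s => vcomp_linl s) (fun a b f g h t => vcomp_linr t)
    (fun a b c g g' f f' s => hcomp_linl s) (fun a b c g g' f f' t => hcomp_linr t)
    (fun a b f g s => vcomp1l s) (fun a b f g s => vcomp1r s)
    (fun a b f g h i u t s => vcompA u t s)
    (fun a b c g f => hcomp1 g f)
    (fun a b c g g' g'' f f' f'' t' t s' s => hcompM t' t s' s)
    (fun a b c d h g f => assocK h g f) (fun a b c d h g f => assocVK h g f)
    (fun a b f => lunitK f) (fun a b f => lunitVK f)
    (fun a b f => runitK f) (fun a b f => runitVK f)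
    (fun a b c d h h' g g' f f' u t s => assoc_nat u t s)
    (fun a b f f' s => lunit_nat s) (fun a b f f' s => runit_nat s)
    (fun a b c d e i h g f => bipentagon i h g f)
    (fun a b c g f => bitriangle g f).

End Bicategories.

Section Tambara.
Context (k : fieldType) (C : moncat k).

Record tamb (M N : modcat C) := Tamb_ {
  tprof :> prof M N;
  tstr : forall H Y X, tprof Y X -> tprof (mact N H Y) (mact M H X);
  tstr_lin : forall H Y X, linear (@tstr H Y X);
  tstr_nat : forall H Y Y' X X' (f : hom Y' Y) (g : hom X X') (v : tprof Y X),
    tstr H (pmap f g v) = pmap (fmap (mact N H) f) (fmap (mact M H) g) (tstr H v);
  tstr_ext : forall H H' (h : hom H H') Y X (v : tprof Y X),
    pmap (idm (mact N H Y)) (mactm M h X) (tstr H v)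
    = pmap (mactm N h Y) (idm (mact M H' X)) (tstr H' v);
  tstr_mul : forall G F Y X (v : tprof Y X),
    pmap (mmul N G F Y) (idm (mact M (ten G F) X)) (tstr (ten G F) v)
    = pmap (idm (mact N G (mact N F Y))) (mmul M G F X) (tstr G (tstr F v));
  tstr_one : forall Y X (v : tprof Y X),
    pmap (mone N Y) (mone_inv M X) (tstr (tunit C) v) = v }.

Local Arguments tstr {M N} _ H {Y X} _.

Lemma tstrP (M N : modcat C) (P : tamb M N) (H : C) (Y : N) (X : M) a (u v : P Y X) :
  tstr P H (a *: u + v) = a *: tstr P H u + tstr P H v.
Proof. exact: tstr_lin. Qed.

Record tmor (M N : modcat C) (P Q : tamb M N) := TMor {
  tfun :> forall Y X, P Y X -> Q Y X;
  tfun_lin : forall Y X, linear (@tfun Y X);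
  tfun_nat : forall Y Y' X X' (f : hom Y' Y) (g : hom X X') (v : P Y X),
    tfun (pmap f g v) = pmap f g (tfun v);
  tfun_str : forall H Y X (v : P Y X), tfun (tstr P H v) = tstr Q H (tfun v) }.

Local Arguments tfun {M N P Q} _ Y X _.

Lemma tfunP (M N : modcat C) (P Q : tamb M N) (s : tmor P Q) (Y : N) (X : M)
  a (u v : P Y X) : s Y X (a *: u + v) = a *: s Y X u + s Y X v.
Proof. exact: tfun_lin. Qed.

Lemma tmor_eq (M N : modcat C) (P Q : tamb M N) (s t : tmor P Q) :
  (forall Y X (v : P Y X), s Y X v = t Y X v) -> s = t.
Proof.
case: s t => [s s1 s2 s3] [t t1 t2 t3] /= e.
have {}e : s = t.
  apply: functional_extensionality_dep => Y.
  apply: functional_extensionality_dep => X.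
  by apply: funext => v; apply: e.
by case: _ / e t1 t2 t3 => t1 t2 t3; f_equal; apply: Prop_irrelevance.
Qed.

Lemma tmor_eqP (M N : modcat C) (P Q : tamb M N) (s t : tmor P Q) :
  s = t -> forall Y X (v : P Y X), s Y X v = t Y X v.
Proof. by move=> ->. Qed.

Definition tid (M N : modcat C) (P : tamb M N) : tmor P P :=
  @TMor M N P P (fun Y X v => v) (fun Y X a u v => erefl)
    (fun Y Y' X X' f g v => erefl) (fun H Y X v => erefl).

Section VComp.
Context (M N : modcat C) (P Q R : tamb M N) (t : tmor Q R) (s : tmor P Q).

Lemma tcomp_lin Y X : linear (fun v : P Y X => t Y X (s Y X v)).
Proof. by move=> a u v; rewrite !tfunP. Qed.

Lemma tcomp_nat Y Y' X X' (f : hom Y' Y) (g : hom X X') (v : P Y X) :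
  t _ _ (s _ _ (pmap f g v)) = pmap f g (t _ _ (s _ _ v)).
Proof. by rewrite !tfun_nat. Qed.

Lemma tcomp_str H Y X (v : P Y X) :
  t _ _ (s _ _ (tstr P H v)) = tstr R H (t _ _ (s _ _ v)).
Proof. by rewrite !tfun_str. Qed.

Definition tcomp : tmor P R := TMor tcomp_lin tcomp_nat tcomp_str.
End VComp.

Section Linear.
Context (M N : modcat C) (P Q : tamb M N).
Implicit Types s t r : tmor P Q.

Lemma tadd_lin s t Y X : linear (fun v : P Y X => s Y X v + t Y X v).
Proof. by move=> a u v; rewrite !tfunP scalerDr addrACA. Qed.

Lemma tadd_nat s t Y Y' X X' (f : hom Y' Y) (g : hom X X') (v : P Y X) :
  s _ _ (pmap f g v) + t _ _ (pmap f g v) = pmap f g (s _ _ v + t _ _ v).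
Proof. by rewrite (linD (@pmap_lin _ _ _ Q _ _ _ _ f g)) !tfun_nat. Qed.

Lemma tadd_str s t H Y X (v : P Y X) :
  s _ _ (tstr P H v) + t _ _ (tstr P H v) = tstr Q H (s _ _ v + t _ _ v).
Proof. by rewrite (linD (@tstr_lin _ _ Q H Y X)) !tfun_str. Qed.

Definition tadd s t : tmor P Q :=
  TMor (@tadd_lin s t) (@tadd_nat s t) (@tadd_str s t).

Lemma tscale_lin a s Y X : linear (fun v : P Y X => a *: s Y X v).
Proof. by move=> b u v; rewrite !tfunP scalerDr !scalerA mulrC. Qed.

Lemma tscale_nat a s Y Y' X X' (f : hom Y' Y) (g : hom X X') (v : P Y X) :
  a *: s _ _ (pmap f g v) = pmap f g (a *: s _ _ v).
Proof. by rewrite (linZ (@pmap_lin _ _ _ Q _ _ _ _ f g)) !tfun_nat. Qed.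

Lemma tscale_str a s H Y X (v : P Y X) :
  a *: s _ _ (tstr P H v) = tstr Q H (a *: s _ _ v).
Proof. by rewrite (linZ (@tstr_lin _ _ Q H Y X)) !tfun_str. Qed.

Definition tscale a s : tmor P Q :=
  TMor (@tscale_lin a s) (@tscale_nat a s) (@tscale_str a s).

Lemma tzero_lin Y X : linear (fun v : P Y X => 0 : Q Y X).
Proof. by move=> a u v; rewrite scaler0 addr0. Qed.

Lemma tzero_nat Y Y' X X' (f : hom Y' Y) (g : hom X X') (v : P Y X) :
  0 = pmap f g (0 : Q Y X).
Proof. by rewrite (lin0 (@pmap_lin _ _ _ Q _ _ _ _ f g)). Qed.

Lemma tzero_str H Y X (v : P Y X) : 0 = tstr Q H (0 : Q Y X).
Proof. by rewrite (lin0 (@tstr_lin _ _ Q H Y X)). Qed.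

Definition tzero : tmor P Q := TMor tzero_lin tzero_nat tzero_str.

Lemma taddA : associative tadd.
Proof. by move=> s t r; apply: tmor_eq => Y X v; apply: addrA. Qed.

Lemma taddC : commutative tadd.
Proof. by move=> s t; apply: tmor_eq => Y X v; apply: addrC. Qed.

Lemma tadd0 : left_id tzero tadd.
Proof. by move=> s; apply: tmor_eq => Y X v; apply: add0r. Qed.

Lemma taddN : left_inverse tzero (tscale (-1)) tadd.
Proof. by move=> s; apply: tmor_eq => Y X v; rewrite /= scaleN1r addNr. Qed.

HB.instance Definition _ := gen_eqMixin (tmor P Q).
HB.instance Definition _ := gen_choiceMixin (tmor P Q).
HB.instance Definition _ := GRing.isZmodule.Build (tmor P Q) taddA taddC tadd0 taddN.

Lemma tscaleA a b s : tscale a (tscale b s) = tscale (a * b) s.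
Proof. by apply: tmor_eq => Y X v; apply: scalerA. Qed.

Lemma tscale1 : left_id 1 tscale.
Proof. by move=> s; apply: tmor_eq => Y X v; apply: scale1r. Qed.

Lemma tscaleDr : right_distributive tscale +%R.
Proof. by move=> a s t; apply: tmor_eq => Y X v; apply: scalerDr. Qed.

Lemma tscaleDl s : {morph tscale^~ s : a b / a + b >-> a + b}.
Proof. by move=> a b; apply: tmor_eq => Y X v; apply: scalerDl. Qed.

HB.instance Definition _ :=
  GRing.Zmodule_isLmodule.Build k (tmor P Q) tscaleA tscale1 tscaleDr tscaleDl.

Lemma tmor_linE a s t Y X (v : P Y X) : (a *: s + t) Y X v = a *: s Y X v + t Y X v.
Proof. by []. Qed.

End Linear.

Section Identity.
Context (M : modcat C).

Lemma hom_str_lin H (Y X : M) : linear (fun v : homprof M Y X => fmap (mact M H) v).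
Proof. exact: fmap_lin. Qed.

Lemma hom_str_nat H (Y Y' X X' : M) (f : hom Y' Y) (g : hom X X') (v : homprof M Y X) :
  fmap (mact M H) (pmap f g v)
  = pmap (p := homprof M) (fmap (mact M H) f) (fmap (mact M H) g) (fmap (mact M H) v).
Proof. by rewrite /= /homprof_map !fmapM. Qed.

Lemma hom_str_ext H H' (h : hom H H') (Y X : M) (v : homprof M Y X) :
  pmap (p := homprof M) (idm _) (mactm M h X) (fmap (mact M H) v)
  = pmap (p := homprof M) (mactm M h Y) (idm _) (fmap (mact M H') v).
Proof. by rewrite /= /homprof_map cmpm1 cmp1m mactm_nat. Qed.

Lemma hom_str_mul G F (Y X : M) (v : homprof M Y X) :
  pmap (p := homprof M) (mmul M G F Y) (idm _) (fmap (mact M (ten G F)) v)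
  = pmap (p := homprof M) (idm _) (mmul M G F X)
      (fmap (mact M G) (fmap (mact M F) v)).
Proof. by rewrite /= /homprof_map cmpm1 cmp1m mmul_natX. Qed.

Lemma hom_str_one (Y X : M) (v : homprof M Y X) :
  pmap (p := homprof M) (mone M Y) (mone_inv M X) (fmap (mact M (tunit C)) v) = v.
Proof. by rewrite /= /homprof_map -cmpA mone_nat cmpA moneK cmp1m. Qed.

Definition hom_tamb : tamb M M :=
  @Tamb_ M M (homprof M) _ hom_str_lin hom_str_nat hom_str_ext hom_str_mul hom_str_one.

End Identity.

Lemma coend_ext_param (M N K : lincat k) (Psi : prof N K) (Phi : prof M N) Z X
    (W V : lmodType k) (g : W -> coend Psi Phi Z X -> V) :
  (forall w, linear (g w)) ->
  (forall Y (p : Psi Z Y) (q : Phi Y X), linear (fun w => g w (cgen p q))) ->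
  forall x, linear (fun w => g w x).
Proof.
move=> gl gg x a w w'; move: x; apply: coend_ext => [//|b u v|Y p q]; last exact: gg.
rewrite !gl !scalerDr !scalerA (mulrC a) -!addrA; congr (_ + _).
by rewrite !addrA; congr (_ + _); rewrite addrC.
Qed.

Section Composite.
Context (M N K : modcat C) (Psi : tamb N K) (Phi : tamb M N).

Definition comp_str (H : C) (Z : K) (X : M) :
    coend Psi Phi Z X -> coend Psi Phi (mact K H Z) (mact M H X) :=
  clift (fun Y (p : Psi Z Y) (q : Phi Y X) => cgen (tstr Psi H p) (tstr Phi H q)).

Lemma comp_str_bal (H : C) (Z : K) (X : M) :
  cbal (fun Y (p : Psi Z Y) (q : Phi Y X) => cgen (tstr Psi H p) (tstr Phi H q)).
Proof.
split=> [Y q a u v|Y p a u v|Y Y' h p q].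
- by rewrite tstrP cgenPl.
- by rewrite tstrP cgenPr.
- by rewrite !tstr_nat !fmap1 cgen_bal.
Qed.

Lemma comp_str_gen (H : C) (Z : K) (X : M) Y (p : Psi Z Y) (q : Phi Y X) :
  comp_str H (cgen p q) = cgen (tstr Psi H p) (tstr Phi H q).
Proof. exact: (clift_gen (comp_str_bal H Z X)). Qed.

Lemma comp_str_lin (H : C) (Z : K) (X : M) : linear (@comp_str H Z X).
Proof. exact: (clift_lin (comp_str_bal H Z X)). Qed.

Lemma comp_strP (H : C) (Z : K) (X : M) a u v :
  @comp_str H Z X (a *: u + v) = a *: comp_str H u + comp_str H v.
Proof. exact: comp_str_lin. Qed.

Lemma comp_str_nat H Z Z' X X' (f : hom Z' Z) (g : hom X X')
    (v : comp_prof Psi Phi Z X) :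
  comp_str H (pmap f g v)
  = pmap (p := comp_prof Psi Phi) (fmap (mact K H) f) (fmap (mact M H) g)
      (comp_str H v).
Proof.
move: v; apply: coend_ext => [a u v|a u v|Y p q] /=.
- by rewrite comp_mapPv comp_strP.
- by rewrite comp_strP comp_mapPv.
- by rewrite comp_map_gen !comp_str_gen comp_map_gen !tstr_nat !fmap1.
Qed.

Lemma comp_str_ext H H' (h : hom H H') Z X (v : comp_prof Psi Phi Z X) :
  pmap (p := comp_prof Psi Phi) (idm _) (mactm M h X) (comp_str H v)
  = pmap (p := comp_prof Psi Phi) (mactm K h Z) (idm _) (comp_str H' v).
Proof.
move: v; apply: coend_ext => [a u v|a u v|Y p q] /=.
- by rewrite comp_strP comp_mapPv.
- by rewrite comp_strP comp_mapPv.
- by rewrite !comp_str_gen !comp_map_gen !pmap1 tstr_ext -cgen_bal tstr_ext.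
Qed.

Lemma comp_str_mul G F Z X (v : comp_prof Psi Phi Z X) :
  pmap (p := comp_prof Psi Phi) (mmul K G F Z) (idm _) (comp_str (ten G F) v)
  = pmap (p := comp_prof Psi Phi) (idm _) (mmul M G F X)
      (comp_str G (comp_str F v)).
Proof.
move: v; apply: coend_ext => [a u v|a u v|Y p q] /=.
- by rewrite comp_strP comp_mapPv.
- by rewrite !comp_strP comp_mapPv.
- by rewrite !comp_str_gen !comp_map_gen !pmap1 tstr_mul cgen_bal tstr_mul.
Qed.

Lemma comp_str_one Z X (v : comp_prof Psi Phi Z X) :
  pmap (p := comp_prof Psi Phi) (mone K Z) (mone_inv M X) (comp_str (tunit C) v) = v.
Proof.
move: v; apply: coend_ext => [a u v|//|Y p q] /=.
- by rewrite comp_strP comp_mapPv.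
rewrite comp_str_gen comp_map_gen.
have e : pmap (mone N Y) (idm X) (pmap (idm _) (mone_inv M X) (tstr Phi (tunit C) q)) = q.
  by rewrite -pmap_lr tstr_one.
rewrite -[in RHS]e -[RHS]cgen_bal.
have -> : pmap (idm Z) (mone N Y) p = pmap (mone K Z) (idm _) (tstr Psi (tunit C) p).
  rewrite -[in LHS](tstr_one p) -pmapM cmpm1.
  by rewrite moneVK.
by [].
Qed.

Definition comp_tamb : tamb M K :=
  @Tamb_ M K (comp_prof Psi Phi) _ comp_str_lin comp_str_nat comp_str_ext
    comp_str_mul comp_str_one.

End Composite.

Section HComp.
Context (M N K : modcat C) (Psi Psi' : tamb N K) (Phi Phi' : tamb M N).
Context (t : tmor Psi Psi') (s : tmor Phi Phi').

Definition thcomp_fun Z X : comp_tamb Psi Phi Z X -> comp_tamb Psi' Phi' Z X :=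
  clift (fun Y (p : Psi Z Y) (q : Phi Y X) =>
    cgen (Psi := Psi') (Phi := Phi') (t _ _ p) (s _ _ q)).

Lemma thcomp_bal Z X : cbal (fun Y (p : Psi Z Y) (q : Phi Y X) =>
    cgen (Psi := Psi') (Phi := Phi') (t _ _ p) (s _ _ q)).
Proof.
split=> [Y q a u v|Y p a u v|Y Y' h p q].
- by rewrite tfunP cgenPl.
- by rewrite tfunP cgenPr.
- by rewrite !tfun_nat cgen_bal.
Qed.

Lemma thcomp_fun_gen Z X Y (p : Psi Z Y) (q : Phi Y X) :
  thcomp_fun (cgen p q) = cgen (Psi := Psi') (Phi := Phi') (t _ _ p) (s _ _ q).
Proof. exact: (clift_gen (thcomp_bal Z X)). Qed.

Lemma thcomp_lin Z X : linear (@thcomp_fun Z X).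
Proof. exact: (clift_lin (thcomp_bal Z X)). Qed.

Lemma thcompP Z X a u v :
  @thcomp_fun Z X (a *: u + v) = a *: thcomp_fun u + thcomp_fun v.
Proof. exact: thcomp_lin. Qed.

Lemma thcomp_nat Z Z' X X' (f : hom Z' Z) (g : hom X X') (v : comp_tamb Psi Phi Z X) :
  thcomp_fun (pmap f g v) = pmap f g (thcomp_fun v).
Proof.
move: v; apply: coend_ext => [a u v|a u v|Y p q] /=.
- by rewrite comp_mapPv thcompP.
- by rewrite thcompP comp_mapPv.
- by rewrite comp_map_gen !thcomp_fun_gen comp_map_gen !tfun_nat.
Qed.

Lemma thcomp_str H Z X (v : comp_tamb Psi Phi Z X) :
  thcomp_fun (tstr (comp_tamb Psi Phi) H v)
  = tstr (comp_tamb Psi' Phi') H (thcomp_fun v).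
Proof.
move: v; apply: coend_ext => [a u v|a u v|Y p q] /=.
- by rewrite comp_strP thcompP.
- by rewrite thcompP comp_strP.
- by rewrite comp_str_gen !thcomp_fun_gen comp_str_gen !tfun_str.
Qed.

Definition thcomp : tmor (comp_tamb Psi Phi) (comp_tamb Psi' Phi') :=
  TMor thcomp_lin thcomp_nat thcomp_str.

Lemma thcomp_gen Z X Y (p : Psi Z Y) (q : Phi Y X) :
  thcomp Z X (cgen p q) = cgen (Psi := Psi') (Phi := Phi') (t _ _ p) (s _ _ q).
Proof. exact: thcomp_fun_gen. Qed.

End HComp.

Lemma tmor_comp_eq (M N K : modcat C) (Psi : tamb N K) (Phi : tamb M N)
    (Q : tamb M K) (s t : tmor (comp_tamb Psi Phi) Q) :
  (forall Z X Y (p : Psi Z Y) (q : Phi Y X), s Z X (cgen p q) = t Z X (cgen p q)) ->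
  s = t.
Proof.
move=> st; apply: tmor_eq => Z X.
apply: coend_ext => [a u v|a u v|Y p q]; last exact: st.
- by rewrite tfunP.
- by rewrite tfunP.
Qed.

(* Tambara morphisms out of a composite are induced by maps on generators. *)
Section TLift.
Context (M N K : modcat C) (Psi : tamb N K) (Phi : tamb M N) (Q : tamb M K).
Context (g : forall Z X Y, Psi Z Y -> Phi Y X -> Q Z X).
Hypothesis gbal : forall Z X, cbal (fun Y (p : Psi Z Y) (q : Phi Y X) => g p q).
Hypothesis gnat : forall Z Z' X X' (f : hom Z' Z) (h : hom X X') Y
  (p : Psi Z Y) (q : Phi Y X), g (pmap f (idm Y) p) (pmap (idm Y) h q) = pmap f h (g p q).
Hypothesis gstr : forall H Z X Y (p : Psi Z Y) (q : Phi Y X),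
  g (tstr Psi H p) (tstr Phi H q) = tstr Q H (g p q).

Definition tlift_fun Z X : comp_tamb Psi Phi Z X -> Q Z X :=
  clift (fun Y (p : Psi Z Y) (q : Phi Y X) => g p q).

Lemma tlift_lin Z X : linear (@tlift_fun Z X).
Proof. exact: (clift_lin (gbal Z X)). Qed.

Lemma tlift_fun_gen Z X Y (p : Psi Z Y) (q : Phi Y X) : tlift_fun (cgen p q) = g p q.
Proof. exact: (clift_gen (gbal Z X)). Qed.

Lemma tliftP Z X a u v :
  @tlift_fun Z X (a *: u + v) = a *: tlift_fun u + tlift_fun v.
Proof. exact: tlift_lin. Qed.

Lemma tlift_nat Z Z' X X' (f : hom Z' Z) (h : hom X X') (v : comp_tamb Psi Phi Z X) :
  tlift_fun (pmap f h v) = pmap f h (tlift_fun v).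
Proof.
move: v; apply: coend_ext => [a u v|a u v|Y p q] /=.
- by rewrite comp_mapPv tliftP.
- by rewrite tliftP pmapPv.
- by rewrite comp_map_gen !tlift_fun_gen gnat.
Qed.

Lemma tlift_str H Z X (v : comp_tamb Psi Phi Z X) :
  tlift_fun (tstr (comp_tamb Psi Phi) H v) = tstr Q H (tlift_fun v).
Proof.
move: v; apply: coend_ext => [a u v|a u v|Y p q] /=.
- by rewrite comp_strP tliftP.
- by rewrite tliftP tstrP.
- by rewrite comp_str_gen !tlift_fun_gen gstr.
Qed.

Definition tlift : tmor (comp_tamb Psi Phi) Q := TMor tlift_lin tlift_nat tlift_str.

Lemma tlift_gen Z X Y (p : Psi Z Y) (q : Phi Y X) : tlift Z X (cgen p q) = g p q.
Proof. exact: tlift_fun_gen. Qed.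

End TLift.

Lemma pmap_gen (M N K : modcat C) (Psi : tamb N K) (Phi : tamb M N) Z Z' X X'
    (f : hom Z' Z) (g : hom X X') Y (p : Psi Z Y) (q : Phi Y X) :
  pmap (p := comp_tamb Psi Phi) f g (cgen p q)
  = cgen (pmap f (idm Y) p) (pmap (idm Y) g q).
Proof. exact: comp_map_gen. Qed.

Lemma tstr_gen (M N K : modcat C) (Psi : tamb N K) (Phi : tamb M N) Z X H
    Y (p : Psi Z Y) (q : Phi Y X) :
  tstr (comp_tamb Psi Phi) H (cgen p q) = cgen (tstr Psi H p) (tstr Phi H q).
Proof. exact: comp_str_gen. Qed.

Section Associator.
Context (M N K L : modcat C) (Xi : tamb K L) (Psi : tamb N K) (Phi : tamb M N).

Definition ass1 Z X Y (w : comp_tamb Xi Psi Z Y) (q : Phi Y X) :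
    comp_tamb Xi (comp_tamb Psi Phi) Z X :=
  clift (fun U (x : Xi Z U) (p : Psi U Y) =>
    cgen (Phi := comp_tamb Psi Phi) x (cgen p q)) w.

Lemma ass1_bal Z X Y (q : Phi Y X) : cbal (fun U (x : Xi Z U) (p : Psi U Y) =>
    cgen (Phi := comp_tamb Psi Phi) x (cgen p q)).
Proof.
split=> [U p a u v|U x a u v|U U' h x p].
- by rewrite cgenPl.
- by rewrite cgenPl cgenPr.
- by rewrite cgen_bal pmap_gen pmap1.
Qed.

Lemma ass1_gen Z X Y U (x : Xi Z U) (p : Psi U Y) (q : Phi Y X) :
  ass1 (cgen x p) q = cgen (Phi := comp_tamb Psi Phi) x (cgen p q).
Proof. exact: (clift_gen (ass1_bal Z q)). Qed.

Lemma ass1_linl Z X Y (q : Phi Y X) : linear (fun w => @ass1 Z X Y w q).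
Proof. exact: (clift_lin (ass1_bal Z q)). Qed.

Lemma ass1Pl Z X Y (q : Phi Y X) a u v :
  @ass1 Z X Y (a *: u + v) q = a *: ass1 u q + ass1 v q.
Proof. exact: ass1_linl. Qed.

Lemma ass1_linr Z X Y w : linear (@ass1 Z X Y w).
Proof.
apply: (coend_ext_param (g := fun q w => @ass1 Z X Y w q)) => [q|U x p a u v].
  exact: ass1_linl.
by rewrite !ass1_gen !cgenPr.
Qed.

Lemma ass1_bal2 Z X : cbal (fun Y (w : comp_tamb Xi Psi Z Y) (q : Phi Y X) => ass1 w q).
Proof.
split=> [Y q|Y w|Y Y' h w q]; [exact: ass1_linl|exact: ass1_linr|].
move: w; apply: coend_ext => [a u v|a u v|U x p].
- by rewrite pmapPv ass1Pl.
- by rewrite ass1Pl.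
- by rewrite pmap_gen !ass1_gen pmap1 cgen_bal.
Qed.

Lemma ass1_nat Z Z' X X' (f : hom Z' Z) (h : hom X X') Y
    (w : comp_tamb Xi Psi Z Y) (q : Phi Y X) :
  ass1 (pmap f (idm Y) w) (pmap (idm Y) h q) = pmap f h (ass1 w q).
Proof.
move: w; apply: coend_ext => [a u v|a u v|U x p].
- by rewrite pmapPv ass1Pl.
- by rewrite ass1Pl pmapPv.
- by rewrite pmap_gen !ass1_gen !pmap_gen !pmap1.
Qed.

Lemma ass1_str H Z X Y (w : comp_tamb Xi Psi Z Y) (q : Phi Y X) :
  ass1 (tstr (comp_tamb Xi Psi) H w) (tstr Phi H q)
  = tstr (comp_tamb Xi (comp_tamb Psi Phi)) H (ass1 w q).
Proof.
move: w; apply: coend_ext => [a u v|a u v|U x p].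
- by rewrite tstrP ass1Pl.
- by rewrite ass1Pl tstrP.
- by rewrite tstr_gen !ass1_gen !tstr_gen.
Qed.

Definition tass : tmor (comp_tamb (comp_tamb Xi Psi) Phi)
                       (comp_tamb Xi (comp_tamb Psi Phi)) :=
  tlift ass1_bal2 ass1_nat ass1_str.

Lemma tass_gen Z X Y U (x : Xi Z U) (p : Psi U Y) (q : Phi Y X) :
  tass Z X (cgen (Psi := comp_tamb Xi Psi) (cgen x p) q)
  = cgen (Phi := comp_tamb Psi Phi) x (cgen p q).
Proof. by rewrite [LHS]tlift_gen ass1_gen. Qed.

Definition assv1 Z X U (x : Xi Z U) (w : comp_tamb Psi Phi U X) :
    comp_tamb (comp_tamb Xi Psi) Phi Z X :=
  clift (fun Y (p : Psi U Y) (q : Phi Y X) =>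
    cgen (Psi := comp_tamb Xi Psi) (cgen x p) q) w.

Lemma assv1_bal Z X U (x : Xi Z U) : cbal (fun Y (p : Psi U Y) (q : Phi Y X) =>
    cgen (Psi := comp_tamb Xi Psi) (cgen x p) q).
Proof.
split=> [Y q a u v|Y p a u v|Y Y' h p q].
- by rewrite cgenPr cgenPl.
- by rewrite cgenPr.
- by rewrite -cgen_bal pmap_gen pmap1.
Qed.

Lemma assv1_gen Z X Y U (x : Xi Z U) (p : Psi U Y) (q : Phi Y X) :
  assv1 x (cgen p q) = cgen (Psi := comp_tamb Xi Psi) (cgen x p) q.
Proof. exact: (clift_gen (assv1_bal X x)). Qed.

Lemma assv1_linr Z X U x : linear (@assv1 Z X U x).
Proof. exact: (clift_lin (assv1_bal X x)). Qed.

Lemma assv1Pr Z X U x a u v :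
  @assv1 Z X U x (a *: u + v) = a *: assv1 x u + assv1 x v.
Proof. exact: assv1_linr. Qed.

Lemma assv1_linl Z X U w : linear (fun x => @assv1 Z X U x w).
Proof.
apply: (coend_ext_param (g := fun x w => @assv1 Z X U x w)) => [x|Y p q a u v].
  exact: assv1_linr.
by rewrite !assv1_gen !cgenPl.
Qed.

Lemma assv1_bal2 Z X :
  cbal (fun U (x : Xi Z U) (w : comp_tamb Psi Phi U X) => assv1 x w).
Proof.
split=> [U w|U x|U U' h x w]; [exact: assv1_linl|exact: assv1_linr|].
move: w; apply: coend_ext => [a u v|a u v|Y p q].
- by rewrite assv1Pr.
- by rewrite pmapPv assv1Pr.
- by rewrite pmap_gen !assv1_gen pmap1 cgen_bal.
Qed.

Lemma assv1_nat Z Z' X X' (f : hom Z' Z) (h : hom X X') U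
    (x : Xi Z U) (w : comp_tamb Psi Phi U X) :
  assv1 (pmap f (idm U) x) (pmap (idm U) h w) = pmap f h (assv1 x w).
Proof.
move: w; apply: coend_ext => [a u v|a u v|Y p q].
- by rewrite pmapPv assv1Pr.
- by rewrite assv1Pr pmapPv.
- by rewrite pmap_gen !assv1_gen !pmap_gen !pmap1.
Qed.

Lemma assv1_str H Z X U (x : Xi Z U) (w : comp_tamb Psi Phi U X) :
  assv1 (tstr Xi H x) (tstr (comp_tamb Psi Phi) H w)
  = tstr (comp_tamb (comp_tamb Xi Psi) Phi) H (assv1 x w).
Proof.
move: w; apply: coend_ext => [a u v|a u v|Y p q].
- by rewrite tstrP assv1Pr.
- by rewrite assv1Pr tstrP.
- by rewrite tstr_gen !assv1_gen !tstr_gen.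
Qed.

Definition tassv : tmor (comp_tamb Xi (comp_tamb Psi Phi))
                        (comp_tamb (comp_tamb Xi Psi) Phi) :=
  tlift assv1_bal2 assv1_nat assv1_str.

Lemma tassv_gen Z X Y U (x : Xi Z U) (p : Psi U Y) (q : Phi Y X) :
  tassv Z X (cgen (Phi := comp_tamb Psi Phi) x (cgen p q))
  = cgen (Psi := comp_tamb Xi Psi) (cgen x p) q.
Proof. by rewrite [LHS]tlift_gen assv1_gen. Qed.

(* Extensionality on iterated composites. *)
Lemma tmor_comp_eql (Q : tamb M L)
    (s t : tmor (comp_tamb (comp_tamb Xi Psi) Phi) Q) :
  (forall Z X U Y (x : Xi Z U) (p : Psi U Y) (q : Phi Y X),
     s Z X (cgen (Psi := comp_tamb Xi Psi) (cgen x p) q)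
     = t Z X (cgen (Psi := comp_tamb Xi Psi) (cgen x p) q)) ->
  s = t.
Proof.
move=> st; apply: tmor_comp_eq => Z X Y w q; move: w.
apply: coend_ext => [a u v|a u v|U x p]; last exact: st.
- by rewrite cgenPl tfunP.
- by rewrite cgenPl tfunP.
Qed.

Lemma tmor_comp_eqr (Q : tamb M L)
    (s t : tmor (comp_tamb Xi (comp_tamb Psi Phi)) Q) :
  (forall Z X U Y (x : Xi Z U) (p : Psi U Y) (q : Phi Y X),
     s Z X (cgen (Phi := comp_tamb Psi Phi) x (cgen p q))
     = t Z X (cgen (Phi := comp_tamb Psi Phi) x (cgen p q))) ->
  s = t.
Proof.
move=> st; apply: tmor_comp_eq => Z X U x w; move: w.
apply: coend_ext => [a u v|a u v|Y p q]; last exact: st.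
- by rewrite cgenPr tfunP.
- by rewrite cgenPr tfunP.
Qed.

End Associator.

Section Unitors.
Context (M N : modcat C) (Phi : tamb M N).

Lemma lun_bal (Z : N) (X : M) :
  cbal (Psi := hom_tamb N) (fun Y (f : hom Z Y) (q : Phi Y X) => pmap f (idm X) q).
Proof.
split=> [Y q a u v|Y p a u v|Y Y' h p q].
- by rewrite pmapPl.
- by rewrite pmapPv.
- by rewrite /= /homprof_map cmpm1 -pmapM cmp1m.
Qed.

Lemma lun_gnat (Z Z' : N) (X X' : M) (f : hom Z' Z) (h : hom X X') Y
    (p : hom_tamb N Z Y) (q : Phi Y X) :
  pmap (pmap f (idm Y) p : hom _ _) (idm X') (pmap (idm Y) h q)
  = pmap f h (pmap p (idm X) q).
Proof. by rewrite /= /homprof_map cmp1m -!pmapM !cmp1m !cmpm1. Qed.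

Lemma lun_gstr H (Z : N) (X : M) Y (p : hom_tamb N Z Y) (q : Phi Y X) :
  pmap (tstr (hom_tamb N) H p : hom _ _) (idm (mact M H X)) (tstr Phi H q)
  = tstr Phi H (pmap p (idm X) q).
Proof. by rewrite tstr_nat fmap1. Qed.

Definition tlun : tmor (comp_tamb (hom_tamb N) Phi) Phi :=
  tlift lun_bal lun_gnat lun_gstr.

Lemma tlun_gen Z X Y (f : hom_tamb N Z Y) (q : Phi Y X) :
  tlun Z X (cgen f q) = pmap f (idm X) q.
Proof. exact: tlift_gen. Qed.

Definition tlunv_fun Z X (q : Phi Z X) : comp_tamb (hom_tamb N) Phi Z X :=
  cgen (Psi := hom_tamb N) (idm Z) q.

Lemma tlunv_lin Z X : linear (@tlunv_fun Z X).
Proof. by move=> a u v; rewrite /tlunv_fun cgenPr. Qed.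

Lemma tlunv_nat Y Y' X X' (f : hom Y' Y) (g : hom X X') (v : Phi Y X) :
  tlunv_fun (pmap f g v) = pmap f g (tlunv_fun v).
Proof.
rewrite /tlunv_fun pmap_gen pmap_lr -cgen_bal; congr cgen.
by rewrite /= /homprof_map !cmpm1 !cmp1m.
Qed.

Lemma tlunv_str H Y X (v : Phi Y X) :
  tlunv_fun (tstr Phi H v) = tstr (comp_tamb (hom_tamb N) Phi) H (tlunv_fun v).
Proof. by rewrite /tlunv_fun tstr_gen /= fmap1. Qed.

Definition tlunv : tmor Phi (comp_tamb (hom_tamb N) Phi) :=
  TMor tlunv_lin tlunv_nat tlunv_str.

Lemma run_bal (Z : N) (X : M) :
  cbal (Phi := hom_tamb M) (fun Y (p : Phi Z Y) (f : hom Y X) => pmap (idm Z) f p).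
Proof.
split=> [Y q a u v|Y p a u v|Y Y' h p q].
- by rewrite pmapPv.
- by rewrite pmapPr.
- by rewrite /= /homprof_map cmp1m -pmapM cmp1m.
Qed.

Lemma run_gnat (Z Z' : N) (X X' : M) (f : hom Z' Z) (h : hom X X') Y
    (p : Phi Z Y) (q : hom_tamb M Y X) :
  pmap (idm Z') (pmap (idm Y) h q : hom _ _) (pmap f (idm Y) p)
  = pmap f h (pmap (idm Z) q p).
Proof. by rewrite /= /homprof_map cmpm1 -!pmapM !cmp1m !cmpm1. Qed.

Lemma run_gstr H (Z : N) (X : M) Y (p : Phi Z Y) (q : hom_tamb M Y X) :
  pmap (idm (mact N H Z)) (tstr (hom_tamb M) H q : hom _ _) (tstr Phi H p)
  = tstr Phi H (pmap (idm Z) q p).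
Proof. by rewrite tstr_nat fmap1. Qed.

Definition trun : tmor (comp_tamb Phi (hom_tamb M)) Phi :=
  tlift run_bal run_gnat run_gstr.

Lemma trun_gen Z X Y (p : Phi Z Y) (f : hom_tamb M Y X) :
  trun Z X (cgen p f) = pmap (idm Z) f p.
Proof. exact: tlift_gen. Qed.

Definition trunv_fun Z X (p : Phi Z X) : comp_tamb Phi (hom_tamb M) Z X :=
  cgen (Phi := hom_tamb M) p (idm X).

Lemma trunv_lin Z X : linear (@trunv_fun Z X).
Proof. by move=> a u v; rewrite /trunv_fun cgenPl. Qed.

Lemma trunv_nat Y Y' X X' (f : hom Y' Y) (g : hom X X') (v : Phi Y X) :
  trunv_fun (pmap f g v) = pmap f g (trunv_fun v).
Proof.
rewrite /trunv_fun pmap_gen pmap_rl cgen_bal; congr cgen.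
by rewrite /= /homprof_map !cmpm1 !cmp1m.
Qed.

Lemma trunv_str H Y X (v : Phi Y X) :
  trunv_fun (tstr Phi H v) = tstr (comp_tamb Phi (hom_tamb M)) H (trunv_fun v).
Proof. by rewrite /trunv_fun tstr_gen /= fmap1. Qed.

Definition trunv : tmor Phi (comp_tamb Phi (hom_tamb M)) :=
  TMor trunv_lin trunv_nat trunv_str.

Lemma tlunK : tcomp tlunv tlun = tid _.
Proof.
apply: tmor_comp_eq => Z X Y p q /=; rewrite [X in tlunv_fun X]tlun_gen.
by rewrite /tlunv_fun -cgen_bal /= /homprof_map cmpm1 cmpm1.
Qed.

Lemma tlunVK : tcomp tlun tlunv = tid _.
Proof. by apply: tmor_eq => Z X v; rewrite [LHS]tlun_gen pmap1. Qed.

Lemma trunK : tcomp trunv trun = tid _.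
Proof.
apply: tmor_comp_eq => Z X Y p q /=; rewrite [X in trunv_fun X]trun_gen.
by rewrite /trunv_fun cgen_bal /= /homprof_map !cmp1m.
Qed.

Lemma trunVK : tcomp trun trunv = tid _.
Proof. by apply: tmor_eq => Z X v; rewrite [LHS]trun_gen pmap1. Qed.

End Unitors.

End Tambara.
Arguments tstr {k C M N} _ H {Y X} _.
Arguments tfun {k C M N P Q} _ Y X _.

Section TambBicategory.
Context (k : fieldType) (C : moncat k).

Lemma tcompE (M N : modcat C) (P Q R : tamb M N) (t : tmor Q R) (s : tmor P Q)
    (Y : N) (X : M) (v : P Y X) :
  tcomp t s Y X v = t Y X (s Y X v).
Proof. by []. Qed.

Lemma tidE (M N : modcat C) (P : tamb M N) (Y : N) (X : M) (v : P Y X) :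
  tid P Y X v = v.
Proof. by []. Qed.

Lemma tcomp1l (M N : modcat C) (P Q : tamb M N) (s : tmor P Q) : tcomp (tid Q) s = s.
Proof. exact: tmor_eq. Qed.

Lemma tcomp1r (M N : modcat C) (P Q : tamb M N) (s : tmor P Q) : tcomp s (tid P) = s.
Proof. exact: tmor_eq. Qed.

Lemma tcompA (M N : modcat C) (P Q R S : tamb M N)
    (u : tmor R S) (t : tmor Q R) (s : tmor P Q) :
  tcomp u (tcomp t s) = tcomp (tcomp u t) s.
Proof. exact: tmor_eq. Qed.

Lemma tcomp_linl (M N : modcat C) (P Q R : tamb M N) (s : tmor P Q) :
  linear (fun t : tmor Q R => tcomp t s).
Proof. by move=> a t t'; apply: tmor_eq => Y X v; rewrite tmor_linE. Qed.

Lemma tcomp_linr (M N : modcat C) (P Q R : tamb M N) (t : tmor Q R) :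
  linear (fun s : tmor P Q => tcomp t s).
Proof. by move=> a s s'; apply: tmor_eq => Y X v; rewrite tmor_linE !tcompE tfunP. Qed.

Lemma thcomp_linl (M N K : modcat C) (Q Q' : tamb N K) (P P' : tamb M N)
    (s : tmor P P') : linear (fun t : tmor Q Q' => thcomp t s).
Proof.
move=> a t t'; apply: tmor_comp_eq => Z X Y p q.
by rewrite tmor_linE !thcomp_gen tmor_linE cgenPl.
Qed.

Lemma thcomp_linr (M N K : modcat C) (Q Q' : tamb N K) (P P' : tamb M N)
    (t : tmor Q Q') : linear (fun s : tmor P P' => thcomp t s).
Proof.
move=> a s s'; apply: tmor_comp_eq => Z X Y p q.
by rewrite tmor_linE !thcomp_gen tmor_linE cgenPr.
Qed.

Lemma thcomp1 (M N K : modcat C) (Q : tamb N K) (P : tamb M N) :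
  thcomp (tid Q) (tid P) = tid (comp_tamb Q P).
Proof. by apply: tmor_comp_eq => Z X Y p q; rewrite [LHS]thcomp_gen. Qed.

Lemma thcompM (M N K : modcat C) (Q Q' Q'' : tamb N K) (P P' P'' : tamb M N)
    (t' : tmor Q' Q'') (t : tmor Q Q') (s' : tmor P' P'') (s : tmor P P') :
  thcomp (tcomp t' t) (tcomp s' s) = tcomp (thcomp t' s') (thcomp t s).
Proof.
by apply: tmor_comp_eq => Z X Y p q; rewrite tcompE !thcomp_gen !tcompE.
Qed.

Lemma tassK (M N K L : modcat C) (X : tamb K L) (Q : tamb N K) (P : tamb M N) :
  tcomp (tassv X Q P) (tass X Q P) = tid _.
Proof.
apply: tmor_comp_eql => Z A U Y x q p.
by rewrite tcompE tass_gen tassv_gen.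
Qed.

Lemma tassVK (M N K L : modcat C) (X : tamb K L) (Q : tamb N K) (P : tamb M N) :
  tcomp (tass X Q P) (tassv X Q P) = tid _.
Proof.
apply: tmor_comp_eqr => Z A U Y x q p.
by rewrite tcompE tassv_gen tass_gen.
Qed.

Lemma tass_natural (M N K L : modcat C) (X X' : tamb K L) (Q Q' : tamb N K)
    (P P' : tamb M N) (u : tmor X X') (t : tmor Q Q') (s : tmor P P') :
  tcomp (tass X' Q' P') (thcomp (thcomp u t) s)
  = tcomp (thcomp u (thcomp t s)) (tass X Q P).
Proof.
apply: tmor_comp_eql => Z A U Y x q p.
by rewrite !tcompE !thcomp_gen !tass_gen !thcomp_gen.
Qed.

Lemma tlun_natural (M N : modcat C) (P P' : tamb M N) (s : tmor P P') :
  tcomp (tlun P') (thcomp (tid _) s) = tcomp s (tlun P).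
Proof.
apply: tmor_comp_eq => Z A Y p q.
by rewrite !tcompE !thcomp_gen !tlun_gen tfun_nat.
Qed.

Lemma trun_natural (M N : modcat C) (P P' : tamb M N) (s : tmor P P') :
  tcomp (trun P') (thcomp s (tid _)) = tcomp s (trun P).
Proof.
apply: tmor_comp_eq => Z A Y p q.
by rewrite !tcompE !thcomp_gen !trun_gen tfun_nat.
Qed.

Lemma tpentagon (A B D E F : modcat C) (i : tamb E F) (h : tamb D E)
    (g : tamb B D) (f : tamb A B) :
  tcomp (thcomp (tid i) (tass h g f))
    (tcomp (tass i (comp_tamb h g) f) (thcomp (tass i h g) (tid f)))
  = tcomp (tass i h (comp_tamb g f)) (tass (comp_tamb i h) g f).
Proof.
apply: tmor_comp_eql => Z X U Y w p q; move: w.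
apply: coend_ext => [a u v|a u v|V x y].
- by rewrite !cgenPl tfunP.
- by rewrite !cgenPl tfunP.
by rewrite !tcompE !thcomp_gen !tass_gen !thcomp_gen !tass_gen.
Qed.

Lemma ttriangle (A B D : modcat C) (g : tamb B D) (f : tamb A B) :
  tcomp (thcomp (tid g) (tlun f)) (tass g (hom_tamb B) f) = thcomp (trun g) (tid f).
Proof.
apply: tmor_comp_eql => Z X U Y x p q.
by rewrite !tcompE !thcomp_gen !tass_gen !thcomp_gen tlun_gen trun_gen cgen_bal.
Qed.

Definition Tamb : bicat k :=
  @Bicat k (modcat C) (fun M N => tamb M N) (fun M N P Q => tmor P Q)
    (fun M => hom_tamb M) (fun M N K Q P => comp_tamb Q P)
    (fun M N P => tid P) (fun M N P Q R t s => tcomp t s)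
    (fun M N K Q Q' P P' t s => thcomp t s)
    (fun M N K L X Q P => tass X Q P) (fun M N K L X Q P => tassv X Q P)
    (fun M N P => tlun P) (fun M N P => tlunv P)
    (fun M N P => trun P) (fun M N P => trunv P)
    tcomp_linl tcomp_linr thcomp_linl thcomp_linr
    tcomp1l tcomp1r tcompA thcomp1 thcompM tassK tassVK (@tlunK k C) (@tlunVK k C) (@trunK k C) (@trunVK k C)
    tass_natural tlun_natural trun_natural tpentagon ttriangle.

Definition Tamb_c : bicat k := @full_sub k Tamb (@very_cyclic k C).

End TambBicategory.

Section Coequalizers.
Context (k : fieldType) (C : moncat k) (M N : modcat C) (P Q : tamb M N).
Context (u v : tmor P Q).

Definition coeq_rel Y X (V : lmodType k) (f : Q Y X -> V) : Prop :=
  linear f /\ forall p : P Y X, f (u Y X p) = f (v Y X p).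

Definition coeq Y X : lmodType k := uvs (@coeq_rel Y X).

Definition qgen Y X (q : Q Y X) : coeq Y X := ugen (@coeq_rel Y X) q.

Lemma qgen_lin Y X : linear (@qgen Y X).
Proof.
move=> a p q; rewrite /qgen /ugen upi_lin; apply: upiP => V f Rf.
rewrite lcomb_cat lcomb_scale !lcomb1; case: Rf => Rf _; exact: Rf.
Qed.

Lemma qgenP Y X a p q : @qgen Y X (a *: p + q) = a *: qgen p + qgen q.
Proof. exact: qgen_lin. Qed.

Lemma qgen_eq Y X (p : P Y X) : qgen (u Y X p) = qgen (v Y X p).
Proof.
apply: upiP => V f Rf.
rewrite !lcomb1; case: Rf => _ Rf; exact: Rf.
Qed.

Definition qlift Y X (V : lmodType k) (f : Q Y X -> V) : coeq Y X -> V := ulift f.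

Lemma qlift_lin Y X (V : lmodType k) (f : Q Y X -> V) :
  coeq_rel f -> linear (qlift f).
Proof. by move=> fR; have [] := uvsP (R := @coeq_rel Y X) fR. Qed.

Lemma qlift_gen Y X (V : lmodType k) (f : Q Y X -> V) :
  coeq_rel f -> forall q, qlift f (qgen q) = f q.
Proof. by move=> fR q; have [_ e] := uvsP (R := @coeq_rel Y X) fR; apply: e. Qed.

Lemma coeq_ext Y X (V : lmodType k) (f g : coeq Y X -> V) :
  linear f -> linear g -> (forall q, f (qgen q) = g (qgen q)) -> f =1 g.
Proof. exact: uvs_ext. Qed.

Definition coeq_map Y Y' X X' (f : hom Y' Y) (g : hom X X') : coeq Y X -> coeq Y' X' :=
  qlift (fun q => qgen (pmap f g q)).

Lemma coeq_map_rel Y Y' X X' (f : hom Y' Y) (g : hom X X') :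
  coeq_rel (fun q : Q Y X => qgen (pmap f g q)).
Proof. by split=> [a p q|p]; rewrite ?pmapPv ?qgenP // -!tfun_nat qgen_eq. Qed.

Lemma coeq_map_gen Y Y' X X' (f : hom Y' Y) (g : hom X X') (q : Q Y X) :
  coeq_map f g (qgen q) = qgen (pmap f g q).
Proof. exact: (qlift_gen (coeq_map_rel f g)). Qed.

Lemma coeq_map_lin Y Y' X X' (f : hom Y' Y) (g : hom X X') :
  linear (coeq_map f g).
Proof. exact: (qlift_lin (coeq_map_rel f g)). Qed.

Lemma coeq_mapP Y Y' X X' (f : hom Y' Y) (g : hom X X') a p q :
  coeq_map f g (a *: p + q) = a *: coeq_map f g p + coeq_map f g q.
Proof. exact: coeq_map_lin. Qed.

Lemma coeq_ext_param Y X (W V : lmodType k) (g : W -> coeq Y X -> V) :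
  (forall w, linear (g w)) -> (forall q, linear (fun w => g w (qgen q))) ->
  forall x, linear (fun w => g w x).
Proof.
move=> gl gg x a w w'; move: x; apply: coeq_ext => [//|b p q|q]; last exact: gg.
rewrite !gl !scalerDr !scalerA (mulrC a) -!addrA; congr (_ + _).
by rewrite !addrA; congr (_ + _); rewrite addrC.
Qed.

Lemma coeq_map_linl Y Y' X X' (g : hom X X') x :
  linear (fun f : hom Y' Y => coeq_map f g x).
Proof.
apply: (coeq_ext_param (g := fun f : hom Y' Y => coeq_map f g)) => [f|q a f f'].
  exact: coeq_map_lin.
by rewrite !coeq_map_gen pmapPl qgenP.
Qed.

Lemma coeq_map_linr Y Y' X X' (f : hom Y' Y) x :
  linear (fun g : hom X X' => coeq_map f g x).
Proof.
apply: (coeq_ext_param (g := fun g : hom X X' => coeq_map f g)) => [g|q a g g'].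
  exact: coeq_map_lin.
by rewrite !coeq_map_gen pmapPr qgenP.
Qed.

Lemma coeq_map1 Y X x : coeq_map (idm Y) (idm X) x = x.
Proof.
move: x; apply: coeq_ext => [a p q|//|q]; first by rewrite coeq_mapP.
by rewrite coeq_map_gen pmap1.
Qed.

Lemma coeq_mapM Y Y' Y'' X X' X'' (f : hom Y' Y) (f' : hom Y'' Y')
    (g : hom X X') (g' : hom X' X'') x :
  coeq_map (f ∘ f') (g' ∘ g) x = coeq_map f' g' (coeq_map f g x).
Proof.
move: x; apply: coeq_ext => [a p q|a p q|q].
- by rewrite coeq_mapP.
- by rewrite !coeq_mapP.
- by rewrite !coeq_map_gen pmapM.
Qed.

Definition coeq_prof : prof M N :=
  Prof coeq_map_lin coeq_map_linl coeq_map_linr coeq_map1 coeq_mapM.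

Definition coeq_str H Y X : coeq_prof Y X -> coeq_prof (mact N H Y) (mact M H X) :=
  qlift (fun q => qgen (tstr Q H q)).

Lemma coeq_str_rel H Y X : coeq_rel (fun q : Q Y X => qgen (tstr Q H q)).
Proof. by split=> [a p q|p]; rewrite ?tstrP ?qgenP // -!tfun_str qgen_eq. Qed.

Lemma coeq_str_gen H Y X (q : Q Y X) : coeq_str H (qgen q) = qgen (tstr Q H q).
Proof. exact: (qlift_gen (coeq_str_rel H Y X)). Qed.

Lemma coeq_str_lin H Y X : linear (@coeq_str H Y X).
Proof. exact: (qlift_lin (coeq_str_rel H Y X)). Qed.

Lemma coeq_strP H Y X a p q :
  @coeq_str H Y X (a *: p + q) = a *: coeq_str H p + coeq_str H q.
Proof. exact: coeq_str_lin. Qed.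

Lemma coeq_str_nat H Y Y' X X' (f : hom Y' Y) (g : hom X X') (x : coeq_prof Y X) :
  coeq_str H (pmap f g x) = pmap (fmap (mact N H) f) (fmap (mact M H) g) (coeq_str H x).
Proof.
move: x; apply: coeq_ext => [a p q|a p q|q] /=.
- by rewrite coeq_mapP coeq_strP.
- by rewrite coeq_strP coeq_mapP.
- by rewrite coeq_map_gen !coeq_str_gen coeq_map_gen tstr_nat.
Qed.

Lemma coeq_str_ext H H' (h : hom H H') Y X (x : coeq_prof Y X) :
  pmap (idm (mact N H Y)) (mactm M h X) (coeq_str H x)
  = pmap (mactm N h Y) (idm (mact M H' X)) (coeq_str H' x).
Proof.
move: x; apply: coeq_ext => [a p q|a p q|q] /=.
- by rewrite coeq_strP coeq_mapP.
- by rewrite coeq_strP coeq_mapP.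
- by rewrite !coeq_str_gen !coeq_map_gen tstr_ext.
Qed.

Lemma coeq_str_mul G F Y X (x : coeq_prof Y X) :
  pmap (mmul N G F Y) (idm (mact M (ten G F) X)) (coeq_str (ten G F) x)
  = pmap (idm (mact N G (mact N F Y))) (mmul M G F X) (coeq_str G (coeq_str F x)).
Proof.
move: x; apply: coeq_ext => [a p q|a p q|q] /=.
- by rewrite coeq_strP coeq_mapP.
- by rewrite !coeq_strP coeq_mapP.
- by rewrite !coeq_str_gen !coeq_map_gen tstr_mul.
Qed.

Lemma coeq_str_one Y X (x : coeq_prof Y X) :
  pmap (mone N Y) (mone_inv M X) (coeq_str (tunit C) x) = x.
Proof.
move: x; apply: coeq_ext => [a p q|//|q] /=.
- by rewrite coeq_strP coeq_mapP.
- by rewrite coeq_str_gen coeq_map_gen tstr_one.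
Qed.

(* The coequalizer of u and v in the category of Tambara modules, see
   [tquot_eq], [tquot_fact] and [tquot_epi]. *)
Definition coeq_tamb : tamb M N :=
  @Tamb_ k C M N coeq_prof _ coeq_str_lin coeq_str_nat coeq_str_ext coeq_str_mul coeq_str_one.

Definition tquot : tmor Q coeq_tamb :=
  TMor (P := Q) (Q := coeq_tamb) qgen_lin
    (fun Y Y' X X' f g q => esym (coeq_map_gen f g q))
    (fun H Y X q => esym (coeq_str_gen H q)).

Lemma tquot_eq : tcomp tquot u = tcomp tquot v.
Proof. by apply: tmor_eq => Y X p; apply: qgen_eq. Qed.

Lemma tquot_epi (R : tamb M N) (s t : tmor coeq_tamb R) :
  tcomp s tquot = tcomp t tquot -> s = t.
Proof.
move=> /tmor_eqP st; apply: tmor_eq => Y X.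
by apply: coeq_ext => [a p q|a p q|q]; rewrite ?tfunP //; apply: st.
Qed.

Section Factor.
Context (R : tamb M N) (f : tmor Q R) (fuv : tcomp f u = tcomp f v).

Lemma tfact_rel Y X : coeq_rel (f Y X).
Proof. by split=> [a p q|p]; [rewrite tfunP|apply: (tmor_eqP fuv)]. Qed.

Lemma tfact_lin Y X : linear (qlift (f Y X)).
Proof. exact: (qlift_lin (tfact_rel Y X)). Qed.

Lemma tfact_nat Y Y' X X' (g : hom Y' Y) (h : hom X X') (x : coeq_tamb Y X) :
  qlift (f Y' X') (pmap g h x) = pmap g h (qlift (f Y X) x).
Proof.
move: x; apply: coeq_ext => [a p q|a p q|q] /=.
- by rewrite coeq_mapP tfact_lin.
- by rewrite tfact_lin pmapPv.
- by rewrite coeq_map_gen !qlift_gen ?tfun_nat //; apply: tfact_rel.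
Qed.

Lemma tfact_str H Y X (x : coeq_tamb Y X) :
  qlift (f _ _) (tstr coeq_tamb H x) = tstr R H (qlift (f Y X) x).
Proof.
move: x; apply: coeq_ext => [a p q|a p q|q] /=.
- by rewrite coeq_strP tfact_lin.
- by rewrite tfact_lin tstrP.
- by rewrite coeq_str_gen !qlift_gen ?tfun_str //; apply: tfact_rel.
Qed.

Definition tfact : tmor coeq_tamb R :=
  TMor (P := coeq_tamb) tfact_lin tfact_nat tfact_str.

Lemma tquot_fact : tcomp tfact tquot = f.
Proof. by apply: tmor_eq => Y X q; apply: (qlift_gen (tfact_rel Y X)). Qed.

End Factor.

End Coequalizers.

(* Monoids and bimodules in Tamb(M, M), which is a monoidal category for
   [comp_tamb], [hom_tamb], [tass], [tlun] and [trun]. *)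
Section Bimodules.
Context (k : fieldType) (C : moncat k) (M : modcat C).

Record tmonoid := TMonoid {
  mon_car :> tamb M M;
  mon_mul : tmor (comp_tamb mon_car mon_car) mon_car;
  mon_one : tmor (hom_tamb M) mon_car;
  mon_mulA : tcomp mon_mul (thcomp mon_mul (tid mon_car))
    = tcomp mon_mul (tcomp (thcomp (tid mon_car) mon_mul)
                           (tass mon_car mon_car mon_car));
  mon_mul1l : tcomp mon_mul (thcomp mon_one (tid mon_car)) = tlun mon_car;
  mon_mul1r : tcomp mon_mul (thcomp (tid mon_car) mon_one) = trun mon_car }.

(* B-A-bimodules, i.e. 1-cells from A to B. *)
Record bimod (A B : tmonoid) := BiMod {
  bim_car :> tamb M M;
  lact : tmor (comp_tamb B bim_car) bim_car;
  ract : tmor (comp_tamb bim_car A) bim_car;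
  lact_mul : tcomp lact (thcomp (mon_mul B) (tid bim_car))
    = tcomp lact (tcomp (thcomp (tid B) lact) (tass B B bim_car));
  lact_one : tcomp lact (thcomp (mon_one B) (tid bim_car)) = tlun bim_car;
  ract_mul : tcomp ract (thcomp ract (tid A))
    = tcomp ract (tcomp (thcomp (tid bim_car) (mon_mul A)) (tass bim_car A A));
  ract_one : tcomp ract (thcomp (tid bim_car) (mon_one A)) = trun bim_car;
  lract : tcomp ract (thcomp lact (tid A))
    = tcomp lact (tcomp (thcomp (tid B) ract) (tass B bim_car A)) }.

Record bimor (A B : tmonoid) (P Q : bimod A B) := BiMor {
  bim_mor :> tmor P Q;
  bim_morl : tcomp bim_mor (lact P) = tcomp (lact Q) (thcomp (tid B) bim_mor);
  bim_morr : tcomp bim_mor (ract P) = tcomp (ract Q) (thcomp bim_mor (tid A)) }.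

Lemma bimor_eq (A B : tmonoid) (P Q : bimod A B) (s t : bimor P Q) :
  (forall F G (v : P F G), s F G v = t F G v) -> s = t.
Proof.
case: s t => [s s1 s2] [t t1 t2] /= /tmor_eq e.
by case: _ / e t1 t2 => t1 t2; f_equal; apply: Prop_irrelevance.
Qed.

Section Elements.
Context (A B : tmonoid) (P : bimod A B).

Definition lc F H G (b : B F H) (p : P H G) : P F G := lact P F G (cgen b p).
Definition rc F H G (p : P F H) (a : A H G) : P F G := ract P F G (cgen p a).
Definition mul F H G (b : B F H) (b' : B H G) : B F G := mon_mul B F G (cgen b b').
Definition one F : B F F := mon_one B F F (idm F).

Lemma lcPl F H G a (b b' : B F H) (p : P H G) :
  lc (a *: b + b') p = a *: lc b p + lc b' p.
Proof. by rewrite /lc cgenPl tfunP. Qed.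

Lemma lcPr F H G a (b : B F H) (p p' : P H G) :
  lc b (a *: p + p') = a *: lc b p + lc b p'.
Proof. by rewrite /lc cgenPr tfunP. Qed.

Lemma lc_bal F H H' G (h : hom H H') (b : B F H) (p : P H' G) :
  lc (pmap (idm F) h b) p = lc b (pmap h (idm G) p).
Proof. by rewrite /lc cgen_bal. Qed.

Lemma lc_nat F F' G G' (f : hom F' F) (g : hom G G') H (b : B F H) (p : P H G) :
  lc (pmap f (idm H) b) (pmap (idm H) g p) = pmap f g (lc b p).
Proof. by rewrite /lc -tfun_nat pmap_gen. Qed.

Lemma lc_str K F H G (b : B F H) (p : P H G) :
  lc (tstr B K b) (tstr P K p) = tstr P K (lc b p).
Proof. by rewrite /lc -tfun_str tstr_gen. Qed.

Lemma lc_mul F H H' G (b : B F H) (b' : B H H') (p : P H' G) :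
  lc (mul b b') p = lc b (lc b' p).
Proof.
have := tmor_eqP (lact_mul P) (cgen (Psi := comp_tamb B B) (cgen b b') p).
by rewrite !tcompE tass_gen !thcomp_gen.
Qed.

Lemma lc_one F G (p : P F G) : lc (one F) p = p.
Proof.
have := tmor_eqP (lact_one P) (cgen (Psi := hom_tamb M) (idm F) p).
by rewrite tcompE thcomp_gen tlun_gen pmap1.
Qed.

Lemma rcPl F H G a (p p' : P F H) (b : A H G) :
  rc (a *: p + p') b = a *: rc p b + rc p' b.
Proof. by rewrite /rc cgenPl tfunP. Qed.

Lemma rcPr F H G a (p : P F H) (b b' : A H G) :
  rc p (a *: b + b') = a *: rc p b + rc p b'.
Proof. by rewrite /rc cgenPr tfunP. Qed.

Lemma rc_bal F H H' G (h : hom H H') (p : P F H) (b : A H' G) :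
  rc (pmap (idm F) h p) b = rc p (pmap h (idm G) b).
Proof. by rewrite /rc cgen_bal. Qed.

Lemma rc_nat F F' G G' (f : hom F' F) (g : hom G G') H (p : P F H) (b : A H G) :
  rc (pmap f (idm H) p) (pmap (idm H) g b) = pmap f g (rc p b).
Proof. by rewrite /rc -tfun_nat pmap_gen. Qed.

Lemma rc_str K F H G (p : P F H) (b : A H G) :
  rc (tstr P K p) (tstr A K b) = tstr P K (rc p b).
Proof. by rewrite /rc -tfun_str tstr_gen. Qed.

Lemma lrc F H H' G (b : B F H) (p : P H H') (a : A H' G) :
  rc (lc b p) a = lc b (rc p a).
Proof.
have := tmor_eqP (lract P) (cgen (Psi := comp_tamb B P) (cgen b p) a).
by rewrite !tcompE tass_gen !thcomp_gen.
Qed.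

End Elements.

Section Elements2.
Context (A B : tmonoid) (P : bimod A B).

Lemma rc_mul F H H' G (p : P F H) (a : A H H') (a' : A H' G) :
  rc (rc p a) a' = rc p (mul a a').
Proof.
have := tmor_eqP (ract_mul P) (cgen (Psi := comp_tamb P A) (cgen p a) a').
by rewrite !tcompE tass_gen !thcomp_gen.
Qed.

Lemma rc_one F G (p : P F G) : rc p (one A G) = p.
Proof.
have := tmor_eqP (ract_one P) (cgen (Phi := hom_tamb M) p (idm G)).
by rewrite tcompE thcomp_gen trun_gen pmap1.
Qed.

Context (Q : bimod A B).

Lemma bimor_lc (s : bimor P Q) F H G (b : B F H) (p : P H G) :
  s F G (lc b p) = lc b (s H G p).
Proof.
have := tmor_eqP (bim_morl s) (cgen b p).
by rewrite !tcompE thcomp_gen.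
Qed.

Lemma bimor_rc (s : bimor P Q) F H G (p : P F H) (a : A H G) :
  s F G (rc p a) = rc (s F H p) a.
Proof.
have := tmor_eqP (bim_morr s) (cgen p a).
by rewrite !tcompE thcomp_gen.
Qed.

Section MkBimor.
Context (s : tmor P Q).
Hypothesis sl : forall F H G (b : B F H) (p : P H G), s F G (lc b p) = lc b (s H G p).
Hypothesis sr : forall F H G (p : P F H) (a : A H G), s F G (rc p a) = rc (s F H p) a.

Lemma mk_bimorl : tcomp s (lact P) = tcomp (lact Q) (thcomp (tid B) s).
Proof. by apply: tmor_comp_eq => F G H b p; rewrite !tcompE thcomp_gen; apply: sl. Qed.

Lemma mk_bimorr : tcomp s (ract P) = tcomp (ract Q) (thcomp s (tid A)).
Proof. by apply: tmor_comp_eq => F G H p a; rewrite !tcompE thcomp_gen; apply: sr. Qed.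

Definition mk_bimor : bimor P Q := BiMor mk_bimorl mk_bimorr.
End MkBimor.

End Elements2.

Section BimodVertical.
Context (A B : tmonoid).

Definition bid (P : bimod A B) : bimor P P :=
  @mk_bimor A B P P (tid P) (fun _ _ _ _ _ => erefl) (fun _ _ _ _ _ => erefl).

Context (P Q R : bimod A B) (t : bimor Q R) (s : bimor P Q).

Lemma bcomp_lc F H G (b : B F H) (p : P H G) :
  tcomp t s F G (lc b p) = lc b (tcomp t s H G p).
Proof. by rewrite !tcompE !bimor_lc. Qed.

Lemma bcomp_rc F H G (p : P F H) (a : A H G) :
  tcomp t s F G (rc p a) = rc (tcomp t s F H p) a.
Proof. by rewrite !tcompE !bimor_rc. Qed.

Definition bcomp : bimor P R := mk_bimor bcomp_lc bcomp_rc.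

End BimodVertical.

Section BimodLinear.
Context (A B : tmonoid) (P Q : bimod A B).
Implicit Types s t r : bimor P Q.

Lemma blin_lc c s t F H G (b : B F H) (p : P H G) :
  (c *: (s : tmor P Q) + t) F G (lc b p) = lc b ((c *: (s : tmor P Q) + t) H G p).
Proof. by rewrite !tmor_linE lcPr !bimor_lc. Qed.

Lemma blin_rc c s t F H G (p : P F H) (a : A H G) :
  (c *: (s : tmor P Q) + t) F G (rc p a) = rc ((c *: (s : tmor P Q) + t) F H p) a.
Proof. by rewrite !tmor_linE rcPl !bimor_rc. Qed.

Definition blin c s t : bimor P Q := mk_bimor (@blin_lc c s t) (@blin_rc c s t).

Lemma bzero_lc F H G (b : B F H) (p : P H G) :
  (0 : tmor P Q) F G (lc b p) = lc b ((0 : tmor P Q) H G p).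
Proof. exact/esym/(lin0 (fun a u v => lcPr a b u v)). Qed.

Lemma bzero_rc F H G (p : P F H) (a : A H G) :
  (0 : tmor P Q) F G (rc p a) = rc ((0 : tmor P Q) F H p) a.
Proof. exact/esym/(lin0 (fun c u v => rcPl c u v a)). Qed.

Definition bzero : bimor P Q := mk_bimor bzero_lc bzero_rc.

Definition badd s t := blin 1 s t.
Definition bscale c s := blin c s bzero.

Lemma bscaleE c s F G (v : P F G) : bscale c s F G v = c *: s F G v.
Proof. by rewrite [LHS]tmor_linE addr0. Qed.

Lemma baddE s t F G (v : P F G) : badd s t F G v = s F G v + t F G v.
Proof. by rewrite [LHS]tmor_linE scale1r. Qed.

Lemma baddA : associative badd.
Proof. by move=> s t r; apply: bimor_eq => Y X v; rewrite !baddE addrA. Qed.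

Lemma baddC : commutative badd.
Proof. by move=> s t; apply: bimor_eq => Y X v; rewrite !baddE addrC. Qed.

Lemma badd0 : left_id bzero badd.
Proof. by move=> s; apply: bimor_eq => Y X v; rewrite baddE add0r. Qed.

Lemma baddN : left_inverse bzero (bscale (-1)) badd.
Proof. by move=> s; apply: bimor_eq => Y X v; rewrite baddE bscaleE scaleN1r addNr. Qed.

HB.instance Definition _ := gen_eqMixin (bimor P Q).
HB.instance Definition _ := gen_choiceMixin (bimor P Q).
HB.instance Definition _ := GRing.isZmodule.Build (bimor P Q) baddA baddC badd0 baddN.

Lemma bscaleA a b s : bscale a (bscale b s) = bscale (a * b) s.
Proof. by apply: bimor_eq => Y X v; rewrite !bscaleE scalerA. Qed.

Lemma bscale1 : left_id 1 bscale.
Proof. by move=> s; apply: bimor_eq => Y X v; rewrite bscaleE scale1r. Qed.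

Lemma bscaleDr : right_distributive bscale +%R.
Proof.
move=> a s t; apply: bimor_eq => Y X v.
by rewrite [LHS]bscaleE [RHS]baddE !bscaleE [X in _ *: X]baddE scalerDr.
Qed.

Lemma bscaleDl s : {morph bscale^~ s : a b / a + b >-> a + b}.
Proof.
by move=> a b; apply: bimor_eq => Y X v; rewrite bscaleE [RHS]baddE !bscaleE scalerDl.
Qed.

HB.instance Definition _ :=
  GRing.Zmodule_isLmodule.Build k (bimor P Q) bscaleA bscale1 bscaleDr bscaleDl.

Lemma bimor_linE a s t Y X (v : P Y X) : (a *: s + t) Y X v = a *: s Y X v + t Y X v.
Proof. by rewrite [LHS]baddE [X in X + _]bscaleE. Qed.

End BimodLinear.

Section RegularBimodule.
Context (A : tmonoid).

Definition reg_bimod : bimod A A :=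
  @BiMod A A A (mon_mul A) (mon_mul A) (mon_mulA A) (mon_mul1l A)
    (mon_mulA A) (mon_mul1r A) (mon_mulA A).

Lemma lc_reg F H G (a a' : A _ _) : lc (P := reg_bimod) (F := F) (H := H) (G := G) a a' = mul a a'.
Proof. by []. Qed.

Lemma rc_reg F H G (a a' : A _ _) : rc (P := reg_bimod) (F := F) (H := H) (G := G) a a' = mul a a'.
Proof. by []. Qed.

Lemma mul_natA F F' G G' (f : hom F' F) (g : hom G G') H (a : A F H) (a' : A H G) :
  mul (pmap f (idm H) a) (pmap (idm H) g a') = pmap f g (mul a a').
Proof. exact: (@lc_nat A A reg_bimod). Qed.

Lemma mul_one F G (a : A F G) : mul a (one A G) = a.
Proof. exact: (@rc_one A A reg_bimod). Qed.

Lemma one_mul F G (a : A F G) : mul (one A F) a = a.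
Proof. exact: (@lc_one A A reg_bimod). Qed.

Lemma one_nat F G (f : hom F G) :
  pmap (idm F) f (one A F) = pmap f (idm G) (one A G).
Proof.
rewrite /one -!tfun_nat; congr (mon_one A _ _ _).
by rewrite /= /homprof_map !cmpm1 !cmp1m.
Qed.

Lemma one_str H F : tstr A H (one A F) = one A (mact M H F).
Proof. by rewrite /one -tfun_str /= fmap1. Qed.

End RegularBimodule.

(* The relative tensor product: the coequalizer of the two actions of the
   middle monoid. *)
Section RelativeTensor.
Context (A B D : tmonoid) (Q : bimod B D) (P : bimod A B).

Definition rt_car : tamb M M :=
  coeq_tamb (thcomp (ract Q) (tid P))
            (tcomp (thcomp (tid Q) (lact P)) (tass Q B P)).

Definition rt_quot : tmor (comp_tamb Q P) rt_car :=
  tquot (thcomp (ract Q) (tid P))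
        (tcomp (thcomp (tid Q) (lact P)) (tass Q B P)).

Definition rgen Z X Y (q : Q Z Y) (p : P Y X) : rt_car Z X :=
  rt_quot Z X (cgen q p).

Lemma rgenPl Z X Y a (q q' : Q Z Y) (p : P Y X) :
  rgen (a *: q + q') p = a *: rgen q p + rgen q' p.
Proof. by rewrite /rgen cgenPl tfunP. Qed.

Lemma rgenPr Z X Y a (q : Q Z Y) (p p' : P Y X) :
  rgen q (a *: p + p') = a *: rgen q p + rgen q p'.
Proof. by rewrite /rgen cgenPr tfunP. Qed.

Lemma rgen_bal Z X Y Y' (h : hom Y Y') (q : Q Z Y) (p : P Y' X) :
  rgen (pmap (idm Z) h q) p = rgen q (pmap h (idm X) p).
Proof. by rewrite /rgen cgen_bal. Qed.

Lemma rgen_act Z X Y Y' (q : Q Z Y) (b : B Y Y') (p : P Y' X) :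
  rgen (rc q b) p = rgen q (lc b p).
Proof.
have := tmor_eqP (tquot_eq (thcomp (ract Q) (tid P))
        (tcomp (thcomp (tid Q) (lact P)) (tass Q B P)))
        (cgen (Psi := comp_tamb Q B) (cgen q b) p).
by rewrite !tcompE tass_gen !thcomp_gen.
Qed.

Lemma pmap_rgen Z Z' X X' (f : hom Z' Z) (g : hom X X') Y (q : Q Z Y) (p : P Y X) :
  pmap f g (rgen q p) = rgen (pmap f (idm Y) q) (pmap (idm Y) g p).
Proof. by rewrite /rgen -tfun_nat pmap_gen. Qed.

Lemma tstr_rgen H Z X Y (q : Q Z Y) (p : P Y X) :
  tstr rt_car H (rgen q p) = rgen (tstr Q H q) (tstr P H p).
Proof. by rewrite /rgen -tfun_str tstr_gen. Qed.

Lemma rt_ext Z X (V : lmodType k) (f g : rt_car Z X -> V) :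
  linear f -> linear g ->
  (forall Y (q : Q Z Y) (p : P Y X), f (rgen q p) = g (rgen q p)) -> f =1 g.
Proof.
move=> fl gl fg; apply: coeq_ext => //.
apply: coend_ext => [a u v|a u v|Y q p]; last exact: fg.
- by rewrite qgenP fl.
- by rewrite qgenP gl.
Qed.

Lemma rt_ext_param Z X (W V : lmodType k) (g : W -> rt_car Z X -> V) :
  (forall w, linear (g w)) ->
  (forall Y (q : Q Z Y) (p : P Y X), linear (fun w => g w (rgen q p))) ->
  forall x, linear (fun w => g w x).
Proof.
move=> gl gg x a w w'; move: x; apply: rt_ext => [//|b u v|Y q p]; last exact: gg.
rewrite !gl !scalerDr !scalerA (mulrC a) -!addrA; congr (_ + _).
by rewrite !addrA; congr (_ + _); rewrite addrC.
Qed.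

Lemma rt_eq (R : tamb M M) (s t : tmor rt_car R) :
  (forall Z X Y (q : Q Z Y) (p : P Y X), s Z X (rgen q p) = t Z X (rgen q p)) -> s = t.
Proof.
move=> st; apply: tmor_eq => Z X; apply: rt_ext => [a u v|a u v|Y q p].
- by rewrite tfunP.
- by rewrite tfunP.
- exact: st.
Qed.

Section Lift.
Context (Z X : M) (V : lmodType k) (g : forall Y, Q Z Y -> P Y X -> V).

Definition rbal : Prop := cbal g /\
  forall Y Y' (q : Q Z Y) (b : B Y Y') (p : P Y' X), g (rc q b) p = g q (lc b p).

Definition rlift : rt_car Z X -> V :=
  qlift (u := thcomp (ract Q) (tid P))
    (v := tcomp (thcomp (tid Q) (lact P)) (tass Q B P))
    (clift g : comp_tamb Q P Z X -> V).

Lemma rlift_rel : rbal -> coeq_rel (thcomp (ract Q) (tid P))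
  (tcomp (thcomp (tid Q) (lact P)) (tass Q B P)) (clift g : comp_tamb Q P Z X -> V).
Proof.
case=> gb gB; split; first exact: clift_lin.
apply: coend_ext => [a u v|a u v|Y w p].
- by rewrite tfunP clift_lin.
- by rewrite tfunP clift_lin.
move: w; apply: coend_ext => [a u v|a u v|U q b].
- by rewrite cgenPl tfunP clift_lin.
- by rewrite cgenPl tfunP clift_lin.
rewrite tcompE tass_gen !thcomp_gen !clift_gen //; exact: gB.
Qed.

Lemma rlift_lin : rbal -> linear rlift.
Proof. by move=> gb; apply: (qlift_lin (rlift_rel gb)). Qed.

Lemma rlift_gen : rbal -> forall Y (q : Q Z Y) (p : P Y X), rlift (rgen q p) = g q p.
Proof.
move=> gb Y q p; rewrite [LHS](qlift_gen (rlift_rel gb)) clift_gen //.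
by case: gb.
Qed.
End Lift.

Section TLift.
Context (R : tamb M M) (g : forall Z X Y, Q Z Y -> P Y X -> R Z X).
Hypothesis gbal : forall Z X, rbal (fun Y (q : Q Z Y) (p : P Y X) => g q p).
Hypothesis gnat : forall Z Z' X X' (f : hom Z' Z) (h : hom X X') Y
  (q : Q Z Y) (p : P Y X), g (pmap f (idm Y) q) (pmap (idm Y) h p) = pmap f h (g q p).
Hypothesis gstr : forall H Z X Y (q : Q Z Y) (p : P Y X),
  g (tstr Q H q) (tstr P H p) = tstr R H (g q p).

Definition rtlift_fun Z X : rt_car Z X -> R Z X :=
  rlift (fun Y (q : Q Z Y) (p : P Y X) => g q p).

Lemma rtlift_lin Z X : linear (@rtlift_fun Z X).
Proof. exact: (rlift_lin (gbal Z X)). Qed.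

Lemma rtlift_fun_gen Z X Y (q : Q Z Y) (p : P Y X) : rtlift_fun (rgen q p) = g q p.
Proof. exact: (rlift_gen (gbal Z X)). Qed.

Lemma rtlift_nat Z Z' X X' (f : hom Z' Z) (h : hom X X') (v : rt_car Z X) :
  rtlift_fun (pmap f h v) = pmap f h (rtlift_fun v).
Proof.
move: v; apply: rt_ext => [a u v|a u v|Y q p].
- by rewrite pmapPv rtlift_lin.
- by rewrite rtlift_lin pmapPv.
- by rewrite pmap_rgen !rtlift_fun_gen gnat.
Qed.

Lemma rtlift_str H Z X (v : rt_car Z X) :
  rtlift_fun (tstr rt_car H v) = tstr R H (rtlift_fun v).
Proof.
move: v; apply: rt_ext => [a u v|a u v|Y q p].
- by rewrite tstrP rtlift_lin.
- by rewrite rtlift_lin tstrP.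
- by rewrite tstr_rgen !rtlift_fun_gen gstr.
Qed.

Definition rtlift : tmor rt_car R := TMor (P := rt_car) rtlift_lin rtlift_nat rtlift_str.

Lemma rtlift_gen Z X Y (q : Q Z Y) (p : P Y X) : rtlift Z X (rgen q p) = g q p.
Proof. exact: rtlift_fun_gen. Qed.

End TLift.

(* The outer actions. *)
Definition rtl1 Z X U (d : D Z U) (w : rt_car U X) : rt_car Z X :=
  rlift (fun Y (q : Q U Y) (p : P Y X) => rgen (lc d q) p) w.

Lemma rtl1_bal Z X U (d : D Z U) :
  rbal (fun Y (q : Q U Y) (p : P Y X) => rgen (lc d q) p).
Proof.
split; first split=> [Y p a u v|Y q a u v|Y Y' h q p].
- by rewrite lcPr rgenPl.
- by rewrite rgenPr.
- rewrite -rgen_bal; congr rgen.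
  by rewrite -lc_nat pmap1.
- by move=> Y Y' q b p; rewrite -lrc rgen_act.
Qed.

Lemma rtl1_gen Z X U Y (d : D Z U) (q : Q U Y) (p : P Y X) :
  rtl1 d (rgen q p) = rgen (lc d q) p.
Proof. exact: (rlift_gen (rtl1_bal X d)). Qed.

Lemma rtl1_linr Z X U d : linear (@rtl1 Z X U d).
Proof. exact: (rlift_lin (rtl1_bal X d)). Qed.

Lemma rtl1_linl Z X U w : linear (fun d => @rtl1 Z X U d w).
Proof.
apply: (rt_ext_param (g := fun d w => @rtl1 Z X U d w)) => [d|Y q p a u v].
  exact: rtl1_linr.
by rewrite !rtl1_gen lcPl rgenPl.
Qed.

Lemma rtl1_bal2 Z X : cbal (fun U (d : D Z U) (w : rt_car U X) => rtl1 d w).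
Proof.
split=> [U w|U d|U U' h d w]; [exact: rtl1_linl|exact: rtl1_linr|].
move: w; apply: rt_ext => [a u v|a u v|Y q p].
- by rewrite rtl1_linr.
- by rewrite pmapPv rtl1_linr.
- by rewrite pmap_rgen !rtl1_gen pmap1 lc_bal.
Qed.

Lemma rtl1_nat Z Z' X X' (f : hom Z' Z) (h : hom X X') U (d : D Z U) (w : rt_car U X) :
  rtl1 (pmap f (idm U) d) (pmap (idm U) h w) = pmap f h (rtl1 d w).
Proof.
move: w; apply: rt_ext => [a u v|a u v|Y q p].
- by rewrite pmapPv rtl1_linr.
- by rewrite rtl1_linr pmapPv.
- rewrite pmap_rgen !rtl1_gen pmap_rgen; congr rgen.
  by rewrite -[RHS]lc_nat.
Qed.

Lemma rtl1_str H Z X U (d : D Z U) (w : rt_car U X) :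
  rtl1 (tstr D H d) (tstr rt_car H w) = tstr rt_car H (rtl1 d w).
Proof.
move: w; apply: rt_ext => [a u v|a u v|Y q p].
- by rewrite tstrP rtl1_linr.
- by rewrite rtl1_linr tstrP.
- by rewrite tstr_rgen !rtl1_gen tstr_rgen lc_str.
Qed.

Definition rt_lact : tmor (comp_tamb D rt_car) rt_car :=
  tlift rtl1_bal2 rtl1_nat rtl1_str.

Lemma rt_lact_gen Z X U Y (d : D Z U) (q : Q U Y) (p : P Y X) :
  rt_lact Z X (cgen d (rgen q p)) = rgen (lc d q) p.
Proof. by rewrite [LHS]tlift_gen rtl1_gen. Qed.

Definition rtr1 Z X U (w : rt_car Z U) (a : A U X) : rt_car Z X :=
  rlift (fun Y (q : Q Z Y) (p : P Y U) => rgen q (rc p a)) w.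

Lemma rtr1_bal Z X U (a : A U X) :
  rbal (fun Y (q : Q Z Y) (p : P Y U) => rgen q (rc p a)).
Proof.
split; first split=> [Y p c u v|Y q c u v|Y Y' h q p].
- by rewrite rgenPl.
- by rewrite rcPl rgenPr.
- rewrite rgen_bal; congr rgen.
  by rewrite -rc_nat pmap1.
- by move=> Y Y' q b p; rewrite lrc rgen_act.
Qed.

Lemma rtr1_gen Z X U Y (q : Q Z Y) (p : P Y U) (a : A U X) :
  rtr1 (rgen q p) a = rgen q (rc p a).
Proof. exact: (rlift_gen (rtr1_bal Z a)). Qed.

Lemma rtr1_linl Z X U a : linear (fun w => @rtr1 Z X U w a).
Proof. exact: (rlift_lin (rtr1_bal Z a)). Qed.

Lemma rtr1Pl Z X U (a : A U X) c (u v : rt_car Z U) :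
  rtr1 (c *: u + v) a = c *: rtr1 u a + rtr1 v a.
Proof. exact: rtr1_linl. Qed.

Lemma rtr1_linr Z X U w : linear (@rtr1 Z X U w).
Proof.
apply: (rt_ext_param (g := fun a w => @rtr1 Z X U w a)) => [a|Y q p c u v].
  exact: rtr1_linl.
by rewrite !rtr1_gen rcPr rgenPr.
Qed.

Lemma rtr1_bal2 Z X : cbal (fun U (w : rt_car Z U) (a : A U X) => rtr1 w a).
Proof.
split=> [U a|U w|U U' h w a]; [exact: rtr1_linl|exact: rtr1_linr|].
move: w; apply: rt_ext => [c u v|c u v|Y q p].
- by rewrite pmapPv rtr1Pl.
- by rewrite rtr1Pl.
- by rewrite pmap_rgen !rtr1_gen pmap1 rc_bal.
Qed.

Lemma rtr1_nat Z Z' X X' (f : hom Z' Z) (h : hom X X') U (w : rt_car Z U) (a : A U X) :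
  rtr1 (pmap f (idm U) w) (pmap (idm U) h a) = pmap f h (rtr1 w a).
Proof.
move: w; apply: rt_ext => [c u v|c u v|Y q p].
- by rewrite pmapPv rtr1Pl.
- by rewrite rtr1Pl pmapPv.
- rewrite pmap_rgen !rtr1_gen pmap_rgen; congr rgen.
  by rewrite -[RHS]rc_nat.
Qed.

Lemma rtr1_str H Z X U (w : rt_car Z U) (a : A U X) :
  rtr1 (tstr rt_car H w) (tstr A H a) = tstr rt_car H (rtr1 w a).
Proof.
move: w; apply: rt_ext => [c u v|c u v|Y q p].
- by rewrite tstrP rtr1Pl.
- by rewrite rtr1Pl tstrP.
- by rewrite tstr_rgen !rtr1_gen tstr_rgen rc_str.
Qed.

Definition rt_ract : tmor (comp_tamb rt_car A) rt_car :=
  tlift rtr1_bal2 rtr1_nat rtr1_str.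

Lemma rt_ract_gen Z X U Y (q : Q Z Y) (p : P Y U) (a : A U X) :
  rt_ract Z X (cgen (rgen q p) a) = rgen q (rc p a).
Proof. by rewrite [LHS]tlift_gen rtr1_gen. Qed.

Lemma rt_lact_mul : tcomp rt_lact (thcomp (mon_mul D) (tid rt_car))
  = tcomp rt_lact (tcomp (thcomp (tid D) rt_lact) (tass D D rt_car)).
Proof.
apply: tmor_comp_eql => Z X U Y d d' w; move: w.
apply: rt_ext => [a u v|a u v|W q p].
- by rewrite cgenPr tfunP.
- by rewrite cgenPr tfunP.
by rewrite !tcompE tass_gen !thcomp_gen !rt_lact_gen -lc_mul.
Qed.

Lemma rt_lact_one : tcomp rt_lact (thcomp (mon_one D) (tid rt_car)) = tlun rt_car.
Proof.
apply: tmor_comp_eq => Z X Y f w; move: w.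
apply: rt_ext => [a u v|a u v|W q p].
- by rewrite cgenPr tfunP.
- by rewrite cgenPr tfunP.
rewrite !tcompE !thcomp_gen !rt_lact_gen tlun_gen pmap_rgen pmap1; congr rgen.
have := tmor_eqP (lact_one Q) (cgen f q).
by rewrite tcompE thcomp_gen tlun_gen.
Qed.

Lemma rt_ract_mul : tcomp rt_ract (thcomp rt_ract (tid A))
  = tcomp rt_ract (tcomp (thcomp (tid rt_car) (mon_mul A)) (tass rt_car A A)).
Proof.
apply: tmor_comp_eql => Z X U Y w a a'; move: w.
apply: rt_ext => [c u v|c u v|W q p].
- by rewrite !cgenPl tfunP.
- by rewrite !cgenPl tfunP.
by rewrite !tcompE tass_gen !thcomp_gen !rt_ract_gen rc_mul.
Qed.

Lemma rt_ract_one : tcomp rt_ract (thcomp (tid rt_car) (mon_one A)) = trun rt_car.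
Proof.
apply: tmor_comp_eq => Z X Y w f; move: w.
apply: rt_ext => [a u v|a u v|W q p].
- by rewrite cgenPl tfunP.
- by rewrite cgenPl tfunP.
rewrite !tcompE !thcomp_gen !rt_ract_gen trun_gen pmap_rgen pmap1; congr rgen.
have := tmor_eqP (ract_one P) (cgen p f).
by rewrite tcompE thcomp_gen trun_gen.
Qed.

Lemma rt_lract : tcomp rt_ract (thcomp rt_lact (tid A))
  = tcomp rt_lact (tcomp (thcomp (tid D) rt_ract) (tass D rt_car A)).
Proof.
apply: tmor_comp_eql => Z X U Y d w a; move: w.
apply: rt_ext => [c u v|c u v|W q p].
- by rewrite cgenPr cgenPl tfunP.
- by rewrite cgenPr cgenPl tfunP.
by rewrite !tcompE tass_gen !thcomp_gen !rt_lact_gen !rt_ract_gen rt_lact_gen.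
Qed.

Definition rt : bimod A D :=
  BiMod rt_lact_mul rt_lact_one rt_ract_mul rt_ract_one rt_lract.

Lemma lc_rgen Z X U Y (d : D Z U) (q : Q U Y) (p : P Y X) :
  lc (P := rt) d (rgen q p) = rgen (lc d q) p.
Proof. exact: rt_lact_gen. Qed.

Lemma rc_rgen Z X U Y (q : Q Z Y) (p : P Y U) (a : A U X) :
  rc (P := rt) (rgen q p) a = rgen q (rc p a).
Proof. exact: rt_ract_gen. Qed.

(* Bimodule morphisms out of a relative tensor product. *)
Section BLift.
Context (R : bimod A D) (g : forall Z X Y, Q Z Y -> P Y X -> R Z X).
Hypothesis gbal : forall Z X, rbal (fun Y (q : Q Z Y) (p : P Y X) => g q p).
Hypothesis gnat : forall Z Z' X X' (f : hom Z' Z) (h : hom X X') Y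
  (q : Q Z Y) (p : P Y X), g (pmap f (idm Y) q) (pmap (idm Y) h p) = pmap f h (g q p).
Hypothesis gstr : forall H Z X Y (q : Q Z Y) (p : P Y X),
  g (tstr Q H q) (tstr P H p) = tstr R H (g q p).
Hypothesis gl : forall Z X U Y (d : D Z U) (q : Q U Y) (p : P Y X),
  g (lc d q) p = lc d (g q p).
Hypothesis gr : forall Z X U Y (q : Q Z Y) (p : P Y U) (a : A U X),
  g q (rc p a) = rc (g q p) a.

Lemma blift_lc F H G (b : D F H) (p : rt H G) :
  rtlift gbal gnat gstr F G (lc (P := rt) b p) = lc b (rtlift gbal gnat gstr H G p).
Proof.
move: p; apply: rt_ext => [a u v|a u v|Y q p].
- by rewrite (lcPr (P := rt)) tfunP.
- by rewrite tfunP lcPr.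
- by rewrite lc_rgen !rtlift_gen gl.
Qed.

Lemma blift_rc F H G (p : rt F H) (a : A H G) :
  rtlift gbal gnat gstr F G (rc (P := rt) p a) = rc (rtlift gbal gnat gstr F H p) a.
Proof.
move: p; apply: rt_ext => [c u v|c u v|Y q p].
- by rewrite (rcPl (P := rt)) tfunP.
- by rewrite tfunP rcPl.
- by rewrite rc_rgen !rtlift_gen gr.
Qed.

Definition blift : bimor rt R := mk_bimor (P := rt) blift_lc blift_rc.

Lemma blift_gen Z X Y (q : Q Z Y) (p : P Y X) : blift Z X (rgen q p) = g q p.
Proof. exact: rtlift_gen. Qed.

End BLift.

Lemma brt_eq (R : bimod A D) (s t : bimor rt R) :
  (forall Z X Y (q : Q Z Y) (p : P Y X), s Z X (rgen q p) = t Z X (rgen q p)) -> s = t.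
Proof.
move=> st; apply: bimor_eq => Z X; apply: rt_ext => [a u v|a u v|Y q p].
- by rewrite tfunP.
- by rewrite tfunP.
- exact: st.
Qed.

End RelativeTensor.

End Bimodules.

Section BimodBicategory.
Context (k : fieldType) (C : moncat k) (M : modcat C).
Implicit Types A B D E : tmonoid M.

Section BHComp.
Context (A B D : tmonoid M) (Q Q' : bimod B D) (P P' : bimod A B).
Context (t : bimor Q Q') (s : bimor P P').

Lemma bh_bal Z X : rbal (fun Y (q : Q Z Y) (p : P Y X) => rgen (t _ _ q) (s _ _ p)).
Proof.
split; first split=> [Y p a u v|Y q a u v|Y Y' h q p].
- by rewrite tfunP rgenPl.
- by rewrite tfunP rgenPr.
- by rewrite !tfun_nat rgen_bal.
- by move=> Y Y' q b p; rewrite bimor_rc bimor_lc rgen_act.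
Qed.

Lemma bh_nat Z Z' X X' (f : hom Z' Z) (h : hom X X') Y (q : Q Z Y) (p : P Y X) :
  rgen (t _ _ (pmap f (idm Y) q)) (s _ _ (pmap (idm Y) h p))
  = pmap f h (rgen (t _ _ q) (s _ _ p)).
Proof. by rewrite pmap_rgen !tfun_nat. Qed.

Lemma bh_str H Z X Y (q : Q Z Y) (p : P Y X) :
  rgen (t _ _ (tstr Q H q)) (s _ _ (tstr P H p))
  = tstr (rt_car Q' P') H (rgen (t _ _ q) (s _ _ p)).
Proof. by rewrite tstr_rgen !tfun_str. Qed.

Lemma bh_l Z X U Y (d : D Z U) (q : Q U Y) (p : P Y X) :
  rgen (t _ _ (lc d q)) (s _ _ p) = lc (P := rt Q' P') d (rgen (t _ _ q) (s _ _ p)).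
Proof. by rewrite lc_rgen bimor_lc. Qed.

Lemma bh_r Z X U Y (q : Q Z Y) (p : P Y U) (a : A U X) :
  rgen (t _ _ q) (s _ _ (rc p a)) = rc (P := rt Q' P') (rgen (t _ _ q) (s _ _ p)) a.
Proof. by rewrite rc_rgen bimor_rc. Qed.

Definition bhcomp : bimor (rt Q P) (rt Q' P') :=
  blift (R := rt Q' P') bh_bal bh_nat bh_str bh_l bh_r.

Lemma bhcomp_gen Z X Y (q : Q Z Y) (p : P Y X) :
  bhcomp Z X (rgen q p) = rgen (t _ _ q) (s _ _ p).
Proof. exact: blift_gen. Qed.

End BHComp.

Section BAssociator.
Context (A B D E : tmonoid M) (R : bimod D E) (Q : bimod B D) (P : bimod A B).

Definition ba1 Z X Y (w : rt R Q Z Y) (p : P Y X) : rt R (rt Q P) Z X :=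
  rlift (Q := R) (P := Q) (fun U (x : R Z U) (q : Q U Y) => rgen (P := rt Q P) x (rgen q p)) w.

Lemma ba1_bal Z X Y (p : P Y X) : rbal (Q := R) (P := Q)
  (fun U (x : R Z U) (q : Q U Y) => rgen (P := rt Q P) x (rgen q p)).
Proof.
split; first split=> [U q a u v|U x a u v|U U' h x q].
- by rewrite rgenPl.
- by rewrite rgenPl rgenPr.
- by rewrite rgen_bal pmap_rgen pmap1.
- by move=> U U' x d q; rewrite rgen_act lc_rgen.
Qed.

Lemma ba1_gen Z X Y U (x : R Z U) (q : Q U Y) (p : P Y X) :
  ba1 (rgen x q) p = rgen (P := rt Q P) x (rgen q p).
Proof. exact: (rlift_gen (ba1_bal Z p)). Qed.

Lemma ba1Pl Z X Y (p : P Y X) a u v :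
  @ba1 Z X Y (a *: u + v) p = a *: ba1 u p + ba1 v p.
Proof. exact: (rlift_lin (ba1_bal Z p)). Qed.

Lemma ba1_linr Z X Y w : linear (@ba1 Z X Y w).
Proof.
apply: (rt_ext_param (g := fun p w => @ba1 Z X Y w p)) => [p a u v|U x q a u v].
  exact: ba1Pl.
by rewrite !ba1_gen !rgenPr.
Qed.

Lemma ba1_bal2 Z X : rbal (Q := rt R Q) (P := P)
  (fun Y (w : rt R Q Z Y) (p : P Y X) => ba1 w p).
Proof.
split; first split=> [Y p a u v|Y w|Y Y' h w p]; first exact: ba1Pl.
- exact: ba1_linr.
- move: w; apply: rt_ext => [a u v|a u v|U x q].
  + by rewrite pmapPv ba1Pl.
  + by rewrite ba1Pl.
  + by rewrite pmap_rgen !ba1_gen pmap1 rgen_bal.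
- move=> Y Y' w b p; move: w; apply: rt_ext => [a u v|a u v|U x q].
  + by rewrite (rcPl (P := rt R Q)) ba1Pl.
  + by rewrite ba1Pl.
  + by rewrite rc_rgen !ba1_gen rgen_act.
Qed.

Lemma ba1_nat Z Z' X X' (f : hom Z' Z) (h : hom X X') Y (w : rt R Q Z Y) (p : P Y X) :
  ba1 (pmap f (idm Y) w) (pmap (idm Y) h p) = pmap f h (ba1 w p).
Proof.
move: w; apply: rt_ext => [a u v|a u v|U x q].
- by rewrite pmapPv ba1Pl.
- by rewrite ba1Pl pmapPv.
- by rewrite pmap_rgen !ba1_gen !pmap_rgen !pmap1.
Qed.

Lemma ba1_str H Z X Y (w : rt R Q Z Y) (p : P Y X) :
  ba1 (tstr (rt R Q) H w) (tstr P H p) = tstr (rt R (rt Q P)) H (ba1 w p).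
Proof.
move: w; apply: rt_ext => [a u v|a u v|U x q].
- by rewrite tstrP ba1Pl.
- by rewrite ba1Pl tstrP.
- by rewrite tstr_rgen !ba1_gen !tstr_rgen.
Qed.

Lemma ba1_l Z X U Y (d : E Z U) (w : rt R Q U Y) (p : P Y X) :
  ba1 (lc d w) p = lc d (ba1 w p).
Proof.
move: w; apply: rt_ext => [a u v|a u v|V x q].
- by rewrite (lcPr (P := rt R Q)) ba1Pl.
- by rewrite ba1Pl lcPr.
- by rewrite lc_rgen !ba1_gen lc_rgen.
Qed.

Lemma ba1_r Z X U Y (w : rt R Q Z Y) (p : P Y U) (a : A U X) :
  ba1 w (rc p a) = rc (ba1 w p) a.
Proof.
move: w; apply: rt_ext => [c u v|c u v|V x q].
- by rewrite ba1Pl.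
- by rewrite ba1Pl rcPl.
- by rewrite !ba1_gen !rc_rgen.
Qed.

Definition bass : bimor (rt (rt R Q) P) (rt R (rt Q P)) :=
  blift (Q := rt R Q) (R := rt R (rt Q P)) ba1_bal2 ba1_nat ba1_str ba1_l ba1_r.

Lemma bass_gen Z X Y U (x : R Z U) (q : Q U Y) (p : P Y X) :
  bass Z X (rgen (Q := rt R Q) (rgen x q) p) = rgen (P := rt Q P) x (rgen q p).
Proof. by rewrite [LHS]blift_gen ba1_gen. Qed.

Definition bv1 Z X U (x : R Z U) (w : rt Q P U X) : rt (rt R Q) P Z X :=
  rlift (Q := Q) (P := P) (fun Y (q : Q U Y) (p : P Y X) => rgen (Q := rt R Q) (rgen x q) p) w.

Lemma bv1_bal Z X U (x : R Z U) : rbal (Q := Q) (P := P)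
  (fun Y (q : Q U Y) (p : P Y X) => rgen (Q := rt R Q) (rgen x q) p).
Proof.
split; first split=> [Y p a u v|Y q a u v|Y Y' h q p].
- by rewrite rgenPr rgenPl.
- by rewrite rgenPr.
- by rewrite -rgen_bal pmap_rgen pmap1.
- by move=> Y Y' q b p; rewrite -rgen_act rc_rgen.
Qed.

Lemma bv1_gen Z X Y U (x : R Z U) (q : Q U Y) (p : P Y X) :
  bv1 x (rgen q p) = rgen (Q := rt R Q) (rgen x q) p.
Proof. exact: (rlift_gen (bv1_bal X x)). Qed.

Lemma bv1Pr Z X U (x : R Z U) a u v :
  @bv1 Z X U x (a *: u + v) = a *: bv1 x u + bv1 x v.
Proof. exact: (rlift_lin (bv1_bal X x)). Qed.

Lemma bv1_linl Z X U w : linear (fun x => @bv1 Z X U x w).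
Proof.
apply: (rt_ext_param (g := fun x w => @bv1 Z X U x w)) => [x a u v|Y q p a u v].
  exact: bv1Pr.
by rewrite !bv1_gen !rgenPl.
Qed.

Lemma bv1_bal2 Z X : rbal (Q := R) (P := rt Q P)
  (fun U (x : R Z U) (w : rt Q P U X) => bv1 x w).
Proof.
split; first split=> [U w|U x a u v|U U' h x w]; first exact: bv1_linl.
- exact: bv1Pr.
- move: w; apply: rt_ext => [a u v|a u v|Y q p].
  + by rewrite bv1Pr.
  + by rewrite pmapPv bv1Pr.
  + by rewrite pmap_rgen !bv1_gen pmap1 rgen_bal.
- move=> U U' x b w; move: w; apply: rt_ext => [a u v|a u v|Y q p].
  + by rewrite bv1Pr.
  + by rewrite (lcPr (P := rt Q P)) bv1Pr.
  + by rewrite lc_rgen !bv1_gen rgen_act.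
Qed.

Lemma bv1_nat Z Z' X X' (f : hom Z' Z) (h : hom X X') U (x : R Z U) (w : rt Q P U X) :
  bv1 (pmap f (idm U) x) (pmap (idm U) h w) = pmap f h (bv1 x w).
Proof.
move: w; apply: rt_ext => [a u v|a u v|Y q p].
- by rewrite pmapPv bv1Pr.
- by rewrite bv1Pr pmapPv.
- by rewrite pmap_rgen !bv1_gen !pmap_rgen !pmap1.
Qed.

Lemma bv1_str H Z X U (x : R Z U) (w : rt Q P U X) :
  bv1 (tstr R H x) (tstr (rt Q P) H w) = tstr (rt (rt R Q) P) H (bv1 x w).
Proof.
move: w; apply: rt_ext => [a u v|a u v|Y q p].
- by rewrite tstrP bv1Pr.
- by rewrite bv1Pr tstrP.
- by rewrite tstr_rgen !bv1_gen !tstr_rgen.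
Qed.

Lemma bv1_l Z X U Y (d : E Z U) (x : R U Y) (w : rt Q P Y X) :
  bv1 (lc d x) w = lc d (bv1 x w).
Proof.
move: w; apply: rt_ext => [a u v|a u v|V q p].
- by rewrite bv1Pr.
- by rewrite bv1Pr lcPr.
- by rewrite !bv1_gen !lc_rgen.
Qed.

Lemma bv1_r Z X U Y (x : R Z Y) (w : rt Q P Y U) (a : A U X) :
  bv1 x (rc w a) = rc (bv1 x w) a.
Proof.
move: w; apply: rt_ext => [c u v|c u v|V q p].
- by rewrite (rcPl (P := rt Q P)) bv1Pr.
- by rewrite bv1Pr rcPl.
- by rewrite rc_rgen !bv1_gen rc_rgen.
Qed.

Definition bassv : bimor (rt R (rt Q P)) (rt (rt R Q) P) :=
  blift (P := rt Q P) (R := rt (rt R Q) P) bv1_bal2 bv1_nat bv1_str bv1_l bv1_r.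

Lemma bassv_gen Z X Y U (x : R Z U) (q : Q U Y) (p : P Y X) :
  bassv Z X (rgen (P := rt Q P) x (rgen q p)) = rgen (Q := rt R Q) (rgen x q) p.
Proof. by rewrite [LHS]blift_gen bv1_gen. Qed.

Lemma brt_eql (S : bimod A E) (s t : bimor (rt (rt R Q) P) S) :
  (forall Z X U Y (x : R Z U) (q : Q U Y) (p : P Y X),
     s Z X (rgen (Q := rt R Q) (rgen x q) p) = t Z X (rgen (Q := rt R Q) (rgen x q) p)) ->
  s = t.
Proof.
move=> st; apply: brt_eq => Z X Y w p; move: w.
apply: rt_ext => [a u v|a u v|U x q]; last exact: st.
- by rewrite rgenPl tfunP.
- by rewrite rgenPl tfunP.
Qed.

Lemma brt_eqr (S : bimod A E) (s t : bimor (rt R (rt Q P)) S) :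
  (forall Z X U Y (x : R Z U) (q : Q U Y) (p : P Y X),
     s Z X (rgen (P := rt Q P) x (rgen q p)) = t Z X (rgen (P := rt Q P) x (rgen q p))) ->
  s = t.
Proof.
move=> st; apply: brt_eq => Z X U x w; move: w.
apply: rt_ext => [a u v|a u v|Y q p]; last exact: st.
- by rewrite rgenPr tfunP.
- by rewrite rgenPr tfunP.
Qed.

End BAssociator.

Section BUnitors.
Context (A B : tmonoid M) (P : bimod A B).
Local Notation IA := (reg_bimod A).
Local Notation IB := (reg_bimod B).

Lemma bl_bal Z X : rbal (Q := IB) (P := P) (fun Y (b : B Z Y) (p : P Y X) => lc b p).
Proof.
split; first split=> [Y p a u v|Y b a u v|Y Y' h b p].
- by rewrite lcPl.
- by rewrite lcPr.
- by rewrite lc_bal.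
- by move=> Y Y' b b' p; rewrite -lc_mul.
Qed.

Definition blun : bimor (rt IB P) P :=
  blift (Q := IB) bl_bal (fun Z Z' X X' f h Y b p => lc_nat f h b p)
    (fun H Z X Y b p => lc_str H b p) (fun Z X U Y d b p => lc_mul d b p)
    (fun Z X U Y b p a => esym (lrc b p a)).

Lemma blun_gen Z X Y (b : IB Z Y) (p : P Y X) : blun Z X (rgen b p) = lc (b : B Z Y) p.
Proof. exact: blift_gen. Qed.

Lemma br_bal Z X : rbal (Q := P) (P := IA) (fun Y (p : P Z Y) (a : A Y X) => rc p a).
Proof.
split; first split=> [Y p a u v|Y b a u v|Y Y' h b p].
- by rewrite rcPl.
- by rewrite rcPr.
- by rewrite rc_bal.
- by move=> Y Y' p a a'; rewrite rc_mul.
Qed.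

Definition brun : bimor (rt P IA) P :=
  blift (P := IA) br_bal (fun Z Z' X X' f h Y b p => rc_nat f h b p)
    (fun H Z X Y b p => rc_str H b p) (fun Z X U Y d b p => lrc d b p)
    (fun Z X U Y p a a' => esym (rc_mul p a a')).

Lemma brun_gen Z X Y (p : P Z Y) (a : IA Y X) : brun Z X (rgen p a) = rc p (a : A Y X).
Proof. exact: blift_gen. Qed.

Definition blunv_fun Z X (p : P Z X) : rt IB P Z X := rgen (Q := IB) (one B Z) p.

Lemma blunv_lin Z X : linear (@blunv_fun Z X).
Proof. by move=> a u v; rewrite /blunv_fun rgenPr. Qed.

Lemma blunv_nat Y Y' X X' (f : hom Y' Y) (g : hom X X') (v : P Y X) :
  blunv_fun (pmap f g v) = pmap f g (blunv_fun v).
Proof.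
rewrite /blunv_fun pmap_rgen pmap_lr -rgen_bal; congr rgen.
exact: one_nat.
Qed.

Lemma blunv_str H Y X (v : P Y X) :
  blunv_fun (tstr P H v) = tstr (rt IB P) H (blunv_fun v).
Proof. by rewrite /blunv_fun tstr_rgen one_str. Qed.

Definition blunv_mor : tmor P (rt IB P) := TMor blunv_lin blunv_nat blunv_str.

Lemma blunv_l Z U X (b : B Z U) (p : P U X) :
  blunv_mor _ _ (lc b p) = lc b (blunv_mor _ _ p).
Proof.
by rewrite [RHS]lc_rgen [X in rgen X _]mul_one -[b in RHS]one_mul [RHS]rgen_act.
Qed.

Lemma blunv_r Z U X (p : P Z U) (a : A U X) :
  blunv_mor _ _ (rc p a) = rc (blunv_mor _ _ p) a.
Proof. by rewrite [RHS]rc_rgen. Qed.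

Definition blunv : bimor P (rt IB P) := mk_bimor (Q := rt IB P) (s := blunv_mor) blunv_l blunv_r.

Definition brunv_fun Z X (p : P Z X) : rt P IA Z X := rgen (P := IA) p (one A X).

Lemma brunv_lin Z X : linear (@brunv_fun Z X).
Proof. by move=> a u v; rewrite /brunv_fun rgenPl. Qed.

Lemma brunv_nat Y Y' X X' (f : hom Y' Y) (g : hom X X') (v : P Y X) :
  brunv_fun (pmap f g v) = pmap f g (brunv_fun v).
Proof.
rewrite /brunv_fun pmap_rgen pmap_rl rgen_bal; congr rgen.
exact: esym (one_nat _ _).
Qed.

Lemma brunv_str H Y X (v : P Y X) :
  brunv_fun (tstr P H v) = tstr (rt P IA) H (brunv_fun v).
Proof. by rewrite /brunv_fun tstr_rgen one_str. Qed.

Definition brunv_mor : tmor P (rt P IA) := TMor brunv_lin brunv_nat brunv_str.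

Lemma brunv_l Z U X (b : B Z U) (p : P U X) :
  brunv_mor _ _ (lc b p) = lc b (brunv_mor _ _ p).
Proof. by rewrite [RHS]lc_rgen. Qed.

Lemma brunv_r Z U X (p : P Z U) (a : A U X) :
  brunv_mor _ _ (rc p a) = rc (brunv_mor _ _ p) a.
Proof.
rewrite [RHS]rc_rgen [X in rgen _ X]one_mul.
rewrite -[X in rgen _ X](mul_one a) -[RHS](rgen_act (P := IA)).
by [].
Qed.

Definition brunv : bimor P (rt P IA) := mk_bimor (Q := rt P IA) (s := brunv_mor) brunv_l brunv_r.

Lemma blunK : bcomp blunv blun = bid _.
Proof.
apply: brt_eq => Z X Y b p; rewrite [LHS](_ : _ = blunv_mor _ _ (blun _ _ (rgen b p))) //.
by rewrite blun_gen blunv_l [LHS]lc_rgen [X in rgen X _]mul_one.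
Qed.

Lemma blunVK : bcomp blun blunv = bid _.
Proof. by apply: bimor_eq => Z X v; rewrite [LHS]blun_gen lc_one. Qed.

Lemma brunK : bcomp brunv brun = bid _.
Proof.
apply: brt_eq => Z X Y p a; rewrite [LHS](_ : _ = brunv_mor _ _ (brun _ _ (rgen p a))) //.
by rewrite brun_gen brunv_r [LHS]rc_rgen [X in rgen _ X]one_mul.
Qed.

Lemma brunVK : bcomp brun brunv = bid _.
Proof. by apply: bimor_eq => Z X v; rewrite [LHS]brun_gen rc_one. Qed.

End BUnitors.

Lemma bcompE A B (P Q R : bimod A B) (t : bimor Q R) (s : bimor P Q) (Y X : M)
    (v : P Y X) : bcomp t s Y X v = t Y X (s Y X v).
Proof. by []. Qed.

Lemma bcomp1l A B (P Q : bimod A B) (s : bimor P Q) : bcomp (bid Q) s = s.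
Proof. exact: bimor_eq. Qed.

Lemma bcomp1r A B (P Q : bimod A B) (s : bimor P Q) : bcomp s (bid P) = s.
Proof. exact: bimor_eq. Qed.

Lemma bcompA A B (P Q R S : bimod A B) (u : bimor R S) (t : bimor Q R) (s : bimor P Q) :
  bcomp u (bcomp t s) = bcomp (bcomp u t) s.
Proof. exact: bimor_eq. Qed.

Lemma bcomp_linl A B (P Q R : bimod A B) (s : bimor P Q) :
  linear (fun t : bimor Q R => bcomp t s).
Proof. by move=> a t t'; apply: bimor_eq => Y X v; rewrite bimor_linE bcompE bimor_linE. Qed.

Lemma bcomp_linr A B (P Q R : bimod A B) (t : bimor Q R) :
  linear (fun s : bimor P Q => bcomp t s).
Proof.
by move=> a s s'; apply: bimor_eq => Y X v; rewrite bimor_linE !bcompE bimor_linE tfunP.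
Qed.

Lemma bhcomp_linl A B D (Q Q' : bimod B D) (P P' : bimod A B) (s : bimor P P') :
  linear (fun t : bimor Q Q' => bhcomp t s).
Proof.
move=> a t t'; apply: brt_eq => Z X Y q p.
by rewrite bimor_linE !bhcomp_gen bimor_linE rgenPl.
Qed.

Lemma bhcomp_linr A B D (Q Q' : bimod B D) (P P' : bimod A B) (t : bimor Q Q') :
  linear (fun s : bimor P P' => bhcomp t s).
Proof.
move=> a s s'; apply: brt_eq => Z X Y q p.
by rewrite bimor_linE !bhcomp_gen bimor_linE rgenPr.
Qed.

Lemma bhcomp1 A B D (Q : bimod B D) (P : bimod A B) :
  bhcomp (bid Q) (bid P) = bid (rt Q P).
Proof. by apply: brt_eq => Z X Y p q; rewrite bhcomp_gen. Qed.

Lemma bhcompM A B D (Q Q' Q'' : bimod B D) (P P' P'' : bimod A B)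
    (t' : bimor Q' Q'') (t : bimor Q Q') (s' : bimor P' P'') (s : bimor P P') :
  bhcomp (bcomp t' t) (bcomp s' s) = bcomp (bhcomp t' s') (bhcomp t s).
Proof. by apply: brt_eq => Z X Y p q; rewrite bcompE !bhcomp_gen !bcompE. Qed.

Lemma bassK A B D E (R : bimod D E) (Q : bimod B D) (P : bimod A B) :
  bcomp (bassv R Q P) (bass R Q P) = bid _.
Proof. by apply: brt_eql => Z X U Y x q p; rewrite bcompE bass_gen bassv_gen. Qed.

Lemma bassVK A B D E (R : bimod D E) (Q : bimod B D) (P : bimod A B) :
  bcomp (bass R Q P) (bassv R Q P) = bid _.
Proof. by apply: brt_eqr => Z X U Y x q p; rewrite bcompE bassv_gen bass_gen. Qed.

Lemma bass_natural A B D E (R R' : bimod D E) (Q Q' : bimod B D) (P P' : bimod A B)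
    (u : bimor R R') (t : bimor Q Q') (s : bimor P P') :
  bcomp (bass R' Q' P') (bhcomp (bhcomp u t) s)
  = bcomp (bhcomp u (bhcomp t s)) (bass R Q P).
Proof.
apply: brt_eql => Z X U Y x q p.
by rewrite !bcompE bhcomp_gen (bhcomp_gen u t) !bass_gen bhcomp_gen (bhcomp_gen t s).
Qed.

Lemma blun_natural A B (P P' : bimod A B) (s : bimor P P') :
  bcomp (blun P') (bhcomp (bid _) s) = bcomp s (blun P).
Proof.
by apply: brt_eq => Z X Y b p; rewrite !bcompE bhcomp_gen !blun_gen bimor_lc.
Qed.

Lemma brun_natural A B (P P' : bimod A B) (s : bimor P P') :
  bcomp (brun P') (bhcomp s (bid _)) = bcomp s (brun P).
Proof.
by apply: brt_eq => Z X Y b p; rewrite !bcompE bhcomp_gen !brun_gen bimor_rc.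
Qed.

Lemma bpentagon A B D E F (i : bimod E F) (h : bimod D E) (g : bimod B D) (f : bimod A B) :
  bcomp (bhcomp (bid i) (bass h g f))
    (bcomp (bass i (rt h g) f) (bhcomp (bass i h g) (bid f)))
  = bcomp (bass i h (rt g f)) (bass (rt i h) g f).
Proof.
apply: brt_eql => Z X U Y w p q; move: w.
apply: rt_ext => [a u v|a u v|V x y].
- by rewrite (rgenPl (Q := rt i h)) (rgenPl (Q := rt (rt i h) g)) tfunP.
- by rewrite (rgenPl (Q := rt i h)) (rgenPl (Q := rt (rt i h) g)) tfunP.
rewrite !bcompE bhcomp_gen (bass_gen (R := i) (Q := h) (P := g)).
rewrite (bass_gen (R := i) (Q := rt h g) (P := f)).
rewrite (bhcomp_gen (bid i) (bass h g f)) (bass_gen (R := h) (Q := g) (P := f)).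
rewrite (bass_gen (R := rt i h) (Q := g) (P := f)).
by rewrite (bass_gen (R := i) (Q := h) (P := rt g f)).
Qed.

Lemma btriangle A B D (g : bimod B D) (f : bimod A B) :
  bcomp (bhcomp (bid g) (blun f)) (bass g (reg_bimod B) f) = bhcomp (brun g) (bid f).
Proof.
apply: brt_eql => Z X U Y x b p.
rewrite !bcompE bass_gen bhcomp_gen blun_gen bhcomp_gen brun_gen.
exact: esym (rgen_act _ _ _).
Qed.

Definition Bimod : bicat k :=
  @Bicat k (tmonoid M) (fun A B => bimod A B) (fun A B P Q => bimor P Q)
    (fun A => reg_bimod A) (fun A B D Q P => rt Q P)
    (fun A B P => bid P) (fun A B P Q R t s => bcomp t s)
    (fun A B D Q Q' P P' t s => bhcomp t s)
    (fun A B D E R Q P => bass R Q P) (fun A B D E R Q P => bassv R Q P)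
    (fun A B P => blun P) (fun A B P => blunv P)
    (fun A B P => brun P) (fun A B P => brunv P)
    bcomp_linl bcomp_linr bhcomp_linl bhcomp_linr
    bcomp1l bcomp1r bcompA bhcomp1 bhcompM bassK bassVK
    blunK blunVK brunK brunVK
    bass_natural blun_natural brun_natural bpentagon btriangle.

End BimodBicategory.

Section Biequivalences.
Context (k : fieldType).

Definition is_iso2 (B : bicat k) (a b : B) (f g : cell1 a b) (s : cell2 f g) : Prop :=
  exists t : cell2 g f, vcomp t s = id2 f /\ vcomp s t = id2 g.

Definition equivalent (B : bicat k) (a b : B) : Prop :=
  exists (f : cell1 a b) (g : cell1 b a)
    (s : cell2 (comp1 g f) (id1 a)) (t : cell2 (comp1 f g) (id1 b)),
    is_iso2 s /\ is_iso2 t.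

(* The data of a pseudofunctor; the axioms, including the invertibility of
   [ps_comp] and [ps_id], are in [is_psfun]. *)
Record psfun_data (B B' : bicat k) := PsFunData {
  ps0 :> B -> B';
  ps1 : forall a b, cell1 a b -> cell1 (ps0 a) (ps0 b);
  ps2 : forall a b (f g : cell1 a b), cell2 f g -> cell2 (ps1 f) (ps1 g);
  ps_comp : forall a b c (g : cell1 b c) (f : cell1 a b),
    cell2 (comp1 (ps1 g) (ps1 f)) (ps1 (comp1 g f));
  ps_id : forall a, cell2 (id1 (ps0 a)) (ps1 (id1 a)) }.

Record is_psfun (B B' : bicat k) (F : psfun_data B B') : Prop := IsPsFun {
  ps2_lin : forall a b (f g : cell1 a b),
    linear (fun s : cell2 f g => ps2 F s);
  ps2_id : forall a b (f : cell1 a b), ps2 F (id2 f) = id2 (ps1 F f);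
  ps2_vcomp : forall a b (f g h : cell1 a b) (t : cell2 g h) (s : cell2 f g),
    ps2 F (vcomp t s) = vcomp (ps2 F t) (ps2 F s);
  ps_comp_iso : forall a b c (g : cell1 b c) (f : cell1 a b),
    is_iso2 (ps_comp F g f);
  ps_id_iso : forall a, is_iso2 (ps_id F a);
  ps_comp_nat : forall a b c (g g' : cell1 b c) (f f' : cell1 a b)
      (t : cell2 g g') (s : cell2 f f'),
    vcomp (ps_comp F g' f') (hcomp (ps2 F t) (ps2 F s))
    = vcomp (ps2 F (hcomp t s)) (ps_comp F g f);
  ps_assoc : forall a b c d (h : cell1 c d) (g : cell1 b c) (f : cell1 a b),
    vcomp (ps2 F (assoc h g f))
      (vcomp (ps_comp F (comp1 h g) f) (hcomp (ps_comp F h g) (id2 (ps1 F f))))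
    = vcomp (ps_comp F h (comp1 g f))
        (vcomp (hcomp (id2 (ps1 F h)) (ps_comp F g f))
               (assoc (ps1 F h) (ps1 F g) (ps1 F f)));
  ps_lunit : forall a b (f : cell1 a b),
    vcomp (ps2 F (lunit f))
      (vcomp (ps_comp F (id1 b) f) (hcomp (ps_id F b) (id2 (ps1 F f))))
    = lunit (ps1 F f);
  ps_runit : forall a b (f : cell1 a b),
    vcomp (ps2 F (runit f))
      (vcomp (ps_comp F f (id1 a)) (hcomp (id2 (ps1 F f)) (ps_id F a)))
    = runit (ps1 F f) }.

(* The functor B(a, b) -> B'(F a, F b) is an equivalence of k-linear
   categories: it has a quasi-inverse (G1, G2), with unit u and counit e. *)
Definition local_equivalence (B B' : bicat k) (F : psfun_data B B') (a b : B) : Prop :=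
  exists (G1 : cell1 (F a) (F b) -> cell1 a b)
    (G2 : forall p q, cell2 p q -> cell2 (G1 p) (G1 q))
    (u : forall f : cell1 a b, cell2 f (G1 (ps1 F f)))
    (e : forall p : cell1 (F a) (F b), cell2 (ps1 F (G1 p)) p),
  [/\ [/\ forall p q, linear (G2 p q), forall p, G2 p p (id2 p) = id2 (G1 p)
        & forall p q r (t : cell2 q r) (s : cell2 p q),
            G2 p r (vcomp t s) = vcomp (G2 q r t) (G2 p q s)],
      forall f, is_iso2 (u f),
      forall p, is_iso2 (e p),
      forall f g (s : cell2 f g), vcomp (u g) s = vcomp (G2 _ _ (ps2 F s)) (u f)
    & forall p q (s : cell2 p q), vcomp (e q) (ps2 F (G2 _ _ s)) = vcomp s (e p)].

(* A pseudofunctor which is locally an equivalence and surjective on objects up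
   to internal equivalence. *)
Definition biequivalence (B B' : bicat k) (F : psfun_data B B') : Prop :=
  [/\ is_psfun F,
      forall a b : B, local_equivalence F a b
    & forall b' : B', exists a : B, equivalent (F a) b'].

End Biequivalences.

Section ModuleLemmas.
Context (k : fieldType) (C : moncat k) (M : modcat C).

Lemma mmul_natr (H F G : C) (f : hom F G) (X : M) :
  mactm M (tenm (idm H) f) X ∘ mmul M H F X
  = mmul M H G X ∘ fmap (mact M H) (mactm M f X).
Proof. by rewrite mmul_nat mactm1 cmp1m. Qed.

Lemma mmul_natl (H H' F : C) (h : hom H H') (X : M) :
  mactm M (tenm h (idm F)) X ∘ mmul M H F X
  = mmul M H' F X ∘ mactm M h (mact M F X).
Proof. by rewrite mmul_nat mactm1 fmap1 cmpm1. Qed.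

Lemma mmul_inv_natr (H F G : C) (f : hom F G) (X : M) :
  mmul_inv M H G X ∘ mactm M (tenm (idm H) f) X
  = fmap (mact M H) (mactm M f X) ∘ mmul_inv M H F X.
Proof.
apply: (cmp_mono (mmulK H G X)); apply: (cmp_epi (mmulVK H F X)).
by rewrite -!cmpA mmulK cmpm1 !cmpA mmulVK cmp1m mmul_natr.
Qed.

Lemma mmul_inv_natl (H H' F : C) (h : hom H H') (X : M) :
  mmul_inv M H' F X ∘ mactm M (tenm h (idm F)) X
  = mactm M h (mact M F X) ∘ mmul_inv M H F X.
Proof.
apply: (cmp_mono (mmulK H' F X)); apply: (cmp_epi (mmulVK H F X)).
by rewrite -!cmpA mmulK cmpm1 !cmpA mmulVK cmp1m mmul_natl.
Qed.

Lemma mactm_iso (F G : C) (f : hom F G) (g : hom G F) (X : M) :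
  f ∘ g = idm G -> mactm M f X ∘ mactm M g X = idm _.
Proof. by rewrite -mactmM => ->; rewrite mactm1. Qed.

Lemma mmulA_asso_inv (G F A : C) (X : M) :
  mactm M (asso_inv G F A) X ∘ (mmul M G (ten F A) X ∘ fmap (mact M G) (mmul M F A X))
  = mmul M (ten G F) A X ∘ mmul M G F (mact M A X).
Proof.
by rewrite -mmulA cmpA (mactm_iso X (assoK G F A)) cmp1m.
Qed.

Lemma mmul_invA (G F A : C) (X : M) :
  mmul M G F (mact M A X) ∘ (fmap (mact M G) (mmul_inv M F A X) ∘ mmul_inv M G (ten F A) X)
  = mmul_inv M (ten G F) A X ∘ mactm M (asso_inv G F A) X.
Proof.
apply: (cmp_mono (mmulK (ten G F) A X)).
rewrite [RHS]cmpA mmulVK cmp1m cmpA -mmulA_asso_inv -!cmpA.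
rewrite (cmpA (fmap _ _)) -fmapM mmulVK fmap1 cmp1m mmulVK.
by rewrite cmpm1.
Qed.

Lemma mmul_luni (G : C) (X : M) :
  mactm M (luni G) X ∘ mmul M (tunit C) G X = mone_inv M (mact M G X).
Proof.
apply: (cmp_epi (moneVK (mact M G X))).
by rewrite moneK -cmpA mmul1l.
Qed.

Lemma mmul_inv_luni (G : C) (X : M) :
  mmul_inv M (tunit C) G X ∘ mactm M (luni_inv G) X = mone M (mact M G X).
Proof.
apply: (cmp_mono (moneVK (mact M G X))).
rewrite moneK -mmul_luni -cmpA (cmpA (mmul _ _ _ _)) mmulVK cmp1m.
exact: mactm_iso (luniVK G).
Qed.

End ModuleLemmas.

Section Bracket.
Context (k : fieldType) (C : moncat k) (M N : modcat C).
Context (P : tamb M N) (Y : N) (X : M).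
Local Notation CC := (regular C).

Definition br_ob (F : CC) (G : CC) : lmodType k := P (mact N F Y) (mact M G X).

Definition br_map (F F' G G' : CC) (f : hom F' F) (g : hom G G') :
  br_ob F G -> br_ob F' G' := pmap (mactm N f Y) (mactm M g X).

Lemma br_lin (F F' G G' : CC) (f : hom F' F) (g : hom G G') : linear (br_map f g).
Proof. exact: pmap_lin. Qed.

Lemma br_linl (F F' G G' : CC) (g : hom G G') (v : br_ob F G) :
  linear (fun f : hom F' F => br_map f g v).
Proof. by move=> a f f'; rewrite /br_map mactmP pmapPl. Qed.

Lemma br_linr (F F' G G' : CC) (f : hom F' F) (v : br_ob F G) :
  linear (fun g : hom G G' => br_map f g v).
Proof. by move=> a g g'; rewrite /br_map mactmP pmapPr. Qed.

Lemma br_map1 (F G : CC) (v : br_ob F G) : br_map (idm F) (idm G) v = v.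
Proof. by rewrite /br_map !mactm1 pmap1. Qed.

Lemma br_mapM (F F' F'' G G' G'' : CC) (f : hom F' F) (f' : hom F'' F')
    (g : hom G G') (g' : hom G' G'') (v : br_ob F G) :
  br_map (f ∘ f') (g' ∘ g) v = br_map f' g' (br_map f g v).
Proof. by rewrite /br_map !mactmM pmapM. Qed.

Definition br_prof : prof CC CC := Prof br_lin br_linl br_linr br_map1 br_mapM.

Definition br_str (H : C) (F G : CC) (v : br_prof F G) :
    br_prof (mact CC H F) (mact CC H G) :=
  pmap (mmul_inv N H F Y) (mmul M H G X) (tstr P H v).

Lemma br_str_lin (H : C) (F G : CC) : linear (@br_str H F G).
Proof. by move=> a u v; rewrite /br_str tstrP pmapPv. Qed.

Lemma br_str_nat H (F F' G G' : CC) (f : hom F' F) (g : hom G G') (v : br_prof F G) :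
  br_str H (pmap f g v) = pmap (fmap (mact CC H) f) (fmap (mact CC H) g) (br_str H v).
Proof.
by rewrite /= /br_str /br_map tstr_nat -!pmapM mmul_natr mmul_inv_natr.
Qed.

Lemma br_str_ext H H' (h : hom H H') (F G : CC) (v : br_prof F G) :
  pmap (idm (mact CC H F)) (mactm CC h G) (br_str H v)
  = pmap (mactm CC h F) (idm (mact CC H' G)) (br_str H' v).
Proof.
rewrite /= /br_str /br_map !mactm1 -!pmapM cmpm1 cmp1m mmul_natl mmul_inv_natl.
rewrite -[mmul_inv N H F Y]cmp1m pmapM tstr_ext -pmapM cmpm1.
by rewrite cmp1m.
Qed.

Lemma br_str_mul G F (A B : CC) (v : br_prof A B) :
  pmap (mmul CC G F A) (idm (mact CC (ten G F) B)) (br_str (ten G F) v)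
  = pmap (idm (mact CC G (mact CC F A))) (mmul CC G F B) (br_str G (br_str F v)).
Proof.
rewrite /= /br_str /br_map !mactm1 tstr_nat -!pmapM cmpm1 cmp1m -mmul_invA.
rewrite -cmpA mmulA_asso_inv -[X in pmap X _ (tstr P G _)]cmp1m pmapM.
by rewrite -tstr_mul -pmapM cmpm1.
Qed.

Lemma br_str_one (A B : CC) (v : br_prof A B) :
  pmap (mone CC A) (mone_inv CC B) (br_str (tunit C) v) = v.
Proof.
by rewrite /= /br_str /br_map -pmapM mmul_luni mmul_inv_luni tstr_one.
Qed.

(* P[Y, X] *)
Definition bracket : tamb CC CC :=
  @Tamb_ k C CC CC br_prof br_str br_str_lin br_str_nat br_str_ext br_str_mul br_str_one.

End Bracket.

Section BracketMonoid.
Context (k : fieldType) (C : moncat k) (M : modcat C) (X : M).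
Local Notation CC := (regular C).
Local Notation E := (bracket (hom_tamb M) X X).

Lemma bm_bal (F G : CC) : cbal (Psi := E) (Phi := E) (V := E F G)
  (fun H (b : hom (mact M F X) (mact M H X)) (c : hom (mact M H X) (mact M G X)) => c ∘ b).
Proof.
split=> [H c a u v|H b a u v|H H' h b c].
- exact: cmpPr.
- exact: cmpPl.
- by rewrite /= /br_map /= /homprof_map !mactm1 cmp1m cmpm1 cmpA.
Qed.

Lemma bm_nat (F F' G G' : CC) (f : hom F' F) (g : hom G G') (H : CC) (b : E F H) (c : E H G) :
  ((pmap (p := E) (idm H) g c : hom _ _) ∘ (pmap (p := E) f (idm H) b : hom _ _))
  = pmap (p := E) f g ((c : hom _ _) ∘ (b : hom _ _)).
Proof. by rewrite /= /br_map /= /homprof_map !mactm1 cmp1m cmpm1 !cmpA. Qed.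

Lemma bm_str (H : C) (F G K : CC) (b : E F K) (c : E K G) :
  ((tstr E H c : hom _ _) ∘ (tstr E H b : hom _ _))
  = tstr E H ((c : hom _ _) ∘ (b : hom _ _) : E F G).
Proof.
rewrite /= /br_str /= /homprof_map fmapM -!cmpA; congr (_ ∘ (_ ∘ _)).
by rewrite !cmpA mmulK cmp1m.
Qed.

Definition br_mul : tmor (comp_tamb E E) E :=
  tlift (Psi := E) (Phi := E) (Q := E) bm_bal bm_nat bm_str.

Lemma br_mul_gen (F G H : CC) (b : E F H) (c : E H G) :
  br_mul F G (cgen b c) = (c : hom _ _) ∘ (b : hom _ _).
Proof. exact: tlift_gen. Qed.

Definition br_one_fun (F G : CC) (f : hom_tamb CC F G) : E F G := mactm M (f : hom F G) X.

Lemma br_one_lin F G : linear (@br_one_fun F G).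
Proof. by move=> a f g; apply: mactmP. Qed.

Lemma br_one_nat (F F' G G' : CC) (f : hom F' F) (g : hom G G') (v : hom_tamb CC F G) :
  br_one_fun (pmap f g v) = pmap (p := E) f g (br_one_fun v).
Proof. by rewrite /= /br_map /br_one_fun /= /homprof_map !mactmM. Qed.

Lemma br_one_str (H : C) (F G : CC) (v : hom_tamb CC F G) :
  br_one_fun (tstr (hom_tamb CC) H v) = tstr E H (br_one_fun v).
Proof.
rewrite /= /br_one_fun /br_str /= /homprof_map -mmul_natr -cmpA mmulVK cmpm1.
by [].
Qed.

Definition br_one : tmor (hom_tamb CC) E := TMor br_one_lin br_one_nat br_one_str.

Lemma br_mulA : tcomp br_mul (thcomp br_mul (tid E))
    = tcomp br_mul (tcomp (thcomp (tid E) br_mul) (tass E E E)).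
Proof.
apply: tmor_comp_eql => F G U V x y z.
by rewrite !tcompE tass_gen !thcomp_gen !br_mul_gen cmpA.
Qed.

Lemma br_mul1l : tcomp br_mul (thcomp br_one (tid E)) = tlun E.
Proof.
apply: tmor_comp_eq => F G U f x.
rewrite !tcompE thcomp_gen br_mul_gen tlun_gen /= /br_map /= /homprof_map.
by rewrite mactm1 cmp1m.
Qed.

Lemma br_mul1r : tcomp br_mul (thcomp (tid E) br_one) = trun E.
Proof.
apply: tmor_comp_eq => F G U x f.
rewrite !tcompE thcomp_gen br_mul_gen trun_gen /= /br_map /= /homprof_map.
by rewrite mactm1 cmpm1.
Qed.

(* [X, X] *)
Definition br_monoid : tmonoid CC := TMonoid br_mulA br_mul1l br_mul1r.

End BracketMonoid.

Section BracketBimodule.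
Context (k : fieldType) (C : moncat k) (M N : modcat C) (Y : N) (X : M).
Local Notation CC := (regular C).
Local Notation A := (br_monoid X).
Local Notation B := (br_monoid Y).

Section Actions.
Context (P : tamb M N).
Local Notation R := (bracket P Y X).

Definition brl_fun (F G H : CC) (f : B F H) (v : R H G) : R F G :=
  pmap (p := P) (f : hom _ _) (idm (mact M G X)) v.

Lemma brl_bal (F G : CC) : cbal (fun H (f : B F H) (v : R H G) => brl_fun f v).
Proof.
split=> [H v a f f'|H f a u v|H H' h f v].
- exact: (@pmap_linl _ _ _ P _ _ _ _ (idm _) v a f f').
- exact: (@pmap_lin _ _ _ P _ _ _ _ _ _ a u v).
- by rewrite /brl_fun /= /br_map /= /homprof_map !mactm1 cmpm1 -pmapM cmp1m.
Qed.

Lemma brl_nat (F F' G G' : CC) (f : hom F' F) (g : hom G G') (H : CC)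
    (b : B F H) (v : R H G) :
  brl_fun (pmap f (idm H) b) (pmap (idm H) g v) = pmap f g (brl_fun b v).
Proof.
by rewrite /brl_fun /= /br_map /= /homprof_map !mactm1 -!pmapM !cmp1m cmpm1.
Qed.

Lemma brl_str (H : C) (F G K : CC) (b : B F K) (v : R K G) :
  brl_fun (tstr B H b) (tstr R H v) = tstr R H (brl_fun b v).
Proof.
rewrite /brl_fun /= /br_str /= /homprof_map tstr_nat fmap1 -!pmapM cmpm1 cmp1m.
by rewrite !cmpA mmulK cmp1m.
Qed.

Definition br_lact : tmor (comp_tamb B R) R := tlift brl_bal brl_nat brl_str.

Lemma br_lact_gen (F G H : CC) (b : B F H) (v : R H G) :
  br_lact F G (cgen b v) = pmap (p := P) (b : hom _ _) (idm (mact M G X)) v.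
Proof. exact: tlift_gen. Qed.

Definition brr_fun (F G H : CC) (v : R F H) (g : A H G) : R F G :=
  pmap (p := P) (idm (mact N F Y)) (g : hom _ _) v.

Lemma brr_bal (F G : CC) : cbal (fun H (v : R F H) (g : A H G) => brr_fun v g).
Proof.
split=> [H g a u v|H v a g g'|H H' h v g].
- exact: (@pmap_lin _ _ _ P _ _ _ _ _ _ a u v).
- exact: (@pmap_linr _ _ _ P _ _ _ _ (idm _) v a g g').
- by rewrite /brr_fun /= /br_map /= /homprof_map !mactm1 cmp1m -pmapM cmp1m.
Qed.

Lemma brr_nat (F F' G G' : CC) (f : hom F' F) (g : hom G G') (H : CC)
    (v : R F H) (a : A H G) :
  brr_fun (pmap f (idm H) v) (pmap (idm H) g a) = pmap f g (brr_fun v a).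
Proof.
by rewrite /brr_fun /= /br_map /= /homprof_map !mactm1 -!pmapM !cmpm1 cmp1m.
Qed.

Lemma brr_str (H : C) (F G K : CC) (v : R F K) (a : A K G) :
  brr_fun (tstr R H v) (tstr A H a) = tstr R H (brr_fun v a).
Proof.
rewrite /brr_fun /= /br_str /= /homprof_map tstr_nat fmap1 -!pmapM cmpm1 cmp1m.
by rewrite -!cmpA mmulK cmpm1.
Qed.

Definition br_ract : tmor (comp_tamb R A) R := tlift brr_bal brr_nat brr_str.

Lemma br_ract_gen (F G H : CC) (v : R F H) (a : A H G) :
  br_ract F G (cgen v a) = pmap (p := P) (idm (mact N F Y)) (a : hom _ _) v.
Proof. exact: tlift_gen. Qed.

Lemma br_lact_mul : tcomp br_lact (thcomp (mon_mul B) (tid R))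
    = tcomp br_lact (tcomp (thcomp (tid B) br_lact) (tass B B R)).
Proof.
apply: tmor_comp_eql => F G U V x y v.
rewrite !tcompE tass_gen !thcomp_gen !br_lact_gen br_mul_gen -pmapM cmp1m.
by [].
Qed.

Lemma br_lact_one : tcomp br_lact (thcomp (mon_one B) (tid R)) = tlun R.
Proof.
apply: tmor_comp_eq => F G U f v.
rewrite !tcompE thcomp_gen br_lact_gen tlun_gen /= /br_map mactm1.
by [].
Qed.

Lemma br_ract_mul : tcomp br_ract (thcomp br_ract (tid A))
    = tcomp br_ract (tcomp (thcomp (tid R) (mon_mul A)) (tass R A A)).
Proof.
apply: tmor_comp_eql => F G U V v x y.
rewrite !tcompE tass_gen !thcomp_gen !br_ract_gen br_mul_gen -pmapM cmp1m.
by [].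
Qed.

Lemma br_ract_one : tcomp br_ract (thcomp (tid R) (mon_one A)) = trun R.
Proof.
apply: tmor_comp_eq => F G U v f.
rewrite !tcompE thcomp_gen br_ract_gen trun_gen /= /br_map mactm1.
by [].
Qed.

Lemma br_lract : tcomp br_ract (thcomp br_lact (tid A))
    = tcomp br_lact (tcomp (thcomp (tid B) br_ract) (tass B R A)).
Proof.
apply: tmor_comp_eql => F G U V b v a.
rewrite !tcompE tass_gen !thcomp_gen br_ract_gen !br_lact_gen br_ract_gen.
by rewrite -!pmapM !cmp1m !cmpm1.
Qed.

(* The [Y, Y]-[X, X]-bimodule P[Y, X]. *)
Definition br_bimod : bimod A B :=
  BiMod br_lact_mul br_lact_one br_ract_mul br_ract_one br_lract.

End Actions.

Section Morphisms.
Context (P Q : tamb M N) (t : tmor P Q).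

Definition brm_fun (F G : CC) : bracket P Y X F G -> bracket Q Y X F G :=
  t (mact N F Y) (mact M G X).

Lemma brm_lin F G : linear (@brm_fun F G).
Proof. exact: (@tfun_lin _ _ _ _ _ _ t). Qed.

Lemma brm_nat (F F' G G' : CC) (f : hom F' F) (g : hom G G') (v : bracket P Y X F G) :
  brm_fun (pmap f g v) = pmap f g (brm_fun v).
Proof. exact: (tfun_nat t). Qed.

Lemma brm_str (H : C) (F G : CC) (v : bracket P Y X F G) :
  brm_fun (tstr (bracket P Y X) H v) = tstr (bracket Q Y X) H (brm_fun v).
Proof. by rewrite /brm_fun /= /br_str tfun_nat tfun_str. Qed.

Definition brm : tmor (bracket P Y X) (bracket Q Y X) := TMor brm_lin brm_nat brm_str.

Lemma brm_l (F H G : CC) (b : B F H) (v : br_bimod P H G) :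
  brm F G (lc (P := br_bimod P) b v) = lc (P := br_bimod Q) b (brm H G v).
Proof. by rewrite [RHS]br_lact_gen -[RHS]tfun_nat [X in brm _ _ X]br_lact_gen. Qed.

Lemma brm_r (F H G : CC) (v : br_bimod P F H) (a : A H G) :
  brm F G (rc (P := br_bimod P) v a) = rc (P := br_bimod Q) (brm F H v) a.
Proof. by rewrite [RHS]br_ract_gen -[RHS]tfun_nat [X in brm _ _ X]br_ract_gen. Qed.

Definition br_bimor : bimor (br_bimod P) (br_bimod Q) :=
  mk_bimor (P := br_bimod P) (Q := br_bimod Q) brm_l brm_r.

End Morphisms.

End BracketBimodule.

Section BracketUnit.
Context (k : fieldType) (C : moncat k) (M : modcat C) (X : M).
Local Notation CC := (regular C).
Local Notation A := (br_monoid X).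
Local Notation R := (br_bimod X X (hom_tamb M)).

Lemma bu_l (F H G : CC) (b : A F H) (v : reg_bimod A H G) :
  tid A F G (lc (P := reg_bimod A) b v) = lc (P := R) b (tid A H G v).
Proof.
rewrite [RHS]br_lact_gen [LHS]br_mul_gen /= /homprof_map cmp1m.
by [].
Qed.

Lemma bu_r (F H G : CC) (v : reg_bimod A F H) (a : A H G) :
  tid A F G (rc (P := reg_bimod A) v a) = rc (P := R) (tid A F H v) a.
Proof.
rewrite [RHS]br_ract_gen [LHS]br_mul_gen /= /homprof_map cmpm1.
by [].
Qed.

(* The regular bimodule [X, X] is Hom[X, X]; the underlying morphism of
   Tambara modules is the identity. *)
Definition br_unit : bimor (reg_bimod A) R :=
  mk_bimor (P := reg_bimod A) (Q := R) (s := tid (bracket (hom_tamb M) X X)) bu_l bu_r.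

End BracketUnit.

Section BracketComposition.
Context (k : fieldType) (C : moncat k) (K M N : modcat C).
Context (Z : N) (Y : M) (X : K) (S : tamb M N) (P : tamb K M).
Local Notation CC := (regular C).
Local Notation QS := (br_bimod Z Y S).
Local Notation QP := (br_bimod Y X P).
Local Notation QSP := (br_bimod Z X (comp_tamb S P)).

Definition bc_fun (F G H : CC) (s : QS F H) (p : QP H G) : QSP F G :=
  cgen (Y := mact M H Y) (s : S (mact N F Z) (mact M H Y)) (p : P (mact M H Y) (mact K G X)).

Lemma bc_bal (F G : CC) : rbal (Q := QS) (P := QP)
  (fun H (s : QS F H) (p : QP H G) => bc_fun s p).
Proof.
split; first split=> [H p a u v|H s a u v|H H' h s p].
- exact: cgenPl.
- exact: cgenPr.
- by rewrite /bc_fun /= /br_map !mactm1 cgen_bal.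
- move=> H H' s b p; rewrite /bc_fun [X in cgen X]br_ract_gen.
  by rewrite [X in _ = cgen _ X]br_lact_gen cgen_bal.
Qed.

Lemma bc_nat (F F' G G' : CC) (f : hom F' F) (h : hom G G') H (s : QS F H) (p : QP H G) :
  bc_fun (pmap f (idm H) s) (pmap (idm H) h p) = pmap f h (bc_fun s p).
Proof.
rewrite [RHS](_ : _ = pmap (p := comp_tamb S P) (mactm N f Z) (mactm K h X)
  (cgen (s : S _ _) (p : P _ _))) //.
by rewrite pmap_gen /bc_fun /= /br_map !mactm1.
Qed.

Lemma bc_str (H : C) (F G U : CC) (s : QS F U) (p : QP U G) :
  bc_fun (tstr QS H s) (tstr QP H p) = tstr QSP H (bc_fun s p).
Proof.
rewrite [RHS](_ : _ = pmap (p := comp_tamb S P) (mmul_inv N H F Z) (mmul K H G X)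
  (tstr (comp_tamb S P) H (cgen (s : S _ _) (p : P _ _)))) //.
rewrite tstr_gen pmap_gen /bc_fun /= /br_str.
rewrite (pmap_rl (mmul_inv N H F Z)) cgen_bal -pmapM cmp1m mmulK.
by [].
Qed.

Lemma bc_l (F G U H : CC) (d : br_monoid Z F U) (s : QS U H) (p : QP H G) :
  bc_fun (lc (P := QS) d s) p = lc (P := QSP) d (bc_fun s p).
Proof.
rewrite [RHS]br_lact_gen /bc_fun [X in cgen X]br_lact_gen pmap_gen pmap1.
by [].
Qed.

Lemma bc_r (F G U H : CC) (s : QS F H) (p : QP H U) (a : br_monoid X U G) :
  bc_fun s (rc (P := QP) p a) = rc (P := QSP) (bc_fun s p) a.
Proof.
rewrite [RHS]br_ract_gen /bc_fun [X in cgen _ X]br_ract_gen pmap_gen pmap1.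
by [].
Qed.

(* Induced by the coprojections
   S(NFZ, MHY) (x) P(MHY, KGX) -> (S . P)(NFZ, KGX) of the coend. *)
Definition br_comp : bimor (rt QS QP) QSP :=
  blift (Q := QS) (P := QP) (R := QSP) bc_bal bc_nat bc_str bc_l bc_r.

End BracketComposition.

(* The pseudofunctor sending M to [W M, W M] and P : M -> N to P[W N, W M]. *)
Definition NW (k : fieldType) (C : moncat k)
    (W : forall M : {M : modcat C | very_cyclic M}, sval M) :
    psfun_data (Tamb_c C) (Bimod (regular C)) :=
  @PsFunData k (Tamb_c C) (Bimod (regular C))
    (fun M => br_monoid (W M))
    (fun M N P => br_bimod (W N) (W M) P)
    (fun M N P Q t => br_bimor (W N) (W M) t)
    (fun K M N S P => br_comp (W N) (W M) (W K) S P)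
    (fun M => br_unit (W M)).

(* Main.v *)
From mathcomp Require Import all_boot ssralg.
From mathcomp Require Import boolp.
Require Import Defs.

Set Implicit Arguments.
Unset Strict Implicit.
Unset Printing Implicit Defensive.

Import GRing.Theory.
Local Open Scope ring_scope.

(** Fix a generator X of a module category M. Every object U of M comes with an
    isomorphism U ≅ MF X; a choice of these isomorphisms is a [frame]. A frame
    reduces every question about M to the objects MF X, where the bracket
    monoids and bimodules live, and the morphisms MF X -> MG X are by definition
    the elements of [X, X](F, G). This gives the three parts of a biequivalence.

    Pseudofunctoriality. All the axioms are identities between maps out of
    relative tensor products, and hold on generators. The substance is the
    invertibility of S[Z, Y] (x)_[Y, Y] P[Y, X] -> (S . P)[Z, X], see
    [br_comp_iso]: the target is a coend over all objects U of the middle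
    category, the source only sees the objects MH Y and the morphisms between
    them, and a frame transports U to such an object.

    Local equivalence. A bimodule morphism P[Y, X] -> Q[Y, X] is a family of maps
    P(NF Y, MG X) -> Q(NF Y, MG X) that commutes with pre- and postcomposition by
    all morphisms between these objects, not only those coming from C; frames
    extend it uniquely to all objects ([br_bimor_faithful], [br_bimor_full]).
    In the same way a bimodule p is extended to the Tambara module
    (U, V) |-> p(F, G) for the chosen U ≅ NF Y and V ≅ MG X ([br_bimod_surj]).

    Essential surjectivity. A monoid A has a Kleisli category [kleisli], with the
    objects of C and with A(F, G) as its space of morphisms F -> G. The Tambara
    structure of A turns it into a module category. It is generated by the unit
    object I, and [I, I] is isomorphic to A through the right unitor
    ([kl_iso]). The pseudofunctor may use another generator W, but [W, W] and
    [I, I] ≅ A are Morita equivalent through Hom[W, I] and Hom[I, W]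
    ([generator_equivalent]). *)

(** * Local equivalences from fully faithful, essentially surjective functors *)
Section LocalEquivalence.
Context (k : fieldType) (B B' : bicat k) (F : psfun_data B B') (a b : B).
Implicit Types f g h : cell1 a b.
Hypothesis F_lin : forall f g, linear (fun s : cell2 f g => ps2 F s).
Hypothesis F_id : forall f, ps2 F (id2 f) = id2 (ps1 F f).
Hypothesis F_vcomp : forall f g h (t : cell2 g h) (s : cell2 f g),
  ps2 F (vcomp t s) = vcomp (ps2 F t) (ps2 F s).
Hypothesis F_faithful : forall f g (s t : cell2 f g), ps2 F s = ps2 F t -> s = t.
Hypothesis F_full : forall f g (s : cell2 (ps1 F f) (ps1 F g)),
  exists t : cell2 f g, ps2 F t = s.
Hypothesis F_surj : forall p : cell1 (F a) (F b),
  exists f (e : cell2 (ps1 F f) p), is_iso2 e.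

(** The usual construction of a quasi-inverse: choose a preimage [G p] of each p
    together with an isomorphism [e p], and transport 2-cells along the [e p].
    Faithfulness makes the transported 2-cells functorial. *)
Lemma fully_faithful_local_equivalence : local_equivalence F a b.
Proof.
have [lift liftK] : {lift : forall f g, cell2 (ps1 F f) (ps1 F g) -> cell2 f g
    | forall f g s, ps2 F (lift f g s) = s}.
  exists (fun f g s => sval (cid (F_full s))) => f g s.
  by case: (cid _).
pose G p := sval (cid (F_surj p)).
pose e p : cell2 (ps1 F (G p)) p := sval (cid (svalP (cid (F_surj p)))).
have e_iso p : is_iso2 (e p) by exact: svalP (cid (svalP (cid (F_surj p)))).
pose e' p := sval (cid (e_iso p)).
have e'K p : vcomp (e' p) (e p) = id2 _ by have [] := svalP (cid (e_iso p)).
have e'VK p : vcomp (e p) (e' p) = id2 _ by have [] := svalP (cid (e_iso p)).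
have vcompZ (D : bicat k) (x y : D) (p q r : cell1 x y) (t : cell2 q r) c
    (s s' : cell2 p q) : vcomp t (c *: s + s') = c *: vcomp t s + vcomp t s'.
  exact: vcomp_linr.
have vcompZl (D : bicat k) (x y : D) (p q r : cell1 x y) (s : cell2 p q) c
    (t t' : cell2 q r) : vcomp (c *: t + t') s = c *: vcomp t s + vcomp t' s.
  exact: (vcomp_linl s c t t').
have F_P f g c (s t : cell2 f g) : ps2 F (c *: s + t) = c *: ps2 F s + ps2 F t.
  exact: F_lin.
exists G, (fun p q s => lift _ _ (vcomp (e' q) (vcomp s (e p)))),
  (fun f => lift _ _ (e' (ps1 F f))), e; split.
- split=> [p q c s t|p|p q r t s]; apply: F_faithful; rewrite liftK.
  + by rewrite F_P !liftK vcompZl vcompZ.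
  + by rewrite vcomp1l e'K F_id.
  + by rewrite F_vcomp !liftK -!vcompA (vcompA (e q)) e'VK vcomp1l.
- move=> f; exists (lift _ _ (e (ps1 F f))).
  by split; apply: F_faithful; rewrite F_vcomp F_id !liftK.
- exact: e_iso.
- move=> f g s; apply: F_faithful; rewrite !F_vcomp !liftK.
  by rewrite -!vcompA e'VK vcomp1r.
- by move=> p q s; rewrite liftK vcompA e'VK vcomp1l.
Qed.

End LocalEquivalence.

(** * Inverses of bijective morphisms *)
Section Inverses.
Context (k : fieldType) (C : moncat k).

Lemma tmor_inverse (M N : modcat C) (P Q : tamb M N) (s : tmor P Q)
    (r : forall Y X, Q Y X -> P Y X) :
    (forall Y X, cancel (s Y X) (r Y X)) -> (forall Y X, cancel (r Y X) (s Y X)) ->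
  exists t : tmor Q P, forall Y X (v : Q Y X), t Y X v = r Y X v.
Proof.
move=> sK rK.
have s_inj Y X := can_inj (sK Y X).
have r_lin Y X : linear (r Y X) by move=> a u v; apply: s_inj; rewrite tfunP !rK.
have r_nat Y Y' X X' (f : hom Y' Y) (g : hom X X') (v : Q Y X) :
    r _ _ (pmap f g v) = pmap f g (r _ _ v).
  by apply: s_inj; rewrite tfun_nat !rK.
have r_str H Y X (v : Q Y X) : r _ _ (tstr Q H v) = tstr P H (r _ _ v).
  by apply: s_inj; rewrite tfun_str !rK.
by exists (TMor r_lin r_nat r_str).
Qed.

Context (M : modcat C) (A B : tmonoid M).

Lemma bimor_iso (P Q : bimod A B) (s : bimor P Q) (r : forall Y X, Q Y X -> P Y X) :
    (forall Y X, cancel (s Y X) (r Y X)) -> (forall Y X, cancel (r Y X) (s Y X)) ->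
  is_iso2 (B := Bimod M) s.
Proof.
move=> sK rK; have [t tE] := tmor_inverse sK rK.
have s_inj Y X := can_inj (sK Y X).
have t_l F H G (b : B F H) (q : Q H G) : t F G (lc b q) = lc b (t H G q).
  by apply: s_inj; rewrite bimor_lc !tE !rK.
have t_r F H G (q : Q F H) (a : A H G) : t F G (rc q a) = rc (t F H q) a.
  by apply: s_inj; rewrite bimor_rc !tE !rK.
exists (mk_bimor t_l t_r).
split; apply: bimor_eq => F G v; first by rewrite bcompE [LHS]tE sK.
by rewrite bcompE [X in s _ _ X]tE rK.
Qed.

End Inverses.

(** * Frames of a module category *)
Section Frames.
Context (k : fieldType) (C : moncat k) (M : modcat C) (X : M).

Record frame := Frame {
  fr_ob : M -> C;
  fr_in : forall U, hom U (mact M (fr_ob U) X);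
  fr_out : forall U, hom (mact M (fr_ob U) X) U;
  fr_inK : forall U, fr_out U ∘ fr_in U = idm U;
  fr_outK : forall U, fr_in U ∘ fr_out U = idm _ }.

Lemma generator_frame : very_cyclic_generator X -> inhabited frame.
Proof.
move=> gX.
pose F U := sval (cid (gX U)).
pose i U : hom U (mact M (F U) X) := sval (cid (svalP (cid (gX U)))).
have i_iso U : is_iso (i U) by exact: svalP (cid (svalP (cid (gX U)))).
pose j U := sval (cid (i_iso U)).
have ij U : j U ∘ i U = idm U /\ i U ∘ j U = idm _ := svalP (cid (i_iso U)).
exact: (inhabits (@Frame F i j (fun U => (ij U).1) (fun U => (ij U).2))).
Qed.

End Frames.

(** * The pseudofunctor axioms *)
Section BracketElements.
Context (k : fieldType) (C : moncat k) (M N : modcat C) (Y : N) (X : M).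
Local Notation CC := (regular C).

Lemma lc_br (P : tamb M N) (F H G : CC) (b : br_monoid Y F H)
    (v : br_bimod Y X P H G) :
  lc b v = pmap (p := P) (b : hom _ _) (idm (mact M G X)) v.
Proof. exact: br_lact_gen. Qed.

Lemma rc_br (P : tamb M N) (F H G : CC) (v : br_bimod Y X P F H)
    (a : br_monoid X H G) :
  rc v a = pmap (p := P) (idm (mact N F Y)) (a : hom _ _) v.
Proof. exact: br_ract_gen. Qed.

Lemma mul_br (F H G : CC) (b : br_monoid X F H) (c : br_monoid X H G) :
  mul b c = (c : hom _ _) ∘ (b : hom _ _).
Proof. exact: br_mul_gen. Qed.

Lemma one_br (F : CC) : one (br_monoid X) F = idm (mact M F X).
Proof. exact: mactm1. Qed.

Lemma br_comp_gen (K : modcat C) (Z : K) (S : tamb N K) (P : tamb M N) (F G H : CC)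
    (s : br_bimod Z Y S F H) (p : br_bimod Y X P H G) :
  br_comp Z Y X S P F G (rgen s p) = cgen (Psi := S) (Phi := P) (Y := mact N H Y) s p.
Proof. exact: blift_gen. Qed.

End BracketElements.

Section BracketCompositionInverse.
Context (k : fieldType) (C : moncat k) (K M N : modcat C).
Context (Z : N) (Y : M) (X : K) (S : tamb M N) (P : tamb K M) (fr : frame Y).
Local Notation CC := (regular C).
Local Notation QS := (br_bimod Z Y S).
Local Notation QP := (br_bimod Y X P).

(** The inverse of [br_comp] on a pure tensor s (x) p with U in the middle: insert
    the isomorphism U ≅ MH Y of the frame. *)
Definition br_split (F G : CC) (U : M) (s : S (mact N F Z) U) (p : P U (mact K G X)) :
    rt QS QP F G :=
  rgen (pmap (idm _) (fr_in fr U) s : QS F (fr_ob fr U))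
       (pmap (fr_out fr U) (idm _) p : QP (fr_ob fr U) G).

(** A morphism h : U -> U' becomes the element [b] of [Y, Y] once both ends are
    framed, and the relative tensor product lets it move across. *)
Lemma br_split_bal (F G : CC) : cbal (@br_split F G).
Proof.
split=> [U p a u v|U s a u v|U U' h s p]; rewrite /br_split.
- by rewrite pmapPv rgenPl.
- by rewrite pmapPv rgenPr.
pose b : br_monoid Y (fr_ob fr U) (fr_ob fr U') := fr_in fr U' ∘ h ∘ fr_out fr U.
have -> : pmap (idm _) (fr_in fr U') (pmap (idm _) h s)
    = rc (P := QS) (pmap (idm _) (fr_in fr U) s : QS F (fr_ob fr U)) b.
  by rewrite rc_br -!pmapM !cmp1m -!cmpA fr_inK cmpm1.
have -> : pmap (fr_out fr U) (idm _) (pmap h (idm _) p)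
    = lc (P := QP) b (pmap (fr_out fr U') (idm _) p : QP (fr_ob fr U') G).
  by rewrite lc_br -!pmapM !cmp1m !cmpA fr_inK cmp1m.
exact: rgen_act.
Qed.

Lemma br_comp_iso : is_iso2 (B := Bimod CC) (br_comp Z Y X S P).
Proof.
apply: (bimor_iso (s := br_comp Z Y X S P)
  (r := fun F G => clift (@br_split F G))) => F G.
- apply: rt_ext => [a u v|//|H s p]; first by rewrite tfunP (clift_lin (br_split_bal F G)).
  rewrite br_comp_gen (clift_gen (br_split_bal F G)) /br_split.
  pose b : br_monoid Y H (fr_ob fr (mact M H Y)) := fr_in fr _.
  (* The frame at MH Y need not choose H itself; the comparison lies in [Y, Y]. *)
  have -> : pmap (idm _) (fr_in fr (mact M H Y)) s = rc (P := QS) s b by rewrite rc_br.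
  by rewrite [LHS]rgen_act lc_br -pmapM fr_inK cmp1m pmap1.
- apply: coend_ext => [a u v|//|U s p]; first by rewrite (clift_lin (br_split_bal F G)) tfunP.
  rewrite (clift_gen (br_split_bal F G)) [LHS]br_comp_gen cgen_bal -pmapM fr_inK.
  by rewrite cmp1m pmap1.
Qed.

End BracketCompositionInverse.

Section BracketCoherence.
Context (k : fieldType) (C : moncat k) (K L M N : modcat C).
Context (Z : N) (Y : M) (X : L) (V : K).
Local Notation CC := (regular C).

Lemma br_comp_natural (S S' : tamb M N) (P P' : tamb L M) (t : tmor S S') (s : tmor P P') :
  bcomp (br_comp Z Y X S' P') (bhcomp (br_bimor Z Y t) (br_bimor Y X s))
  = bcomp (br_bimor Z X (thcomp t s)) (br_comp Z Y X S P).
Proof.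
apply: brt_eq => F G H x y.
rewrite !bcompE bhcomp_gen !br_comp_gen.
by rewrite [RHS]thcomp_gen.
Qed.

Lemma br_comp_assoc (S : tamb M N) (P : tamb L M) (Q : tamb K L) :
  bcomp (br_bimor Z V (tass S P Q))
    (bcomp (br_comp Z X V (comp_tamb S P) Q)
       (bhcomp (br_comp Z Y X S P) (bid (br_bimod X V Q))))
  = bcomp (br_comp Z Y V S (comp_tamb P Q))
      (bcomp (bhcomp (bid (br_bimod Z Y S)) (br_comp Y X V P Q))
         (bass (br_bimod Z Y S) (br_bimod Y X P) (br_bimod X V Q))).
Proof.
apply: brt_eql => F G U H x y z.
rewrite !bcompE (bhcomp_gen (br_comp Z Y X S P)) !br_comp_gen [LHS]tass_gen.
rewrite bass_gen (bhcomp_gen (bid (br_bimod Z Y S)) (br_comp Y X V P Q)).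
by rewrite !br_comp_gen.
Qed.

Lemma br_comp_lunit (P : tamb L M) :
  bcomp (br_bimor Y X (tlun P))
    (bcomp (br_comp Y Y X (hom_tamb M) P)
       (bhcomp (br_unit Y) (bid (br_bimod Y X P))))
  = blun (br_bimod Y X P).
Proof.
apply: brt_eq => F G H b p.
rewrite !bcompE (bhcomp_gen (br_unit Y)) br_comp_gen [LHS]tlun_gen.
by rewrite blun_gen lc_br.
Qed.

Lemma br_comp_runit (P : tamb L M) :
  bcomp (br_bimor Y X (trun P))
    (bcomp (br_comp Y X X P (hom_tamb L))
       (bhcomp (bid (br_bimod Y X P)) (br_unit X)))
  = brun (br_bimod Y X P).
Proof.
apply: brt_eq => F G H p a.
rewrite !bcompE (bhcomp_gen (bid (br_bimod Y X P))) br_comp_gen [LHS]trun_gen.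
by rewrite brun_gen rc_br.
Qed.

Lemma br_unit_iso : is_iso2 (B := Bimod CC) (br_unit X).
Proof. exact: (bimor_iso (s := br_unit X) (r := fun _ _ v => v)). Qed.

End BracketCoherence.

Section Pseudofunctor.
Context (k : fieldType) (C : moncat k).
Context (W : forall M : {M : modcat C | very_cyclic M}, sval M).
Hypothesis hW : forall M : {M : modcat C | very_cyclic M}, very_cyclic_generator (W M).

Lemma NW_psfun : is_psfun (NW W).
Proof.
split.
- by move=> M N P Q c s t; apply: bimor_eq => F G v; rewrite bimor_linE.
- by move=> M N P; apply: bimor_eq.
- by move=> M N P Q R t s; apply: bimor_eq.
- move=> K M N S P; have [fr] := generator_frame (@hW M).
  exact: br_comp_iso.
- by move=> M; apply: br_unit_iso.
- by move=> K M N S S' P P' t s; apply: br_comp_natural.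
- by move=> K L M N S P Q; apply: br_comp_assoc.
- by move=> M N P; apply: br_comp_lunit.
- by move=> M N P; apply: br_comp_runit.
Qed.

End Pseudofunctor.

(** * The bracket is locally fully faithful *)
Section BracketFullyFaithful.
Context (k : fieldType) (C : moncat k) (M N : modcat C) (Y : N) (X : M).
Context (fY : frame Y) (fX : frame X) (P Q : tamb M N).
Local Notation CC := (regular C).

Lemma frame_pmap (R : tamb M N) (U : N) (V : M) (v : R U V) :
  v = pmap (fr_in fY U) (fr_out fX V) (pmap (fr_out fY U) (fr_in fX V) v).
Proof. by rewrite -pmapM !fr_inK pmap1. Qed.

Lemma tstr_br (R : tamb M N) (H : C) (F G : CC) (w : R (mact N F Y) (mact M G X)) :
  tstr R H w
  = pmap (mmul N H F Y) (mmul_inv M H G X) (tstr (bracket R Y X) H (w : br_prof R Y X F G)).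
Proof. by rewrite /= /br_str -pmapM !mmulK pmap1. Qed.

Lemma br_bimor_faithful (s t : tmor P Q) : br_bimor Y X s = br_bimor Y X t -> s = t.
Proof.
move=> st; apply: tmor_eq => U V v.
rewrite (frame_pmap v) (tfun_nat s (fr_in _ _)) (tfun_nat t (fr_in _ _)).
congr pmap.
have /tmor_eqP := congr1 (@bim_mor _ _ _ _ _ _ _) st.
by move/(_ (fr_ob fY U) (fr_ob fX V)); apply.
Qed.

Section Extension.
Context (s : bimor (br_bimod Y X P) (br_bimod Y X Q)).

(** Bimodule morphisms are natural for all morphisms between the objects NF Y and
    MG X, because these morphisms are the elements of the bracket monoids. *)
Lemma br_bimor_pmap (F F' G G' : CC) (x : hom (mact N F' Y) (mact N F Y))
    (y : hom (mact M G X) (mact M G' X)) (w : P (mact N F Y) (mact M G X)) :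
  s F' G' (pmap x y w) = pmap (p := Q) x y (s F G w).
Proof.
(* Transport along x and y is the action of x and y as elements of the monoids. *)
have e (R : tamb M N) (u : R (mact N F Y) (mact M G X)) :
    pmap x y u = lc (P := br_bimod Y X R) (x : br_monoid Y F' F)
      (rc (P := br_bimod Y X R) (u : br_bimod Y X R F G) (y : br_monoid X G G')).
  by rewrite rc_br lc_br -pmapM !cmp1m.
by rewrite !e bimor_lc bimor_rc.
Qed.

Definition ext_fun (U : N) (V : M) (v : P U V) : Q U V :=
  pmap (fr_in fY U) (fr_out fX V)
    (s (fr_ob fY U) (fr_ob fX V) (pmap (fr_out fY U) (fr_in fX V) v) : Q _ _).

(** The extension does not depend on the frame. Naturality and compatibility with
    the Tambara structure are instances of this formula. *)
Lemma ext_fun_pmap (F G : CC) (U : N) (V : M) (x : hom U (mact N F Y))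
    (y : hom (mact M G X) V) (w : P (mact N F Y) (mact M G X)) :
  ext_fun (pmap x y w) = pmap (p := Q) x y (s F G w).
Proof.
rewrite /ext_fun -pmapM br_bimor_pmap -pmapM.
by rewrite -cmpA fr_inK cmpm1 cmpA fr_inK cmp1m.
Qed.

Lemma ext_lin U V : linear (@ext_fun U V).
Proof. by move=> a u v; rewrite /ext_fun pmapPv tfunP pmapPv. Qed.

Lemma ext_nat U U' V V' (f : hom U' U) (g : hom V V') (v : P U V) :
  ext_fun (pmap f g v) = pmap f g (ext_fun v).
Proof. by rewrite (frame_pmap v) -pmapM !ext_fun_pmap -pmapM. Qed.

Lemma ext_str H U V (v : P U V) : ext_fun (tstr P H v) = tstr Q H (ext_fun v).
Proof.
rewrite (frame_pmap v); move: (pmap _ _ v) => w.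
rewrite ext_fun_pmap !tstr_nat [tstr P H w]tstr_br -pmapM ext_fun_pmap tfun_str.
by rewrite pmapM -tstr_br.
Qed.

Definition ext_tmor : tmor P Q := TMor ext_lin ext_nat ext_str.

Lemma br_bimor_ext : br_bimor Y X ext_tmor = s.
Proof.
apply: bimor_eq => F G v.
have := ext_fun_pmap (idm (mact N F Y)) (idm (mact M G X)) v.
by rewrite !pmap1.
Qed.

End Extension.

Lemma br_bimor_full (s : bimor (br_bimod Y X P) (br_bimod Y X Q)) :
  exists t, br_bimor Y X t = s.
Proof. by exists (ext_tmor s); apply: br_bimor_ext. Qed.

End BracketFullyFaithful.

(** * The bracket is locally essentially surjective *)
Section BracketSurjective.
Context (k : fieldType) (C : moncat k) (M N : modcat C) (Y : N) (X : M).
Context (fY : frame Y) (fX : frame X).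
Local Notation CC := (regular C).
Context (p : bimod (br_monoid X) (br_monoid Y)).

(** The two unit axioms force the functoriality of a bimodule in C to be its
    action restricted along the units of the monoids. *)
Lemma pmap_bim (F F' G G' : CC) (f : hom F' F) (g : hom G G') (v : p F G) :
  pmap f g v = lc (mactm N f Y : br_monoid Y F' F)
                  (rc v (mactm M g X : br_monoid X G G')).
Proof.
have el (H : CC) (u : p F H) :
    lc (mactm N f Y : br_monoid Y F' F) u = pmap f (idm H) u.
  have := tmor_eqP (lact_one p) (cgen (Psi := hom_tamb CC) (f : hom_tamb CC F' F) u).
  by rewrite tcompE thcomp_gen tlun_gen.
have er : rc v (mactm M g X : br_monoid X G G') = pmap (idm F) g v.
  have := tmor_eqP (ract_one p) (cgen (Phi := hom_tamb CC) v (g : hom_tamb CC G G')).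
  by rewrite tcompE thcomp_gen trun_gen.
by rewrite er el -pmap_lr.
Qed.

Definition ind_ob (U : N) (V : M) : lmodType k := p (fr_ob fY U) (fr_ob fX V).

(** The element of p(U, V) that would be p(x, y)(v) if p were defined on all
    objects. Every element has this form in a canonical way ([ind_elt_id]), and
    the operations of the induced Tambara module are computed on this form
    without reference to the frame ([ind_map_elt], [ind_str_elt]). *)
Definition ind_elt (F G : CC) (U : N) (V : M) (x : hom U (mact N F Y)) (v : p F G)
    (y : hom (mact M G X) V) : ind_ob U V :=
  lc (x ∘ fr_out fY U : br_monoid Y _ _) (rc v (fr_in fX V ∘ y : br_monoid X _ _)).

Lemma ind_elt_id (U : N) (V : M) (v : ind_ob U V) :
  v = ind_elt (fr_in fY U) v (fr_out fX V).
Proof.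
rewrite /ind_elt !fr_outK -{1}(lc_one v) -{1}(rc_one v) !one_br.
by [].
Qed.

Lemma ind_elt_lc (F F' G : CC) (U : N) (V : M) (x : hom U (mact N F' Y))
    (b : hom (mact N F' Y) (mact N F Y)) (v : p F G) (y : hom (mact M G X) V) :
  ind_elt x (lc (b : br_monoid Y F' F) v) y = ind_elt (b ∘ x) v y.
Proof. by rewrite /ind_elt lrc -lc_mul mul_br cmpA. Qed.

Lemma ind_elt_rc (F G G' : CC) (U : N) (V : M) (x : hom U (mact N F Y)) (v : p F G)
    (a : hom (mact M G X) (mact M G' X)) (y : hom (mact M G' X) V) :
  ind_elt x (rc v (a : br_monoid X G G')) y = ind_elt x v (y ∘ a).
Proof. by rewrite /ind_elt rc_mul mul_br cmpA. Qed.

(** How the Tambara axioms of p reach the induced module: a morphism of C on v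
    turns into module structure on x and y. *)
Lemma ind_elt_pmap (F F' G G' : CC) (U : N) (V : M) (x : hom U (mact N F' Y))
    (f : hom F' F) (g : hom G G') (v : p F G) (y : hom (mact M G' X) V) :
  ind_elt x (pmap f g v) y = ind_elt (mactm N f Y ∘ x) v (y ∘ mactm M g X).
Proof. by rewrite pmap_bim ind_elt_lc ind_elt_rc. Qed.

Lemma ind_elt_linv (F G : CC) (U : N) (V : M) (x : hom U (mact N F Y))
    (y : hom (mact M G X) V) : linear (fun v => ind_elt x v y).
Proof. by move=> a u v; rewrite /ind_elt rcPl lcPr. Qed.

Lemma ind_elt_linl (F G : CC) (U : N) (V : M) (v : p F G)
    (y : hom (mact M G X) V) : linear (fun x : hom U (mact N F Y) => ind_elt x v y).
Proof. by move=> a u u'; rewrite /ind_elt cmpPl (lcPl (B := br_monoid Y)). Qed.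

Lemma ind_elt_linr (F G : CC) (U : N) (V : M) (x : hom U (mact N F Y)) (v : p F G) :
  linear (fun y : hom (mact M G X) V => ind_elt x v y).
Proof. by move=> a u u'; rewrite /ind_elt cmpPr (rcPr (A := br_monoid X)) lcPr. Qed.

Definition ind_map (U U' : N) (V V' : M) (f : hom U' U) (g : hom V V') (v : ind_ob U V) :
    ind_ob U' V' :=
  ind_elt (fr_in fY U ∘ f) v (g ∘ fr_out fX V).

Lemma ind_map_elt (F G : CC) (U U' : N) (V V' : M) (f : hom U' U) (g : hom V V')
    (x : hom U (mact N F Y)) (v : p F G) (y : hom (mact M G X) V) :
  ind_map f g (ind_elt x v y) = ind_elt (x ∘ f) v (g ∘ y).
Proof.
rewrite /ind_map {2}/ind_elt ind_elt_lc ind_elt_rc.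
by rewrite -!cmpA (cmpA (fr_out fY U)) fr_inK cmp1m (cmpA (fr_out fX V)) fr_inK cmp1m.
Qed.

Lemma ind_map_lin (U U' : N) (V V' : M) (f : hom U' U) (g : hom V V') :
  linear (ind_map f g).
Proof. exact: ind_elt_linv. Qed.

Lemma ind_map_linl (U U' : N) (V V' : M) (g : hom V V') (v : ind_ob U V) :
  linear (fun f : hom U' U => ind_map f g v).
Proof. by move=> a f f'; rewrite /ind_map cmpPr; apply: ind_elt_linl. Qed.

Lemma ind_map_linr (U U' : N) (V V' : M) (f : hom U' U) (v : ind_ob U V) :
  linear (fun g : hom V V' => ind_map f g v).
Proof. by move=> a g g'; rewrite /ind_map cmpPl; apply: ind_elt_linr. Qed.

Lemma ind_map1 (U : N) (V : M) (v : ind_ob U V) : ind_map (idm U) (idm V) v = v.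
Proof. by rewrite {2}(ind_elt_id v) /ind_map cmpm1 cmp1m. Qed.

Lemma ind_mapM (U U' U'' : N) (V V' V'' : M) (f : hom U' U) (f' : hom U'' U')
    (g : hom V V') (g' : hom V' V'') (v : ind_ob U V) :
  ind_map (f ∘ f') (g' ∘ g) v = ind_map f' g' (ind_map f g v).
Proof. by rewrite (ind_elt_id v) !ind_map_elt !cmpA. Qed.

Definition ind_prof : prof M N :=
  Prof ind_map_lin ind_map_linl ind_map_linr ind_map1 ind_mapM.

Definition ind_str (H : C) (U : N) (V : M) (v : ind_prof U V) :
    ind_prof (mact N H U) (mact M H V) :=
  ind_elt (mmul N H _ Y ∘ fmap (mact N H) (fr_in fY U))
    (tstr p H (v : p (fr_ob fY U) (fr_ob fX V)))
    (fmap (mact M H) (fr_out fX V) ∘ mmul_inv M H _ X).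

Lemma ind_str_elt (H : C) (F G : CC) (U : N) (V : M)
    (x : hom U (mact N F Y)) (v : p F G) (y : hom (mact M G X) V) :
  ind_str H (ind_elt x v y)
  = ind_elt (mmul N H F Y ∘ fmap (mact N H) x) (tstr p H v)
           (fmap (mact M H) y ∘ mmul_inv M H G X).
Proof.
rewrite /ind_str {2}/ind_elt -lc_str -rc_str ind_elt_lc ind_elt_rc.
rewrite /= /br_str /= /homprof_map !fmapM -!cmpA.
rewrite !(cmpA (mmul_inv N H _ Y)) !mmulK !cmp1m.
rewrite !(cmpA (mmul_inv M H _ X)) !mmulK !cmp1m.
rewrite -(fmapM _ (fr_out fY U)) fr_inK fmap1 cmpm1.
by rewrite (cmpA (fmap _ (fr_out fX V))) -fmapM fr_inK fmap1 cmp1m.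
Qed.

Lemma ind_str_lin H U V : linear (@ind_str H U V).
Proof. by move=> a u v; rewrite /ind_str tstrP; apply: ind_elt_linv. Qed.

Lemma ind_str_nat H (U U' : N) (V V' : M) (f : hom U' U) (g : hom V V')
    (v : ind_prof U V) :
  ind_str H (pmap f g v) = pmap (fmap (mact N H) f) (fmap (mact M H) g) (ind_str H v).
Proof. by rewrite (ind_elt_id v) /= ind_map_elt !ind_str_elt ind_map_elt !fmapM !cmpA. Qed.

Lemma ind_str_ext H H' (h : hom H H') (U : N) (V : M) (v : ind_prof U V) :
  pmap (idm (mact N H U)) (mactm M h V) (ind_str H v)
  = pmap (mactm N h U) (idm (mact M H' V)) (ind_str H' v).
Proof.
rewrite (ind_elt_id v) /= !ind_str_elt !ind_map_elt cmpm1 cmp1m.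
rewrite cmpA -mactm_nat -[in LHS]cmpA -mmul_inv_natl cmpA.
rewrite -[X in ind_elt X _ _]cmp1m -(mactm1 (m := N)) -ind_elt_pmap.
(* On the left, h now acts on the element of p, where the axiom of p applies. *)
have := tstr_ext h (v : p (fr_ob fY U) (fr_ob fX V)); rewrite /= => ->.
rewrite ind_elt_pmap mactm1 cmpm1 cmpA mmul_natl -!cmpA.
by rewrite mactm_nat.
Qed.

Lemma ind_str_mul G F (U : N) (V : M) (v : ind_prof U V) :
  pmap (mmul N G F U) (idm (mact M (ten G F) V)) (ind_str (ten G F) v)
  = pmap (idm (mact N G (mact N F U))) (mmul M G F V) (ind_str G (ind_str F v)).
Proof.
rewrite (ind_elt_id v) /= !ind_str_elt !ind_map_elt cmpm1 cmp1m.
rewrite -[in LHS]cmpA mmul_natX cmpA -mmulA_asso_inv -[in LHS]cmpA.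
rewrite -[X in ind_elt _ _ X]cmpm1 -(mactm1 (m := M)) -ind_elt_pmap.
have := tstr_mul (t := p) G F (v : p (fr_ob fY U) (fr_ob fX V)); rewrite /= => ->.
rewrite ind_elt_pmap mactm1 cmp1m -(cmpA (fmap _ (fr_out fX V))) -mmul_invA.
rewrite (cmpA (fmap _ (fr_out fX V))) mmul_natX.
by rewrite !fmapM -!cmpA.
Qed.

Lemma ind_str_one (U : N) (V : M) (v : ind_prof U V) :
  pmap (mone N U) (mone_inv M V) (ind_str (tunit C) v) = v.
Proof.
rewrite {1}(ind_elt_id v) /= ind_str_elt ind_map_elt -[in LHS]cmpA mone_nat.
have e1 : mone_inv M V ∘ fmap (mact M (tunit C)) (fr_out fX V) = fr_out fX V ∘ mone_inv M _.
  apply: (cmp_epi (moneVK _)).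
  by rewrite -[LHS]cmpA mone_nat cmpA moneK cmp1m -cmpA moneK cmpm1.
rewrite !cmpA e1 -cmpA -(mmul_inv_luni (fr_ob fY U) Y) -(mmul_luni (fr_ob fX V) X).
rewrite !cmpA mmulVK cmp1m -(cmpA _ (mmul _ _ _ _)) mmulVK cmpm1 -ind_elt_pmap.
have := tstr_one (v : p (fr_ob fY U) (fr_ob fX V)); rewrite /= => ->.
exact: esym (ind_elt_id v).
Qed.

Definition ind_tamb : tamb M N :=
  @Tamb_ k C M N ind_prof ind_str ind_str_lin ind_str_nat ind_str_ext ind_str_mul ind_str_one.

(** A bimodule sits in the bracket of its extension as the elements p(id, id)(w). *)
Definition ind_unit_fun (F G : CC) (w : p F G) : bracket ind_tamb Y X F G :=
  ind_elt (idm (mact N F Y)) w (idm (mact M G X)).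

Lemma ind_unit_lin F G : linear (@ind_unit_fun F G).
Proof. exact: ind_elt_linv. Qed.

Lemma ind_unit_nat (F F' G G' : CC) (f : hom F' F) (g : hom G G') (w : p F G) :
  ind_unit_fun (pmap f g w) = pmap f g (ind_unit_fun w).
Proof.
by rewrite /ind_unit_fun ind_elt_pmap [RHS]ind_map_elt !cmpm1 !cmp1m.
Qed.

Lemma ind_unit_str (H : C) (F G : CC) (w : p F G) :
  ind_unit_fun (tstr p H w) = tstr (bracket ind_tamb Y X) H (ind_unit_fun w).
Proof.
rewrite /= /br_str /= ind_str_elt ind_map_elt !fmap1 cmpm1 cmp1m !mmulVK.
by [].
Qed.

Definition ind_unit : tmor p (bracket ind_tamb Y X) :=
  TMor ind_unit_lin ind_unit_nat ind_unit_str.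

Lemma ind_unit_lc F H G (b : br_monoid Y F H) (w : p H G) :
  ind_unit F G (lc b w) = lc (P := br_bimod Y X ind_tamb) b (ind_unit H G w).
Proof. by rewrite lc_br [RHS]ind_map_elt [LHS]ind_elt_lc cmpm1 !cmp1m. Qed.

Lemma ind_unit_rc F H G (w : p F H) (a : br_monoid X H G) :
  ind_unit F G (rc w a) = rc (P := br_bimod Y X ind_tamb) (ind_unit F H w) a.
Proof. by rewrite rc_br [RHS]ind_map_elt [LHS]ind_elt_rc !cmpm1 cmp1m. Qed.

Definition ind_counit_fun (F G : CC) (v : ind_ob (mact N F Y) (mact M G X)) : p F G :=
  lc (fr_in fY (mact N F Y) : br_monoid Y _ _)
     (rc v (fr_out fX (mact M G X) : br_monoid X _ _)).

Lemma ind_unitK F G : cancel (ind_unit F G) (@ind_counit_fun F G).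
Proof.
move=> w; rewrite /ind_counit_fun /= /ind_unit_fun /ind_elt cmp1m cmpm1.
rewrite lrc -lc_mul rc_mul !mul_br !fr_inK.
by rewrite -(one_br X G) -(one_br Y F) rc_one lc_one.
Qed.

Lemma ind_counitK F G : cancel (@ind_counit_fun F G) (ind_unit F G).
Proof.
move=> v; rewrite /ind_counit_fun /= /ind_unit_fun ind_elt_lc ind_elt_rc cmpm1 cmp1m.
exact: esym (ind_elt_id v).
Qed.

Lemma br_bimod_surj : exists (R : tamb M N) (e : bimor (br_bimod Y X R) p),
  is_iso2 (B := Bimod CC) e.
Proof.
pose s := mk_bimor (Q := br_bimod Y X ind_tamb) ind_unit_lc ind_unit_rc.
have [e [eK eVK]] := bimor_iso (s := s) ind_unitK ind_counitK.
by exists ind_tamb, e, s.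
Qed.

End BracketSurjective.

(** * The Kleisli module category of a monoid *)
Section Kleisli.
Context (k : fieldType) (C : moncat k).
Local Notation CC := (regular C).

(** Kelly's consequence of the pentagon and triangle axioms, the mirror image of
    [luni_ten]. *)
Lemma runi_ten (F G : C) :
  runi (ten F G) = tenm (idm F) (runi G) ∘ asso F G (tunit C).
Proof.
have faith (X Y : C) (f g : hom X Y) :
    tenm f (idm (tunit C)) = tenm g (idm (tunit C)) -> f = g.
  by move=> fg; apply: (cmp_epi (runiVK X)); rewrite -!runi_nat fg.
apply: faith; apply: (cmp_mono (assoK F G (tunit C))).
rewrite -triangle -(tenm1 F G) cmpA asso_nat -cmpA -pentagon.
rewrite -(cmp1m (idm (tunit C))) tenmM !cmpA asso_nat cmp1m -!tenmM.
by rewrite cmp1m triangle.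
Qed.

Lemma runi_inv_ten (F G : C) :
  runi_inv (ten F G) = asso_inv F G (tunit C) ∘ tenm (idm F) (runi_inv G).
Proof.
apply: (cmp_mono (runiK (ten F G))); rewrite runiVK runi_ten -cmpA.
rewrite (cmpA (asso _ _ _)) assoVK cmp1m -tenmM runiVK cmpm1.
by rewrite tenm1.
Qed.

Context (A : tmonoid CC).

Definition eta (F G : C) (f : hom F G) : A F G := mon_one A F G f.

Lemma eta_mul (F G H : C) (f : hom F H) (a : A H G) :
  mul (eta f) a = pmap (p := A) f (idm G : hom (l := CC) G G) a.
Proof.
have := tmor_eqP (mon_mul1l A) (cgen (Psi := hom_tamb CC) (f : hom_tamb CC F H) a).
by rewrite tcompE thcomp_gen tlun_gen.
Qed.

Lemma mul_eta (F G H : C) (a : A F H) (g : hom H G) :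
  mul a (eta g) = pmap (p := A) (idm F : hom (l := CC) F F) g a.
Proof.
have := tmor_eqP (mon_mul1r A) (cgen (Phi := hom_tamb CC) a (g : hom_tamb CC H G)).
by rewrite tcompE thcomp_gen trun_gen.
Qed.

Lemma etaM (F G H : C) (g : hom G H) (f : hom F G) :
  eta (g ∘ f) = mul (eta f) (eta g).
Proof.
rewrite eta_mul /eta -tfun_nat; congr (mon_one A _ _ _).
by rewrite /= /homprof_map cmp1m.
Qed.

Lemma eta1 (F : C) : eta (idm F) = one A F.
Proof. by []. Qed.

Lemma eta_str (H F G : C) (f : hom F G) : tstr A H (eta f) = eta (tenm (idm H) f).
Proof. by rewrite /eta -tfun_str. Qed.

Lemma kl_linl (x y z : C) (f : A x y) : linear (fun g : A y z => mul f g).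
Proof. by move=> a u v; apply: (lcPr (P := reg_bimod A)). Qed.

Lemma kl_linr (x y z : C) (g : A y z) : linear (fun f : A x y => mul f g).
Proof. by move=> a u v; apply: (lcPl (P := reg_bimod A)). Qed.

Lemma kl_mulA (x y z t : C) (h : A z t) (g : A y z) (f : A x y) :
  mul (mul f g) h = mul f (mul g h).
Proof. exact: (lc_mul (P := reg_bimod A)). Qed.

Definition kl_cat : lincat k :=
  @LinCat k C (fun F G => A F G) (fun F => one A F) (fun x y z g f => mul f g)
    kl_linl kl_linr kl_mulA (fun x y f => mul_one f) (fun x y f => one_mul f).

Lemma kl_str_cmp (H : C) (x y z : C) (g : A y z) (f : A x y) :
  tstr A H (mul f g) = mul (tstr A H f) (tstr A H g).
Proof. exact: esym (lc_str (P := reg_bimod A) H f g). Qed.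

Definition kl_act (H : C) : linfunctor kl_cat kl_cat :=
  @LinFunctor k kl_cat kl_cat (fun F => ten H F) (fun F G a => tstr A H a)
    (fun F G => @tstr_lin _ _ _ _ A H F G) (fun F => one_str A H F) (@kl_str_cmp H).

Lemma kl_mactm_nat (F G : C) (f : hom F G) (X Y : C) (x : A X Y) :
  mul (eta (tenm f (idm X))) (tstr A G x) = mul (tstr A F x) (eta (tenm f (idm Y))).
Proof. by rewrite eta_mul mul_eta; apply: esym (tstr_ext (t := A) f x). Qed.

Lemma kl_mactm_lin (F G X : C) : linear (fun f : hom F G => eta (tenm f (idm X))).
Proof. by move=> a f g; rewrite tenmPl /eta (tfunP (mon_one A)). Qed.

Lemma kl_mul_natX (G F X Y : C) (x : A X Y) :
  mul (eta (asso_inv G F X)) (tstr A (ten G F) x)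
  = mul (tstr A G (tstr A F x)) (eta (asso_inv G F Y)).
Proof. by rewrite eta_mul mul_eta; apply: (tstr_mul (t := A)). Qed.

Lemma kl_mul_nat (G G' F F' : C) (g : hom G G') (f : hom F F') (X : C) :
  mul (eta (asso_inv G F X)) (eta (tenm (tenm g f) (idm X)))
  = mul (mul (tstr A G (eta (tenm f (idm X)))) (eta (tenm g (idm (ten F' X)))))
        (eta (asso_inv G' F' X)).
Proof. by rewrite eta_str -!etaM reg_mul_nat. Qed.

Lemma kl_one_nat (X Y : C) (x : A X Y) :
  mul (eta (luni_inv X)) (tstr A (tunit C) x) = mul x (eta (luni_inv Y)).
Proof.
rewrite eta_mul mul_eta -{2}(tstr_one x) -pmapM /= luniK.
by rewrite cmpm1.
Qed.

Lemma kl_mulA_coh (H G F X : C) :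
  mul (mul (eta (asso_inv H G (ten F X))) (eta (asso_inv (ten H G) F X)))
      (eta (tenm (asso H G F) (idm X)))
  = mul (tstr A H (eta (asso_inv G F X))) (eta (asso_inv H (ten G F) X)).
Proof. by rewrite eta_str -!etaM reg_mulA. Qed.

Lemma kl_mul1l (F X : C) :
  mul (mul (eta (luni_inv (ten F X))) (eta (asso_inv (tunit C) F X)))
      (eta (tenm (luni F) (idm X))) = one A (ten F X).
Proof. by rewrite -!etaM reg_mul1l eta1. Qed.

Lemma kl_mul1r (F X : C) :
  mul (mul (tstr A F (eta (luni_inv X))) (eta (asso_inv F (tunit C) X)))
      (eta (tenm (runi F) (idm X))) = one A (ten F X).
Proof. by rewrite eta_str -!etaM reg_mul1r eta1. Qed.

Lemma eta_iso (F G : C) (f : hom F G) (g : hom G F) :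
  g ∘ f = idm F -> mul (eta f) (eta g) = one A F.
Proof. by rewrite -etaM => ->. Qed.

(** All structure morphisms are images under [eta] of those of C acting on itself,
    so their coherence is inherited. The naturality with respect to morphisms of
    A, which [eta] need not reach, is given by the Tambara axioms of A. *)
Definition kleisli : modcat C := @ModCat k C kl_cat kl_act
  (fun F G f X => eta (tenm f (idm (X : C)))) kl_mactm_nat kl_mactm_lin
  (fun F X => congr1 (@eta _ _) (tenm1 F (X : C)))
  (fun F G H g f X => etrans (congr1 (@eta _ _) (reg_mactmM g f X)) (etaM _ _))
  (fun G F X => eta (asso_inv G F X)) (fun G F X => eta (asso G F X))
  (fun G F X => eta_iso (assoVK G F X)) (fun G F X => eta_iso (assoK G F X))
  kl_mul_natX kl_mul_nat
  (fun X => eta (luni_inv X)) (fun X => eta (luni X))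
  (fun X => eta_iso (luniVK X)) (fun X => eta_iso (luniK X))
  kl_one_nat kl_mulA_coh kl_mul1l kl_mul1r.

Lemma kleisli_generator : very_cyclic_generator (tunit C : kleisli).
Proof.
move=> F; exists F, (eta (runi_inv F)), (eta (runi F)).
by split; apply: eta_iso; rewrite ?runiVK ?runiK.
Qed.

End Kleisli.

(** * Restriction of bimodules along monoid morphisms *)
Section Restriction.
Context (k : fieldType) (C : moncat k) (M : modcat C).

Record monmor (A A' : tmonoid M) := MonMor {
  mm_mor :> tmor A A';
  mm_mul : forall F H G (a : A F H) (b : A H G),
    mm_mor F G (mul a b) = mul (mm_mor F H a) (mm_mor H G b);
  mm_one : tcomp mm_mor (mon_one A) = mon_one A' }.

Definition mm_id (A : tmonoid M) : monmor A A :=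
  @MonMor A A (tid A) (fun _ _ _ _ _ => erefl) (tcomp1l _).

Context (A A' B B' : tmonoid M) (f : monmor A A') (g : monmor B B') (P : bimod A' B').

Definition res_lact : tmor (comp_tamb B P) P := tcomp (lact P) (thcomp g (tid P)).
Definition res_ract : tmor (comp_tamb P A) P := tcomp (ract P) (thcomp (tid P) f).

Lemma res_lact_gen F G H (b : B F H) (p : P H G) :
  res_lact F G (cgen b p) = lc (g F H b) p.
Proof. by rewrite tcompE thcomp_gen. Qed.

Lemma res_ract_gen F G H (p : P F H) (a : A H G) :
  res_ract F G (cgen p a) = rc p (f H G a).
Proof. by rewrite tcompE thcomp_gen. Qed.

Lemma res_lact_mul : tcomp res_lact (thcomp (mon_mul B) (tid P))
    = tcomp res_lact (tcomp (thcomp (tid B) res_lact) (tass B B P)).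
Proof.
apply: tmor_comp_eql => F G H K b b' p.
by rewrite !(tcompE res_lact) tcompE tass_gen !thcomp_gen !res_lact_gen -lc_mul -mm_mul.
Qed.

Lemma res_lact_one : tcomp res_lact (thcomp (mon_one B) (tid P)) = tlun P.
Proof.
rewrite -lact_one -(mm_one g); apply: tmor_comp_eq => F G H b p.
by rewrite (tcompE res_lact) tcompE !thcomp_gen res_lact_gen.
Qed.

Lemma res_ract_mul : tcomp res_ract (thcomp res_ract (tid A))
    = tcomp res_ract (tcomp (thcomp (tid P) (mon_mul A)) (tass P A A)).
Proof.
apply: tmor_comp_eql => F G H K p a a'.
by rewrite !(tcompE res_ract) tcompE tass_gen !thcomp_gen !res_ract_gen rc_mul -mm_mul.
Qed.

Lemma res_ract_one : tcomp res_ract (thcomp (tid P) (mon_one A)) = trun P.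
Proof.
rewrite -ract_one -(mm_one f); apply: tmor_comp_eq => F G H p a.
by rewrite (tcompE res_ract) tcompE !thcomp_gen res_ract_gen.
Qed.

Lemma res_lract : tcomp res_ract (thcomp res_lact (tid A))
    = tcomp res_lact (tcomp (thcomp (tid B) res_ract) (tass B P A)).
Proof.
apply: tmor_comp_eql => F G H K b p a.
rewrite (tcompE res_lact) (tcompE res_ract) tcompE tass_gen !thcomp_gen.
by rewrite res_lact_gen !res_ract_gen res_lact_gen lrc.
Qed.

Definition res : bimod A B :=
  BiMod res_lact_mul res_lact_one res_ract_mul res_ract_one res_lract.

Lemma lc_res F H G (b : B F H) (p : P H G) : lc (P := res) b p = lc (g F H b) p.
Proof. exact: res_lact_gen. Qed.

Lemma rc_res F H G (p : P F H) (a : A H G) : rc (P := res) p a = rc p (f H G a).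
Proof. exact: res_ract_gen. Qed.

End Restriction.

(** * Morita equivalence *)
Section Morita.
Context (k : fieldType) (C : moncat k) (M : modcat C).

Section Pairing.
Context (A B : tmonoid M) (P : bimod A B) (Q : bimod B A).
Context (mu : bimor (rt Q P) (reg_bimod A)) (nu : bimor (rt P Q) (reg_bimod B)).
Hypothesis munu : forall F H K G (q : Q F H) (p : P H K) (q' : Q K G),
  lc (mu F K (rgen q p) : A F K) q' = rc q (nu H G (rgen p q') : B H G).
Hypothesis numu : forall F H K G (p : P F H) (q : Q H K) (p' : P K G),
  lc (nu F K (rgen p q) : B F K) p' = rc p (mu H G (rgen q p') : A H G).
Hypothesis mu_one : forall F, exists H (q : Q F H) (p : P H F), mu F F (rgen q p) = one A F.

(** The classical argument: if the q_F (x) p_F pair to 1, then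
    a |-> q_F (x) p_F a inverts mu, since
    q_F (x) p_F mu(q, p) = q_F (x) nu(p_F, q) p = q_F nu(p_F, q) (x) p
    = mu(q_F, p_F) q (x) p = q (x) p. *)
Lemma pairing_iso : is_iso2 (B := Bimod M) mu.
Proof.
pose Y F := sval (cid (mu_one F)).
pose q F : Q F (Y F) := sval (cid (svalP (cid (mu_one F)))).
pose p F : P (Y F) F := sval (cid (svalP (cid (svalP (cid (mu_one F)))))).
have qp F : mu F F (rgen (q F) (p F)) = one A F.
  exact: svalP (cid (svalP (cid (svalP (cid (mu_one F)))))).
apply: (bimor_iso (s := mu) (r := fun F G (a : A F G) => rgen (q F) (rc (p F) a))) => F G.
- apply: rt_ext => [a u v|//|H q' p'].
    by rewrite tfunP (rcPr (A := A)) rgenPr.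
  rewrite -numu -[LHS]rgen_act -munu qp lc_one.
  by [].
- move=> a; rewrite -(rc_rgen (q F) (p F)) (bimor_rc mu) qp.
  exact: one_mul.
Qed.

End Pairing.

Lemma morita_equivalent (A B : tmonoid M) (P : bimod A B) (Q : bimod B A)
    (mu : bimor (rt Q P) (reg_bimod A)) (nu : bimor (rt P Q) (reg_bimod B)) :
    (forall F H K G (q : Q F H) (p : P H K) (q' : Q K G),
       lc (mu F K (rgen q p) : A F K) q' = rc q (nu H G (rgen p q') : B H G)) ->
    (forall F H K G (p : P F H) (q : Q H K) (p' : P K G),
       lc (nu F K (rgen p q) : B F K) p' = rc p (mu H G (rgen q p') : A H G)) ->
    (forall F, exists H (q : Q F H) (p : P H F), mu F F (rgen q p) = one A F) ->
    (forall F, exists H (p : P F H) (q : Q H F), nu F F (rgen p q) = one B F) ->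
  equivalent (B := Bimod M) B A.
Proof.
move=> munu numu mu_one nu_one; exists Q, P, nu, mu.
by split; apply: pairing_iso.
Qed.

End Morita.

(** * The bracket of the Kleisli category at the unit object *)
Section KleisliBracket.
Context (k : fieldType) (C : moncat k).
Local Notation CC := (regular C).
Context (A : tmonoid CC).
Local Notation KA := (kleisli A).
Local Notation I := (tunit C : KA).
Local Notation E := (br_monoid I).

(** [I, I](F, G) consists of the elements of A(F (x) I, G (x) I), so the right unitor
    identifies it with A(F, G). *)
Definition kl_iso_fun (F G : CC) (a : A F G) : E F G :=
  pmap (p := A) (runi F : hom (l := CC) _ _) (runi_inv G : hom (l := CC) _ _) a.

Definition kl_iso_inv (F G : CC) (a : E F G) : A F G :=
  pmap (p := A) (runi_inv F : hom (l := CC) _ _) (runi G : hom (l := CC) _ _) (a : A _ _).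

Lemma kl_isoK F G : cancel (@kl_iso_fun F G) (@kl_iso_inv F G).
Proof. by move=> a; rewrite /kl_iso_inv /kl_iso_fun -pmapM !runiVK pmap1. Qed.

Lemma kl_iso_invK F G : cancel (@kl_iso_inv F G) (@kl_iso_fun F G).
Proof. by move=> a; rewrite /kl_iso_inv /kl_iso_fun -pmapM !runiK pmap1. Qed.

Lemma kl_iso_lin F G : linear (@kl_iso_fun F G).
Proof. exact: pmap_lin. Qed.

Lemma kl_homprof (x y z t : C) (f : hom x y) (a : A y z) (g : hom z t) :
  homprof_map (M := kl_cat A) (eta A f) (eta A g) a
  = pmap (p := A) (f : hom (l := CC) _ _) (g : hom (l := CC) _ _) a.
Proof. by rewrite /homprof_map /= mul_eta eta_mul -pmap_lr. Qed.

Lemma kl_iso_nat (F F' G G' : CC) (f : hom F' F) (g : hom G G') (a : A F G) :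
  kl_iso_fun (pmap f g a) = pmap f g (kl_iso_fun a).
Proof.
rewrite [RHS](kl_homprof (tenm f (idm (tunit C))) (kl_iso_fun a) (tenm g (idm (tunit C)))).
have e : runi_inv G' ∘ g = tenm g (idm (tunit C)) ∘ runi_inv G.
  apply: (cmp_mono (runiK G')).
  by rewrite !cmpA runiVK cmp1m runi_nat -cmpA runiVK cmpm1.
by rewrite /kl_iso_fun -!pmapM -runi_nat e.
Qed.

Lemma kl_iso_str (H : C) (F G : CC) (a : A F G) :
  kl_iso_fun (tstr A H a) = tstr E H (kl_iso_fun a).
Proof.
rewrite [RHS](kl_homprof (asso H F (tunit C)) (tstr A H (kl_iso_fun a)) (asso_inv H G (tunit C))).
rewrite /kl_iso_fun tstr_nat -!pmapM /=.
by rewrite -runi_ten -runi_inv_ten.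
Qed.

Definition kl_iso_tmor : tmor A E := TMor kl_iso_lin kl_iso_nat kl_iso_str.

Lemma kl_iso_mul F H G (a : A F H) (b : A H G) :
  kl_iso_tmor F G (mul a b) = mul (kl_iso_tmor F H a) (kl_iso_tmor H G b).
Proof.
rewrite mul_br /= /kl_iso_fun -mul_natA.
(* The unitor and its inverse meet at H and cancel across the product. *)
rewrite [pmap (runi F) (runi_inv H) a]pmap_rl [RHS](lc_bal (P := reg_bimod A)).
by rewrite -pmapM runiVK cmp1m.
Qed.

Lemma kl_iso_one : tcomp kl_iso_tmor (mon_one A) = mon_one E.
Proof.
apply: tmor_eq => F G f; rewrite tcompE /= /br_one_fun /= /kl_iso_fun /eta -tfun_nat.
congr (mon_one A _ _ _); rewrite /= /homprof_map.
apply: (cmp_mono (runiK G)); rewrite !cmpA runiVK cmp1m.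
exact: esym (runi_nat f).
Qed.

Definition kl_iso : monmor A E := MonMor kl_iso_mul kl_iso_one.

End KleisliBracket.

(** * Change of generator *)
Section Generators.
Context (k : fieldType) (C : moncat k) (M : modcat C) (X X0 : M).
Context (fX : frame X) (fX0 : frame X0).
Local Notation CC := (regular C).
Context (A : tmonoid CC) (phi : monmor A (br_monoid X)).
Context (psi : tmor (br_monoid X) A).
Hypothesis phiK : forall F G, cancel (phi F G) (psi F G).
Hypothesis psiK : forall F G, cancel (psi F G) (phi F G).
Local Notation E := (br_monoid X0).

(** The bimodules Hom[X0, X] and Hom[X, X0] of the Morita context, with A acting
    through [phi]. Both pairings are composition in M. *)
Definition gP : bimod A E := res phi (mm_id E) (br_bimod X0 X (hom_tamb M)).
Definition gQ : bimod E A := res (mm_id E) phi (br_bimod X X0 (hom_tamb M)).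

Lemma lc_gP (F H G : CC) (e : E F H) (p : gP H G) :
  lc e p = (p : hom _ _) ∘ (e : hom _ _).
Proof. by rewrite lc_res lc_br /= /homprof_map cmp1m. Qed.

Lemma rc_gP (F H G : CC) (p : gP F H) (a : A H G) :
  rc p a = (phi H G a : hom _ _) ∘ (p : hom _ _).
Proof. by rewrite rc_res rc_br /= /homprof_map cmpm1. Qed.

Lemma lc_gQ (F H G : CC) (a : A F H) (q : gQ H G) :
  lc a q = (q : hom _ _) ∘ (phi F H a : hom _ _).
Proof. by rewrite lc_res lc_br /= /homprof_map cmp1m. Qed.

Lemma rc_gQ (F H G : CC) (q : gQ F H) (e : E H G) :
  rc q e = (e : hom _ _) ∘ (q : hom _ _).
Proof. by rewrite rc_res rc_br /= /homprof_map cmpm1. Qed.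

Definition nu_fun (F G H : CC) (p : gP F H) (q : gQ H G) : E F G :=
  (q : hom _ _) ∘ (p : hom _ _).

Lemma nu_bal F G : rbal (Q := gP) (P := gQ) (@nu_fun F G).
Proof.
split; first split=> [H q a u v|H p a u v|H H' h p q].
- exact: cmpPr.
- exact: cmpPl.
- by rewrite /nu_fun /= /br_map /= /homprof_map !mactm1 cmp1m cmpm1 cmpA.
- by move=> H H' p a q; rewrite /nu_fun rc_gP lc_gQ cmpA.
Qed.

Lemma nu_nat (F F' G G' : CC) (f : hom F' F) (g : hom G G') H (p : gP F H) (q : gQ H G) :
  nu_fun (pmap f (idm H) p) (pmap (idm H) g q) = pmap f g (nu_fun p q).
Proof. by rewrite /nu_fun /= /br_map /= /homprof_map !mactm1 cmp1m cmpm1 !cmpA. Qed.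

Lemma nu_str (K : C) (F G H : CC) (p : gP F H) (q : gQ H G) :
  nu_fun (tstr gP K p) (tstr gQ K q) = tstr E K (nu_fun p q).
Proof.
rewrite /nu_fun /= /br_str /= /homprof_map fmapM -!cmpA; congr (_ ∘ (_ ∘ _)).
by rewrite !cmpA mmulK cmp1m.
Qed.

Lemma nu_l F G U H (e : E F U) (p : gP U H) (q : gQ H G) :
  nu_fun (lc e p) q = lc (P := reg_bimod E) e (nu_fun p q).
Proof. by rewrite [RHS]mul_br lc_gP /nu_fun cmpA. Qed.

Lemma nu_r F G U H (p : gP F H) (q : gQ H U) (e : E U G) :
  nu_fun p (rc q e) = rc (P := reg_bimod E) (nu_fun p q) e.
Proof. by rewrite [RHS]mul_br rc_gQ /nu_fun cmpA. Qed.

Definition nu : bimor (rt gP gQ) (reg_bimod E) :=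
  blift (R := reg_bimod E) nu_bal nu_nat nu_str nu_l nu_r.

Definition comp_fun (F G H : CC) (q : gQ F H) (p : gP H G) : br_monoid X F G :=
  (p : hom _ _) ∘ (q : hom _ _).

Definition mu_fun (F G H : CC) (q : gQ F H) (p : gP H G) : A F G :=
  psi F G (comp_fun q p).

Lemma mu_bal F G : rbal (Q := gQ) (P := gP) (@mu_fun F G).
Proof.
split; first split=> [H p a u v|H q a u v|H H' h q p].
- by rewrite /mu_fun -tfunP; congr (psi _ _ _); apply: cmpPr.
- by rewrite /mu_fun -tfunP; congr (psi _ _ _); apply: cmpPl.
- rewrite /mu_fun /comp_fun; congr (psi _ _ _).
  by rewrite /= /br_map /= /homprof_map !mactm1 cmp1m cmpm1 cmpA.
- by move=> H H' q e p; rewrite /mu_fun /comp_fun rc_gQ lc_gP cmpA.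
Qed.

Lemma mu_nat (F F' G G' : CC) (f : hom F' F) (g : hom G G') H (q : gQ F H) (p : gP H G) :
  mu_fun (pmap f (idm H) q) (pmap (idm H) g p) = pmap f g (mu_fun q p).
Proof.
rewrite /mu_fun -tfun_nat; congr (psi _ _ _).
by rewrite /comp_fun /= /br_map /= /homprof_map !mactm1 cmp1m cmpm1 !cmpA.
Qed.

Lemma mu_str (K : C) (F G H : CC) (q : gQ F H) (p : gP H G) :
  mu_fun (tstr gQ K q) (tstr gP K p) = tstr A K (mu_fun q p).
Proof.
rewrite /mu_fun -tfun_str; congr (psi _ _ _).
rewrite /comp_fun /= /br_str /= /homprof_map fmapM -!cmpA; congr (_ ∘ (_ ∘ _)).
by rewrite !cmpA mmulK cmp1m.
Qed.

Lemma mu_l F G U H (a : A F U) (q : gQ U H) (p : gP H G) :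
  mu_fun (lc a q) p = lc (P := reg_bimod A) a (mu_fun q p).
Proof.
apply: (can_inj (@phiK F G)).
by rewrite [in RHS]mm_mul !psiK mul_br /comp_fun lc_gQ cmpA.
Qed.

Lemma mu_r F G U H (q : gQ F H) (p : gP H U) (a : A U G) :
  mu_fun q (rc p a) = rc (P := reg_bimod A) (mu_fun q p) a.
Proof.
apply: (can_inj (@phiK F G)).
by rewrite [in RHS]mm_mul !psiK mul_br /comp_fun rc_gP cmpA.
Qed.

Definition mu : bimor (rt gQ gP) (reg_bimod A) :=
  blift (R := reg_bimod A) mu_bal mu_nat mu_str mu_l mu_r.

(** That X0 generates makes F X isomorphic to some H X0, so that the identity of F X
    factors as a pairing; that X generates does the same for F X0. *)
Lemma generator_equivalent : equivalent (B := Bimod CC) E A.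
Proof.
apply: (morita_equivalent (mu := mu) (nu := nu)).
- move=> F H K G q p q'; rewrite lc_gQ rc_gQ [nu _ _ _]blift_gen [mu _ _ _]blift_gen.
  by rewrite psiK /nu_fun /comp_fun cmpA.
- move=> F H K G p q p'; rewrite lc_gP rc_gP [nu _ _ _]blift_gen [mu _ _ _]blift_gen.
  by rewrite psiK /nu_fun /comp_fun cmpA.
- move=> F; exists (fr_ob fX0 (mact M F X)), (fr_in fX0 (mact M F X)), (fr_out fX0 (mact M F X)).
  rewrite [mu _ _ _]blift_gen /mu_fun /comp_fun fr_inK -(one_br X F).
  by rewrite -[one (br_monoid X) F](tmor_eqP (mm_one phi)) phiK.
- move=> F; exists (fr_ob fX (mact M F X0)), (fr_in fX (mact M F X0)), (fr_out fX (mact M F X0)).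
  by rewrite [nu _ _ _]blift_gen /nu_fun fr_inK one_br.
Qed.

End Generators.

(** * The biequivalence *)
Section Biequivalence.
Context (k : fieldType) (C : moncat k).
Context (W : forall M : {M : modcat C | very_cyclic M}, sval M).
Hypothesis hW : forall M : {M : modcat C | very_cyclic M}, very_cyclic_generator (W M).

Lemma NW_local_equivalence M N : local_equivalence (NW W) M N.
Proof.
have [fN] := generator_frame (@hW N); have [fM] := generator_frame (@hW M).
have [F_lin F_id F_vcomp _ _ _ _ _ _] := NW_psfun hW.
apply: fully_faithful_local_equivalence.
- exact: F_lin.
- exact: F_id.
- exact: F_vcomp.
- by move=> P Q s t; apply: (br_bimor_faithful fN fM).
- by move=> P Q s; apply: (br_bimor_full fN fM).
- by move=> p; apply: (br_bimod_surj fN fM).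
Qed.

Lemma NW_essentially_surjective (A : Bimod (regular C)) :
  exists M, equivalent (NW W M) A.
Proof.
pose K : {M : modcat C | very_cyclic M} :=
  exist _ (kleisli A) (ex_intro _ _ (@kleisli_generator k C A)).
have [fW] := generator_frame (@hW K).
have [fI] := generator_frame (@kleisli_generator k C A).
have [psi psiE] := tmor_inverse (s := kl_iso A) (@kl_isoK k C A) (@kl_iso_invK k C A).
exists K; apply: (generator_equivalent fI fW (phi := kl_iso A) (psi := psi)) => F G a.
- by rewrite psiE; apply: kl_isoK.
- by rewrite psiE; apply: kl_iso_invK.
Qed.

End Biequivalence.

Theorem theorem2 (k : fieldType) (C : moncat k)
    (W : forall M : {M : modcat C | very_cyclic M}, sval M)
    (hW : forall M : {M : modcat C | very_cyclic M}, very_cyclic_generator (W M)) :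
  biequivalence (NW W).
Proof.
split; first exact: NW_psfun.
- exact: NW_local_equivalence.
- exact: NW_essentially_surjective.
Qed.
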